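(* Let $\mathcal{W},\mathcal{V}$ be closed subspaces of $L^2(\mathbb{R})$ with $L^2(\mathbb{R})=\mathcal{W}\oplus\mathcal{V}^{\perp}$. Let $\phi,\phi_1\in L^2(\mathbb{R})$ be such that $\{T_k\phi\}_{k\in\mathbb{Z}}$ and $\{T_k\phi_1\}_{k\in\mathbb{Z}}$ are frames for $\mathcal{W}$ and $\mathcal{V}$, respectively. Then, for every $f\in L^2(\mathbb{R})$ (and a.e. $\gamma$), $$\widehat{\pi_{\mathcal{W}\mathcal{V}^{\perp}}f}(\gamma)=\begin{cases}\dfrac{[\widehat{f},\widehat{\phi_1}](\gamma)}{[\widehat{\phi},\widehat{\phi_1}](\gamma)}\,\widehat{\phi}(\gamma), & \gamma\in N(\Phi)^{c},\\[2mm] 0, & \gamma\in N(\Phi).\end{cases}$$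
   Context: $T_kf(x)=f(x-k)$ for $k\in\mathbb{Z}$. The Fourier transform is $\widehat{f}(\gamma)=\int_{\mathbb{R}}f(x)e^{-2\pi i x\gamma}\,dx$, extended to a unitary operator of $L^2(\mathbb{R})$. For $f,\psi\in L^2(\mathbb{R})$, the 1-periodic bracket is $[\widehat{f},\widehat{\psi}](\gamma)=\sum_{k\in\mathbb{Z}}\widehat{f}(\gamma+k)\overline{\widehat{\psi}(\gamma+k)}$ (a.e. defined, complex valued); $\Phi(\gamma)=\sum_{k\in\mathbb{Z}}|\widehat{\phi}(\gamma+k)|^2$, $N(\Phi)=\{\gamma:\Phi(\gamma)=0\}$; $A^c$ is the complement of $A$ in $\mathbb{R}$. (It is known that under the stated hypotheses $[\widehat{\phi},\widehat{\phi_1}]$ is nonzero a.e. on $N(\Phi)^c$.) The direct sum is not assumed orthogonal; $\pi_{\mathcal{W}\mathcal{V}^{\perp}}$ is the oblique projection onto $\mathcal{W}$ along $\mathcal{V}^{\perp}$ (identity on $\mathcal{W}$, zero on $\mathcal{V}^{\perp}$). A family $\{f_k\}\subset\mathcal{W}$ is a frame for $\mathcal{W}$ if there are $0<\alpha\le\beta<\infty$ with $\alpha\|f\|^2\le\sum_k|\langle f,f_k\rangle|^2\le\beta\|f\|^2$ for all $f\in\mathcal{W}$. *)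

(* Defs.v *)
From HB Require Import structures.
From mathcomp Require Import all_boot all_order all_algebra.
From mathcomp Require Import all_classical all_reals all_analysis.
From mathcomp Require Import complex.

Set Implicit Arguments.
Unset Strict Implicit.
Unset Printing Implicit Defensive.
Import Order.TTheory GRing.Theory Num.Theory.
Import numFieldNormedType.Exports.
Import ComplexField.Normc.

Local Open Scope classical_set_scope.
Local Open Scope ring_scope.
Local Open Scope complex_scope.

(* Elements of the complex space L^2(R) are represented by measurable,
   square-integrable functions R -> R[i]; two of them are the same element when
   they are equal almost everywhere for Lebesgue measure. *)

Section ComplexL2.
Context {R : realType}.
Local Notation mu := (@lebesgue_measure R).
Implicit Types (f g h : R -> R[i]) (W U V : set (R -> R[i])).

Definition L1fun : set (R -> R[i]) := [set f : R -> R[i] |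
  mu.-integrable [set: R] (EFin \o (fun x => complex.Re (f x))) /\
  mu.-integrable [set: R] (EFin \o (fun x => complex.Im (f x)))].

Definition L2fun : set (R -> R[i]) := [set f : R -> R[i] |
  (fun x => complex.Re (f x)) \in Lfun mu (2%:E : \bar R) /\
  (fun x => complex.Im (f x)) \in Lfun mu (2%:E : \bar R)].

Definition cintegral f : R[i] :=
  (\int[mu]_x complex.Re (f x)) +i* (\int[mu]_x complex.Im (f x)).

Definition inner f g : R[i] := cintegral (fun x => f x * (g x)^*).

(* the square of the L^2 norm *)
Definition normsq f : \bar R := (\int[mu]_x (normc (f x) ^+ 2)%:E)%E.

(* The last condition implies that a closed subspace contains, along with a
   function, all the functions of L2fun equal to it almost everywhere. *)
Definition closed_subspace W :=
  [/\ W `<=` L2fun,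
      W (cst 0),
      forall (a : R[i]) f g, W f -> W g -> W (fun x => a * f x + g x) &
      forall f, L2fun f ->
        (forall e : R, 0 < e ->
           exists2 g, W g & (normsq (fun x => f x - g x)%R < e%:E)%E) ->
        W f].

Definition orthogonal_complement V : set (R -> R[i]) :=
  [set f | L2fun f /\ forall g, V g -> inner f g = 0].

(* L^2(R) = W (+) U, not necessarily orthogonally *)
Definition direct_sum_L2 W U :=
  (forall f, L2fun f -> exists w u,
     [/\ W w, U u & f = (fun x => w x + u x) %[ae mu]]) /\
  (forall f, W f -> U f -> f = cst 0 %[ae mu]).

(* When direct_sum_L2 W U holds with W and U closed subspaces, this is, up to
   almost everywhere equality, the W-component of f in L^2(R) = W (+) U. *)
Definition oblique_projection W U f : R -> R[i] :=
  xget (cst 0) [set w | W w /\ U (fun x => f x - w x)].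

Definition translate (k : int) f : R -> R[i] := fun x => f (x - k%:~R).

Definition is_frame W (u : int -> (R -> R[i])) :=
  (forall k, W (u k)) /\
  exists alpha beta : R, [/\ 0 < alpha, alpha <= beta &
    forall f, W f ->
      (alpha%:E * normsq f <=
         \esum_(k in [set: int]) (normc (inner f (u k)) ^+ 2)%:E)%E /\
      (\esum_(k in [set: int]) (normc (inner f (u k)) ^+ 2)%:E <=
         beta%:E * normsq f)%E].

Definition expi (t : R) : R[i] := cos t +i* sin t.

Definition fourier_integral f : R -> R[i] :=
  fun gamma => cintegral (fun x => f x * expi (- (2 * pi * x * gamma))).

Definition unitary_L2 (F : (R -> R[i]) -> (R -> R[i])) :=
  [/\ forall f, L2fun f -> L2fun (F f),
      forall (a : R[i]) f g, L2fun f -> L2fun g ->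
        F (fun x => a * f x + g x) = (fun x => a * F f x + F g x) %[ae mu],
      forall f g, L2fun f -> L2fun g -> inner (F f) (F g) = inner f g &
      forall g, L2fun g -> exists2 f, L2fun f & F f = g %[ae mu]].

(* The Fourier transform of L^2(R): the unitary operator which extends the
   Fourier integral on L^1 and L^2 functions. It exists (Plancherel), and
   since these functions are dense it is unique up to almost everywhere
   equality, so that the choice made by xget is immaterial. *)
Definition fourier : (R -> R[i]) -> (R -> R[i]) :=
  xget (fun f => f) [set F : (R -> R[i]) -> (R -> R[i]) | unitary_L2 F /\
    forall f, L1fun f -> L2fun f -> F f = fourier_integral f %[ae mu]].

(* Positive part minus negative part: the sum of u over the integers when u is
   absolutely summable, and of no significance otherwise. *)
Definition zsum (u : int -> R) : R :=
  fine (\esum_(k in [set: int]) ((EFin \o u)^\+)%E k) -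
  fine (\esum_(k in [set: int]) ((EFin \o u)^\-)%E k).

Definition czsum (u : int -> R[i]) : R[i] :=
  zsum (fun k => complex.Re (u k)) +i* zsum (fun k => complex.Im (u k)).

(* f and g are meant to be Fourier transforms; the family is then absolutely
   summable for almost every gamma. *)
Definition bracket f g : R -> R[i] :=
  fun gamma => czsum (fun k => f (gamma + k%:~R) * (g (gamma + k%:~R))^*).

Definition periodization f : R -> \bar R :=
  fun gamma => (\esum_(k in [set: int])
    (normc (fourier f (gamma + k%:~R)) ^+ 2)%:E)%E.

Definition zero_set (Phi : R -> \bar R) : set R :=
  [set gamma | Phi gamma = 0%E].

End ComplexL2.

(* Main.v *)
(** Let [p] and [q] be the Fourier transforms of [phi] and [phi1].  On the
    Fourier side the translates of [phi] are the products of [p] with the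
    characters of the circle, and periodizing an integral over the line shows
    that the Fourier coefficients of the 1-periodic function [[u, p]] are the
    inner products of [u] with these products.  Hence [u] is orthogonal to all
    the translates exactly when [[u, p] = 0] a.e.

    It follows that the transform of [W] is the set of all square integrable
    products [m p] with [m] 1-periodic: such a product has no component
    orthogonal to [W], and for [w] in [W] the choice [m = [w, p] / [p, p]]
    leaves a difference with zero bracket against [p], which the lower frame
    bound kills.  If [E] is the set where [[p, q]] vanishes then [1_E p] lies
    in the transform of [W], and it is orthogonal to every [m q], hence to the
    transform of [V]; since the sum is direct it is zero, so that [p] vanishes
    on [E].  Finally the transform of the projection [w] of [f] is some [m p],
    and [f - w] is orthogonal to [V], so that [[f, q] = m [p, q]], which
    determines [m] wherever [p] is not zero.

    For the existence of the Fourier transform of L^2: on a function supported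
    in an interval, Parseval's formula for the Fourier series over that
    interval, and over its modulations, gives the isometry; the rest is
    density, and surjectivity comes from the multiplication formula. *)

Require Import Defs.
From HB Require Import structures.
From mathcomp Require Import all_boot all_order all_algebra.
From mathcomp Require Import all_classical all_reals all_analysis.
From mathcomp Require Import measurable_realfun complex.
From mathcomp Require Import ring lra zify.

Set Implicit Arguments.
Unset Strict Implicit.
Unset Printing Implicit Defensive.
Import Order.TTheory GRing.Theory Num.Theory.
Import numFieldNormedType.Exports.
Import ComplexField.Normc.

Local Open Scope classical_set_scope.
Local Open Scope ring_scope.
Local Open Scope complex_scope.
Local Notation "x ^*" := (conjc x) : ring_scope.

(** * Complex inner product spaces *)

(** The definition of [fourier] selects an operator by its properties, so Plancherel's theorem must
    be proved before anything can be said of it, and afterwards only those properties are available: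
    even the rule for translates is then derived by density. Two kinds of inner product space occur:
    the square integrable functions on the line and, for almost every [gamma], the square summable
    sequences indexed by the fibre [gamma + Z]. Both are instances of [L2], for Lebesgue and for
    counting measure. The bracket is the inner product of two fibres, and so inherits its linearity
    and its Cauchy-Schwarz inequality. A bracket is integrable over a period but may fail to be
    square integrable there. Its vanishing must therefore be read off its Fourier coefficients in
    L^1, beyond the reach of orthonormal expansions. [trigonometric_uniqueness] does this by
    approximating indicators of intervals pointwise and differentiating the primitive. The same
    result supplies the completeness of the exponentials in Plancherel's theorem. *)

Section ComplexNumbers.
Context {R : realType}.
Implicit Types a b z : R[i].

(** The squared modulus as a polynomial in the two coordinates: it is open to [ring] and [lra], and
    its measurability is immediate. *)
Definition sqn z : R := complex.Re z ^+ 2 + complex.Im z ^+ 2.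

Lemma normc_sqr z : normc z ^+ 2 = sqn z.
Proof. by case: z => x y; rewrite /normc sqr_sqrtr// addr_ge0// sqr_ge0. Qed.

Lemma sqn_ge0 z : 0 <= sqn z.
Proof. by rewrite addr_ge0// sqr_ge0. Qed.

Lemma cReD a b : complex.Re (a + b) = complex.Re a + complex.Re b.
Proof. by case: a b => [x y] []. Qed.
Lemma cImD a b : complex.Im (a + b) = complex.Im a + complex.Im b.
Proof. by case: a b => [x y] []. Qed.
Lemma cReN a : complex.Re (- a) = - complex.Re a. Proof. by case: a. Qed.
Lemma cImN a : complex.Im (- a) = - complex.Im a. Proof. by case: a. Qed.
Lemma cReM a b : complex.Re (a * b) =
  complex.Re a * complex.Re b - complex.Im a * complex.Im b.
Proof. by case: a b => [x y] []. Qed.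
Lemma cImM a b : complex.Im (a * b) =
  complex.Re a * complex.Im b + complex.Im a * complex.Re b.
Proof. by case: a b => [x y] []. Qed.
Lemma cReJ a : complex.Re (a^*) = complex.Re a. Proof. by case: a. Qed.
Lemma cImJ a : complex.Im (a^*) = - complex.Im a. Proof. by case: a. Qed.
Lemma conjcM a b : (a * b)^* = a^* * b^*.
Proof. exact: rmorphM. Qed.
Definition cReImE := (cReD, cImD, cReN, cImN, cReM, cImM, cReJ, cImJ).

Lemma complexP a b : complex.Re a = complex.Re b ->
  complex.Im a = complex.Im b -> a = b.
Proof. by case: a b => [x y] [x' y'] /= -> ->. Qed.

Lemma sqnM a b : sqn (a * b) = sqn a * sqn b.
Proof. by rewrite /sqn !cReImE; ring. Qed.
Lemma sqnJ a : sqn (a^*) = sqn a.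
Proof. by rewrite /sqn !cReImE sqrrN. Qed.
Lemma sqn_eq0 a : sqn a = 0 -> a = 0.
Proof.
move/eqP; rewrite paddr_eq0 ?sqr_ge0// !sqrf_eq0 => /andP[/eqP ? /eqP ?].
exact: complexP.
Qed.
Lemma sqnE a : (sqn a)%:C = a * a^*.
Proof. by apply: complexP; rewrite !cReImE /= /sqn; ring. Qed.
Lemma sqn_real (x : R) : sqn x%:C = x ^+ 2.
Proof. by rewrite /sqn/= expr0n addr0. Qed.
Lemma sqnD a b : sqn (a + b) <= 2 * sqn a + 2 * sqn b.
Proof.
rewrite /sqn !cReImE; move: (complex.Re a) (complex.Im a) => x y.
move: (complex.Re b) (complex.Im b) => x' y'.
have := sqr_ge0 (x - x'); have := sqr_ge0 (y - y'); rewrite !expr2; lra.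
Qed.

End ComplexNumbers.

(** * Semidefinite inner products: Cauchy-Schwarz, limits, projections, Bessel sums *)

Section Prehilbert.
Context {R : realType} {V : lmodType R[i]}.

(** The form is only semidefinite, as is natural on functions not yet identified almost everywhere.
    Limits are accordingly unique up to seminorm zero. *)
Record prehilbert (ip : V -> V -> R[i]) : Prop := Prehilbert {
  ip_linear : forall a u v w, ip (a *: u + v) w = a * ip u w + ip v w ;
  ip_conj : forall u v, ip v u = (ip u v)^* ;
  ip_ge0 : forall u, 0 <= complex.Re (ip u u) }.

Variable ip : V -> V -> R[i].
Hypothesis Hip : prehilbert ip.
Implicit Types f u v w : V.

Definition hnorm2 u : R := complex.Re (ip u u).
Definition hcvg (s_ : nat -> V) (l : V) := hnorm2 (s_ n - l) @[n --> \oo] --> 0.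
Definition hcauchy (s_ : nat -> V) := forall e : R, 0 < e ->
  exists N : nat, forall m n, (N <= m)%N -> (N <= n)%N -> hnorm2 (s_ m - s_ n) < e.
Definition hcomplete := forall s_, hcauchy s_ -> exists l, hcvg s_ l.

Local Notation N := hnorm2.

Lemma ipDl u v w : ip (u + v) w = ip u w + ip v w.
Proof. by have := ip_linear Hip 1 u v w; rewrite scale1r mul1r. Qed.
Lemma ip0l w : ip 0 w = 0.
Proof. by apply: (addrI (ip 0 w)); rewrite -ipDl !addr0. Qed.
Lemma ipZl a u w : ip (a *: u) w = a * ip u w.
Proof. by have := ip_linear Hip a u 0 w; rewrite !addr0 ip0l addr0. Qed.
Lemma ipNl u w : ip (- u) w = - ip u w.
Proof. by rewrite -scaleN1r ipZl mulN1r. Qed.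
Lemma ipBl u v w : ip (u - v) w = ip u w - ip v w.
Proof. by rewrite ipDl ipNl. Qed.
Lemma ipDr u v w : ip w (u + v) = ip w u + ip w v.
Proof. by rewrite (ip_conj Hip) ipDl rmorphD/= -!(ip_conj Hip). Qed.
Lemma ipZr a u w : ip w (a *: u) = a^* * ip w u.
Proof. by rewrite (ip_conj Hip) ipZl rmorphM/= -(ip_conj Hip). Qed.
Lemma ipNr u w : ip w (- u) = - ip w u.
Proof. by rewrite (ip_conj Hip) ipNl rmorphN/= -(ip_conj Hip). Qed.
Lemma ipBr u v w : ip w (u - v) = ip w u - ip w v.
Proof. by rewrite ipDr ipNr. Qed.

Lemma hnorm2E u : ip u u = (N u)%:C.
Proof.
apply: complexP => //=; have := congr1 (@complex.Im R) (ip_conj Hip u u).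
by rewrite cImJ => ?; lra.
Qed.

Lemma Re_ipC u v : complex.Re (ip v u) = complex.Re (ip u v).
Proof. by rewrite (ip_conj Hip) cReJ. Qed.

Lemma hnorm2D u v : N (u + v) = N u + 2 * complex.Re (ip u v) + N v.
Proof. rewrite /N ipDl !ipDr !cReD (Re_ipC u v); lra. Qed.
Lemma hnorm2N u : N (- u) = N u.
Proof. by rewrite /N ipNl ipNr opprK. Qed.
Lemma hnorm2B u v : N (u - v) = N u - 2 * complex.Re (ip u v) + N v.
Proof. by rewrite hnorm2D hnorm2N ipNr cReN mulrN. Qed.
Lemma hnorm2BC u v : N (u - v) = N (v - u).
Proof. by rewrite -hnorm2N opprB. Qed.
Lemma hnorm2Z a u : N (a *: u) = sqn a * N u.
Proof. by rewrite {1}/N ipZl ipZr mulrA -sqnE hnorm2E -rmorphM. Qed.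
Lemma hnorm20 : N 0 = 0.
Proof. by rewrite /N ip0l. Qed.
Lemma hnorm2_ge0 u : 0 <= N u. Proof. exact: ip_ge0. Qed.

Lemma hnorm2_subl f u v : N ((f - u) - (f - v)) = N (u - v).
Proof. by rewrite opprB addrC addrA subrK hnorm2BC. Qed.

Lemma hnorm2D_le u v : N (u + v) <= 2 * N u + 2 * N v.
Proof. have := hnorm2_ge0 (u - v); rewrite hnorm2B hnorm2D; lra. Qed.

Lemma hnorm2_triangle u v w : N (u - w) <= 2 * N (u - v) + 2 * N (v - w).
Proof. by have := hnorm2D_le (u - v) (v - w); rewrite addrA subrK. Qed.

Lemma Re_ip_cauchy_schwarz u v : complex.Re (ip u v) ^+ 2 <= N u * N v.
Proof.
set b := complex.Re _.
have P (t : R) : 0 <= N u - 2 * (t * b) + t ^+ 2 * N v.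
  have := hnorm2_ge0 (u - t%:C *: v).
  rewrite hnorm2B ipZr hnorm2Z sqn_real.
  by rewrite cReM cReJ cImJ/= oppr0 mul0r subr0.
have [v0|v0] := eqVneq (N v) 0.
  have [->|b0] := eqVneq b 0; first by rewrite expr0n mulr_ge0// hnorm2_ge0.
  (* When [N v = 0] the bound [P] is affine in [t], and this [t] gives it the value -1. *)
  have := P ((N u + 1) / (2 * b)); rewrite v0 mulr0 addr0.
  have -> : 2 * ((N u + 1) / (2 * b) * b) = N u + 1 by field.
  by rewrite opprD addrA subrr sub0r oppr_ge0 ler10.
have vp : 0 < N v by rewrite lt0r v0 hnorm2_ge0.
have := P (b / N v).
have -> : N u - 2 * (b / N v * b) + (b / N v) ^+ 2 * N v = N u - b ^+ 2 / N v.
  by field.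
by rewrite subr_ge0 ler_pdivrMr.
Qed.

Lemma cauchy_schwarz u v : sqn (ip u v) <= N u * N v.
Proof.
set z := ip u v.
have [->|z0] := eqVneq z 0.
  by rewrite /sqn/= !expr0n/= addr0 mulr_ge0// hnorm2_ge0.
have zp : 0 < sqn z.
  by rewrite lt0r sqn_ge0 andbT; apply: contra_neq z0; exact: sqn_eq0.
(* Multiplying [u] by the conjugate of [z] makes the inner product the real number [sqn z], so that
   the real case applies; one factor [sqn z] then cancels. *)
have := Re_ip_cauchy_schwarz (z^* *: u) v.
rewrite ipZl hnorm2Z sqnJ -/z mulrC -sqnE /= expr2 -mulrA.
by rewrite ler_pM2l.
Qed.

Lemma Re_ip_le u v : `|complex.Re (ip u v)| <= Num.sqrt (N u) * Num.sqrt (N v).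
Proof.
rewrite -sqrtrM ?hnorm2_ge0// -sqrtr_sqr ler_wsqrtr//.
exact: Re_ip_cauchy_schwarz.
Qed.

Lemma hcvg_sqrt s_ l : hcvg s_ l -> Num.sqrt (N (s_ n - l)) @[n --> \oo] --> 0.
Proof.
move=> ul; rewrite -[X in _ --> X](@sqrtr0 R).
by apply: continuous_cvg => //; exact: sqrt_continuous.
Qed.

Lemma hcvg_Re_ip s_ t_ l m : hcvg s_ l -> hcvg t_ m ->
  complex.Re (ip (s_ n) (t_ n)) @[n --> \oo] --> complex.Re (ip l m).
Proof.
move=> /hcvg_sqrt ul /hcvg_sqrt vm.
pose s n := Num.sqrt (N (s_ n - l)); pose t n := Num.sqrt (N (t_ n - m)).
apply/cvgrPdistC_le => e e0.
have : s n * t n + s n * Num.sqrt (N m) + Num.sqrt (N l) * t n @[n --> \oo] -->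
   (0 * 0 + 0 * Num.sqrt (N m) + Num.sqrt (N l) * 0 : R).
  apply: cvgD; last by apply: cvgM => //; exact: cvg_cst.
  by apply: cvgD; apply: cvgM => //; exact: cvg_cst.
rewrite !mulr0 mul0r !addr0 => /cvgr_le/(_ e e0).
apply: filterS => n; apply: le_trans.
have -> : complex.Re (ip (s_ n) (t_ n)) - complex.Re (ip l m) =
    complex.Re (ip (s_ n - l) (t_ n - m)) + complex.Re (ip (s_ n - l) m) +
    complex.Re (ip l (t_ n - m)).
  by rewrite !(ipBl, ipBr, cReD, cReN); ring.
apply: (le_trans (ler_normD _ _)); apply: lerD; last exact: Re_ip_le.
by apply: (le_trans (ler_normD _ _)); apply: lerD; exact: Re_ip_le.
Qed.

Lemma hcvg_cst l : hcvg (fun=> l) l.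
Proof. by rewrite /hcvg subrr hnorm20; exact: cvg_cst. Qed.

(** Isometries and adjunction formulas pass from truncated functions to all of L^2 by this
    continuity argument. Real parts converge; multiplying by ['i] reduces imaginary parts to real
    ones. *)
Lemma hcvg_ip_eq s_ t_ l m s'_ t'_ l' m' :
    hcvg s_ l -> hcvg t_ m -> hcvg s'_ l' -> hcvg t'_ m' ->
    (forall n, ip (s_ n) (t_ n) = ip (s'_ n) (t'_ n)) ->
  ip l m = ip l' m'.
Proof.
have Re_eq p_ q_ p q p'_ q'_ p' q' : hcvg p_ p -> hcvg q_ q -> hcvg p'_ p' ->
    hcvg q'_ q' -> (forall n, ip (p_ n) (q_ n) = ip (p'_ n) (q'_ n)) ->
    complex.Re (ip p q) = complex.Re (ip p' q').
  move=> pp qq pp' qq' E.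
  have /cvg_lim <- := hcvg_Re_ip pp qq; last by [].
  under eq_fun do rewrite E.
  by apply: cvg_lim => //; exact: hcvg_Re_ip.
have hcvgZ a p_ p : hcvg p_ p -> hcvg (fun n => a *: p_ n) (a *: p).
  move=> pp; rewrite /hcvg -[X in _ --> X](mulr0 (sqn a)).
  under eq_fun do rewrite -scalerBr hnorm2Z.
  by apply: cvgM => //; exact: cvg_cst.
move=> ul vm ul' vm' E; apply: complexP; first exact: (Re_eq s_ t_ l m s'_ t'_).
have := Re_eq _ t_ _ m _ t'_ _ m' (hcvgZ 'i _ _ ul) vm (hcvgZ 'i _ _ ul') vm'.
rewrite !ipZl !cReM/= !mul0r !mul1r !sub0r => H; apply: oppr_inj; apply: H => n.
by rewrite !ipZl E.
Qed.

Lemma hcvg_hnorm2 s_ l : hcvg s_ l -> N (s_ n) @[n --> \oo] --> N l.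
Proof. by move=> ul; exact: hcvg_Re_ip. Qed.

Lemma hcvg_unique s_ l m : hcvg s_ l -> hcvg s_ m -> N (l - m) = 0.
Proof.
move=> ul um; apply/eqP; rewrite eq_le hnorm2_ge0 andbT.
have cv : 2 * N (s_ n - l) + 2 * N (s_ n - m) @[n --> \oo] -->
    (2 * 0 + 2 * 0 : R).
  by apply: cvgD; apply: cvgM => //; exact: cvg_cst.
rewrite !mulr0 addr0 in cv; apply: (cvgr_to_ge cv).
by apply: nearW => n; rewrite (hnorm2BC (s_ n)); exact: hnorm2_triangle.
Qed.

Lemma hnorm2_eq0_ip u v : N u = 0 -> ip u v = 0.
Proof.
move=> u0; apply: sqn_eq0; apply/eqP; rewrite eq_le sqn_ge0 andbT.
by apply: (le_trans (cauchy_schwarz u v)); rewrite u0 mul0r.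
Qed.

Lemma hnorm2_eq0_sub u v w : N (u - v) = 0 -> N (u - w) = N (v - w).
Proof.
move=> uv; rewrite (_ : u - w = (u - v) + (v - w)); last by rewrite addrA subrK.
by rewrite hnorm2D (hnorm2_eq0_ip _ uv) uv/= mulr0 addr0 add0r.
Qed.

Lemma hcvg_cauchy s_ l : hcvg s_ l -> hcauchy s_.
Proof.
move=> ul e e0; have e4 : 0 < e / 4 by lra.
move/cvgr_lt : ul => /(_ _ e4)[M _ HM]; exists M => m n Mm Mn.
have := hnorm2_triangle (s_ m) l (s_ n); rewrite (hnorm2BC l).
have := HM _ Mm; have := HM _ Mn; rewrite /=; lra.
Qed.

Lemma hcvg_lin a s_ l t_ m : hcvg s_ l -> hcvg t_ m ->
  hcvg (fun n => a *: s_ n + t_ n) (a *: l + m).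
Proof.
move=> sl tm.
have c : 2 * (sqn a * N (s_ n - l)) + 2 * N (t_ n - m) @[n --> \oo] -->
    (2 * (sqn a * 0) + 2 * 0 : R).
  by apply: cvgD; apply: cvgM => //; [exact: cvg_cst|apply: cvgM => //; exact: cvg_cst|exact: cvg_cst].
rewrite !mulr0 addr0 in c.
apply: (@squeeze_cvgr _ _ _ _ (fun=> 0) _ _ _ _ _ c); last exact: cvg_cst.
apply: nearW => n; rewrite hnorm2_ge0/= opprD addrACA -scalerBr -hnorm2Z.
exact: hnorm2D_le.
Qed.

Lemma hcvg_le s_ l t_ m : (forall n, N (s_ n - l) <= N (t_ n - m)) -> hcvg t_ m -> hcvg s_ l.
Proof.
move=> st tm; apply: (@squeeze_cvgr _ _ _ _ (fun=> 0) _ _ _ _ _ tm); last exact: cvg_cst.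
by apply: nearW => n; rewrite hnorm2_ge0 st.
Qed.

Lemma polarization (A B : V -> V) : (forall a u v, A (a *: u + v) = a *: A u + A v) ->
    (forall a u v, B (a *: u + v) = a *: B u + B v) -> (forall u, N (A u) = N (B u)) ->
  forall u v, ip (A u) (A v) = ip (B u) (B v).
Proof.
move=> lA lB AB.
have Re_eq u v : complex.Re (ip (A u) (A v)) = complex.Re (ip (B u) (B v)).
  have := AB (1 *: u + v); rewrite lA lB !scale1r !hnorm2D !AB; lra.
move=> u v; apply: complexP => //; have := Re_eq ('i *: u) v.
have l0 (C : V -> V) : (forall a u v, C (a *: u + v) = a *: C u + C v) -> C ('i *: u) = 'i *: C u.
  move=> lC; have C0 : C 0 = 0.
    by apply: (addrI (C 0)); have := lC 1 0 0; rewrite !scale1r !addr0 => <-.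
  by have := lC 'i u 0; rewrite C0 !addr0.
by rewrite !l0// !ipZl !cReM/= !mul0r !mul1r !sub0r => /oppr_inj.
Qed.

Section Projection.
Variable W : set V.
Hypothesis W0 : W 0.
Hypothesis W_linear : forall a u v, W u -> W v -> W (a *: u + v).
Hypothesis W_closed : forall u, (forall e : R, 0 < e -> exists2 g, W g & N (u - g) < e) -> W u.
Hypothesis complete : hcomplete.

(* A minimizing sequence is Cauchy by the parallelogram identity. *)
Lemma orthogonal_projection f : exists2 h, W h & forall g, W g -> ip (f - h) g = 0.
Proof.
pose D := [set N (f - g) | g in W].
have D0 : D !=set0 by exists (N (f - 0)), 0.
have Dlb : lbound D 0 by move=> _ [g _ <-]; exact: hnorm2_ge0.
have hD : has_inf D by split => //; exists 0.
pose d := inf D.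
have dle g : W g -> d <= N (f - g) by move=> Wg; apply: ge_inf; [exists 0|exists g].
have : forall n : nat, exists g, W g /\ N (f - g) < d + n.+1%:R^-1.
  move=> n; have [_ [g Wg <-] ?] := inf_adherent (ltac:(by rewrite invr_gt0) : 0 < n.+1%:R^-1 :> R) hD.
  by exists g.
move=> /choice[g_ Hg].
have mid m n : N (g_ m - g_ n) <= 2 * m.+1%:R^-1 + 2 * n.+1%:R^-1.
  have := dle (2^-1 *: (g_ m + g_ n)).
  have -> : 2^-1 *: (g_ m + g_ n) = 2^-1 *: g_ m + (2^-1 *: g_ n + 0).
    by rewrite addr0 scalerDr.
  move=> /(_ (W_linear _ (Hg m).1 (W_linear _ (Hg n).1 W0))); rewrite addr0 -scalerDr.
  have -> : f - 2^-1 *: (g_ m + g_ n) = 2^-1 *: ((f - g_ m) + (f - g_ n)).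
    have h2 : f = 2^-1 *: (f + f).
      by rewrite -mulr2n -(scaler_nat 2 f) scalerA mulVf ?scale1r// pnatr_eq0.
    by rewrite {1}h2 -scalerBr opprD addrACA.
  rewrite hnorm2Z.
  have -> : sqn (2^-1 : R[i]) = 4^-1.
    have -> : 2^-1 = (2^-1 : R)%:C by rewrite fmorphV/= rmorph_nat.
    by rewrite sqn_real; field.
  have -> : g_ m - g_ n = (f - g_ n) - (f - g_ m) by rewrite opprB [RHS]addrC addrA subrK.
  have := (Hg m).2; have := (Hg n).2.
  rewrite (hnorm2D (f - g_ m)) (hnorm2B (f - g_ n)) (Re_ipC (f - g_ m)).
  by move: (m.+1%:R^-1) (n.+1%:R^-1) (complex.Re _) (hnorm2 _) (hnorm2 _) => *; lra.
have cg : hcauchy g_.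
  move=> e e0; have e4 : 0 < e / 4 by lra.
  have [M _ HM] : \forall n \near \oo, n.+1%:R^-1 < e / 4.
    by have /cvgr_lt := @cvg_harmonic R; apply.
  exists M => m n Mm Mn; apply: le_lt_trans (mid m n) _.
  have := HM _ Mm; have := HM _ Mn => /=.
  by move: (m.+1%:R^-1) (n.+1%:R^-1) => p q; lra.
have [h gh] := complete cg.
have Wh : W h.
  apply: W_closed => e e0; have /cvgr_lt/(_ _ e0)[M _ HM] := gh.
  by exists (g_ M); [exact: (Hg M).1|rewrite hnorm2BC; exact: (HM M (leqnn M))].
exists h => // g Wg.
have Nh : N (f - h) <= d.
  have fgh : hcvg (fun n => f - g_ n) (f - h).
    by rewrite /hcvg; under eq_fun do rewrite hnorm2_subl.
  have dn : d + n.+1%:R^-1 @[n --> \oo] --> d.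
    by rewrite -[X in _ --> X]addr0; apply: cvgD; [exact: cvg_cst|exact: cvg_harmonic].
  apply: (ler_cvg_to (hcvg_hnorm2 fgh) dn).
  by apply: nearW => n; apply/ltW; exact: (Hg n).2.
have Re0 g' : W g' -> complex.Re (ip (f - h) g') = 0.
  move=> Wg'; set b := complex.Re _.
  have P (t : R) : 0 <= - 2 * (t * b) + t ^+ 2 * N g'.
    have := dle _ (W_linear t%:C Wg' Wh).
    rewrite opprD addrA addrAC.
    rewrite hnorm2B ipZr hnorm2Z sqn_real.
    have -> : complex.Re ((t%:C)^* * ip (f - h) g') = t * b.
      by rewrite cReM cReJ cImJ/= oppr0 mul0r subr0.
    by lra.
  have [b0//|b0] := eqVneq b 0.
  (* The minimiser would be [b / N g']. Adding 1 to the denominator covers a [g'] of seminorm zero,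
     and the value is still negative. *)
  have := P (b / (N g' + 1)).
  have Ng := hnorm2_ge0 g'.
  have -> : - 2 * (b / (N g' + 1) * b) + (b / (N g' + 1)) ^+ 2 * N g' =
    - (b ^+ 2 * (N g' + 2) / (N g' + 1) ^+ 2) by field; lra.
  have b2 : 0 < b ^+ 2 by rewrite exprn_even_gt0.
  have N1 : 0 < N g' + 1 by lra.
  have N2 : 0 < N g' + 2 by lra.
  by rewrite oppr_ge0 leNgt; case/negP; apply: divr_gt0; [exact: mulr_gt0|exact: exprn_gt0].
apply: complexP; first exact: Re0.
have := Re0 _ (W_linear 'i Wg W0).
by rewrite addr0 ipZr cReM/= mul0r sub0r mulN1r opprK.
Qed.

End Projection.

Section Orthonormal.
Variable e : nat -> V.
Hypothesis e_orthonormal : forall i j, ip (e i) (e j) = (i == j)%:R.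
Hypothesis complete : hcomplete.

Let S f n := \sum_(0 <= i < n) ip f (e i) *: e i.

Let ip_sum f n g : ip (S f n) g = \sum_(0 <= i < n) ip f (e i) * ip (e i) g.
Proof.
rewrite /S; elim: n => [|n IH]; first by rewrite !big_geq// ip0l.
by rewrite !big_nat_recr//= ipDl IH ipZl.
Qed.

Let ip_sum_e f n i : (i < n)%N -> ip (S f n) (e i) = ip f (e i).
Proof.
move=> lin; rewrite ip_sum big_mkord (bigD1 (Ordinal lin))//= e_orthonormal eqxx mulr1.
rewrite big1 ?addr0// => j ji; rewrite e_orthonormal.
by rewrite (_ : (j == i :> nat) = false) ?mulr0//; apply/negbTE.
Qed.

Let hnorm2_sum f m n : (m <= n)%N ->
  N (S f n - S f m) = \sum_(m <= i < n) sqn (ip f (e i)).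
Proof.
move=> mn; rewrite /S (big_cat_nat (leq0n m) mn)/= addrAC subrr add0r.
elim: n mn => [|k IH]; first by rewrite leqn0 => /eqP ->; rewrite !big_geq ?hnorm20.
rewrite leq_eqVlt => /predU1P[->|mk]; first by rewrite !big_geq ?hnorm20.
rewrite ltnS in mk; rewrite !(big_nat_recr k)//= hnorm2D IH// hnorm2Z.
rewrite /N e_orthonormal eqxx mulr1.
suff -> : ip (\sum_(m <= i < k) ip f (e i) *: e i) (ip f (e k) *: e k) = 0.
  by rewrite mulr0 addr0.
rewrite ipZr; have -> : ip (\sum_(m <= i < k) ip f (e i) *: e i) (e k) = 0.
  have -> : \sum_(m <= i < k) ip f (e i) *: e i = S f k - S f m.
    by rewrite /S (big_cat_nat (leq0n m) mk)//= addrAC subrr add0r.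
  rewrite ipBl !ip_sum !big1_seq ?subr0// => i /=; rewrite mem_index_iota => ik.
    by rewrite e_orthonormal ltn_eqF ?mulr0//; lia.
  by rewrite e_orthonormal ltn_eqF ?mulr0//; lia.
by rewrite mulr0.
Qed.

Let hnorm2_sub_sum f n :
  N (f - S f n) = N f - \sum_(0 <= i < n) sqn (ip f (e i)).
Proof.
have := hnorm2_sum f (leq0n n); rewrite {2}/S big_geq// subr0 => E.
rewrite hnorm2B E (Re_ipC (S f n)) ip_sum.
suff -> : complex.Re (\sum_(0 <= i < n) ip f (e i) * ip (e i) f) =
  \sum_(0 <= i < n) sqn (ip f (e i)) by lra.
elim: n {E} => [|n IH]; first by rewrite !big_geq.
by rewrite !big_nat_recr//= cReD IH (ip_conj Hip f (e n)) -sqnE.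
Qed.

(* [s] is the sum of the Fourier series of [f]. *)
Lemma parseval f : exists s, [/\ forall i, ip (f - s) (e i) = 0, N s <= N f &
  \sum_(0 <= i < n) sqn (ip f (e i)) @[n --> \oo] --> N s].
Proof.
pose c n := \sum_(0 <= i < n) sqn (ip f (e i)).
have c_nd : nondecreasing_seq c.
  apply/nondecreasing_seqP => n; rewrite /c big_nat_recr//= lerDl; exact: sqn_ge0.
have c_ub n : c n <= N f.
  by have := hnorm2_ge0 (f - S f n); rewrite hnorm2_sub_sum subr_ge0.
have c_cvg : cvgn c by apply: nondecreasing_is_cvgn => //; exists (N f) => _ [n _ <-].
have S_cauchy : hcauchy (S f).
  move=> r r0; have r2 : 0 < r / 2 by lra.
  have /cvgrPdist_lt/(_ _ r2)[M _ HM] := c_cvg; exists M => m n Mm Mn.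
  wlog mn : m n Mm Mn / (m <= n)%N.
    by move=> H; have [|/ltnW] := leqP m n => ?; [|rewrite hnorm2BC]; apply: H.
  rewrite hnorm2BC (hnorm2_sum f mn).
  have := HM _ Mm; have := HM _ Mn; rewrite /= -/(c _) /c (big_cat_nat (leq0n m) mn)//=.
  rewrite -!/(c _) !ltr_norml; lra.
have [s Ss] := complete S_cauchy; exists s; split.
- move=> i.
  (* From the index [i.+1] on, the partial sums have the exact coefficient at [e i], so the inner
     product is constantly 0 along the shifted sequence. *)
  have shift : hcvg (fun n => f - S f (n + i.+1)) (f - s).
    rewrite /hcvg; under eq_fun do rewrite hnorm2_subl.
    by move: Ss; rewrite /hcvg -(cvg_shiftn i.+1).
  rewrite -(ip0l (e i)); apply: (hcvg_ip_eq shift (hcvg_cst (e i)) (hcvg_cst 0) (hcvg_cst (e i))) => n.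
  by rewrite ip0l ipBl ip_sum_e ?subrr//; lia.
- have SE n : N (S f n) = c n.
    by have := hnorm2_sum f (leq0n n); rewrite {2}/S big_geq// subr0.
  by apply: (cvgr_to_le (hcvg_hnorm2 Ss)); apply: nearW => n; rewrite SE.
- have := hcvg_hnorm2 Ss.
  suff -> : (fun n => N (S f n)) = c by [].
  apply/funext => n.
  by have := hnorm2_sum f (leq0n n); rewrite {2}/S big_geq// subr0.
Qed.

End Orthonormal.

End Prehilbert.

(** * The Hilbert space of square integrable functions *)

Section ComplexIntegral.
Context d {T : measurableType d} {R : realType}.
Variable mu : {measure set T -> \bar R}.
Implicit Types f g m : T -> R[i].

Definition cmeasurable f := measurable_fun [set: T] (fun x => complex.Re (f x)) /\
  measurable_fun [set: T] (fun x => complex.Im (f x)).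
Definition cintegrable f := mu.-integrable [set: T] (EFin \o (fun x => complex.Re (f x))) /\
  mu.-integrable [set: T] (EFin \o (fun x => complex.Im (f x))).
Definition cint f : R[i] :=
  (\int[mu]_x complex.Re (f x)) +i* (\int[mu]_x complex.Im (f x)).
Definition csquare_integrable f := cmeasurable f /\
  (\int[mu]_x (sqn (f x))%:E < +oo)%E.

Lemma cmeasurable_cst (a : R[i]) : cmeasurable (cst a).
Proof. by split; exact: measurable_cst. Qed.
Lemma cmeasurableD f g : cmeasurable f -> cmeasurable g ->
  cmeasurable (fun x => f x + g x).
Proof.
move=> [? ?] [? ?]; split.
  by under eq_fun do rewrite cReD; exact: measurable_funD.
by under eq_fun do rewrite cImD; exact: measurable_funD.
Qed.
Lemma cmeasurableM f g : cmeasurable f -> cmeasurable g ->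
  cmeasurable (fun x => f x * g x).
Proof.
move=> [? ?] [? ?]; split.
  by under eq_fun do rewrite cReM; apply: measurable_funB; exact: measurable_funM.
by under eq_fun do rewrite cImM; apply: measurable_funD; exact: measurable_funM.
Qed.
Lemma cmeasurableN f : cmeasurable f -> cmeasurable (fun x => - f x).
Proof.
by move=> mf; under eq_fun do rewrite -mulN1r; exact: cmeasurableM (cmeasurable_cst _) mf.
Qed.
Lemma cmeasurableB f g : cmeasurable f -> cmeasurable g ->
  cmeasurable (fun x => f x - g x).
Proof. by move=> mf mg; apply: cmeasurableD => //; exact: cmeasurableN. Qed.
Lemma cmeasurableJ f : cmeasurable f -> cmeasurable (fun x => (f x)^*).
Proof.
move=> [? ?]; split; first by under eq_fun do rewrite cReJ.
by under eq_fun do rewrite cImJ; exact: measurableT_comp.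
Qed.
Lemma cmeasurable_real (f : T -> R) : measurable_fun [set: T] f ->
  cmeasurable (fun x => (f x)%:C).
Proof. by move=> mf; split => //=; exact: measurable_cst. Qed.
Lemma measurable_sqn f : cmeasurable f -> measurable_fun [set: T] (fun x => sqn (f x)).
Proof.
by move=> [? ?]; apply: measurable_funD; exact: measurable_funX.
Qed.
Lemma measurable_EFin_sqn f : cmeasurable f ->
  measurable_fun [set: T] (fun x => (sqn (f x))%:E).
Proof. by move=> /measurable_sqn mf; exact/measurable_EFinP. Qed.

Lemma integrable_addr (u v : T -> R) : mu.-integrable [set: T] (EFin \o u) ->
  mu.-integrable [set: T] (EFin \o v) ->
  mu.-integrable [set: T] (EFin \o (fun x => u x + v x)).
Proof. by move=> iu iv; have := integrableD measurableT iu iv. Qed.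
Lemma integrable_subr (u v : T -> R) : mu.-integrable [set: T] (EFin \o u) ->
  mu.-integrable [set: T] (EFin \o v) ->
  mu.-integrable [set: T] (EFin \o (fun x => u x - v x)).
Proof. by move=> iu iv; have := integrableB measurableT iu iv. Qed.
Lemma integrable_mulr (k : R) (u : T -> R) : mu.-integrable [set: T] (EFin \o u) ->
  mu.-integrable [set: T] (EFin \o (fun x => k * u x)).
Proof. by move=> iu; have := integrableZl measurableT k iu. Qed.

Lemma cintegrable_meas f : cintegrable f -> cmeasurable f.
Proof.
by move=> [/measurable_int/measurable_EFinP ? /measurable_int/measurable_EFinP ?].
Qed.

Lemma cintegrable_dom f (g : T -> R) : cmeasurable f ->
  mu.-integrable [set: T] (EFin \o g) ->
  (forall x, `|complex.Re (f x)| <= g x) ->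
  (forall x, `|complex.Im (f x)| <= g x) -> cintegrable f.
Proof.
move=> [mRe mIm] ig bRe bIm; split; apply: (le_integrable _ _ _ ig) => //.
- exact/measurable_EFinP.
- by move=> x _; rewrite lee_fin (le_trans (bRe x))// ler_norm.
- exact/measurable_EFinP.
- by move=> x _; rewrite lee_fin (le_trans (bIm x))// ler_norm.
Qed.

Lemma cintegrable_le f g : cmeasurable f -> cintegrable g ->
  (forall x, sqn (f x) <= sqn (g x)) -> cintegrable f.
Proof.
move=> mf [iRe iIm] fg.
pose h x := `|complex.Re (g x)| + `|complex.Im (g x)|.
have ih : mu.-integrable [set: T] (EFin \o h).
  by apply: integrable_addr; exact: integrable_norm.
have sq (a b c e : R) : a ^+ 2 + b ^+ 2 <= c ^+ 2 + e ^+ 2 -> `|a| <= `|c| + `|e|.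
  move=> H; rewrite -ler_sqr ?nnegrE ?addr_ge0// sqrrD !real_normK ?num_real//.
  have := sqr_ge0 b; have : 0 <= `|c| * `|e| by rewrite mulr_ge0.
  by rewrite mulr2n; lra.
apply: (cintegrable_dom mf ih) => x; apply: sq; first exact: fg.
by rewrite addrC; exact: fg.
Qed.

Lemma cintegrableZ a f : cintegrable f -> cintegrable (fun x => a * f x).
Proof.
move=> [iRe iIm]; split.
  by under eq_fun do rewrite cReM; apply: integrable_subr; exact: integrable_mulr.
by under eq_fun do rewrite cImM; apply: integrable_addr; exact: integrable_mulr.
Qed.

Lemma cintegrableM_bounded f m (C : R) : cmeasurable m -> (forall x, sqn (m x) <= C) ->
  cintegrable f -> cintegrable (fun x => m x * f x).
Proof.
move=> mm mC cf; apply: (cintegrable_le _ (cintegrableZ (1 + `|C|)%:C cf)).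
  by apply: cmeasurableM => //; exact: cintegrable_meas.
move=> x; rewrite !sqnM sqn_real ler_wpM2r ?sqn_ge0//.
apply: (le_trans (mC x)); have := ler_norm C; have := normr_ge0 C.
rewrite expr2; nra.
Qed.

Lemma cintD f g : cintegrable f -> cintegrable g ->
  cint (fun x => f x + g x) = cint f + cint g.
Proof.
move=> [? ?] [? ?]; apply: complexP; rewrite !cReImE /cint/=.
  by under eq_Rintegral do rewrite cReD; exact: RintegralD.
by under eq_Rintegral do rewrite cImD; exact: RintegralD.
Qed.

Lemma cintZ a f : cintegrable f -> cint (fun x => a * f x) = a * cint f.
Proof.
move=> [iRe iIm]; apply: complexP; rewrite !cReImE /cint/=.
  under eq_Rintegral do rewrite cReM.
  by rewrite RintegralB ?RintegralZl//; exact: integrable_mulr.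
under eq_Rintegral do rewrite cImM.
by rewrite RintegralD ?RintegralZl//; exact: integrable_mulr.
Qed.

Lemma cintJ f : cintegrable f -> cint (fun x => (f x)^*) = (cint f)^*.
Proof.
move=> [iRe iIm]; apply: complexP; rewrite !cReImE /cint/=.
  by under eq_Rintegral do rewrite cReJ.
under eq_Rintegral do rewrite cImJ -mulN1r.
by rewrite RintegralZl// mulN1r.
Qed.

Lemma cint_ae f g : cmeasurable f -> cmeasurable g ->
  {ae mu, forall x, f x = g x} -> cint f = cint g.
Proof.
move=> [mfR mfI] [mgR mgI] fg; apply: complexP; rewrite /cint/= /Rintegral; congr fine.
  apply: ae_eq_integral => //; [exact/measurable_EFinP|exact/measurable_EFinP|].
  by apply: filterS fg => x /= -> _.
apply: ae_eq_integral => //; [exact/measurable_EFinP|exact/measurable_EFinP|].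
by apply: filterS fg => x /= -> _.
Qed.

Lemma eq_cint f g : f =1 g -> cint f = cint g.
Proof. by move=> /funext ->. Qed.

Lemma csquare_integrableP f : csquare_integrable f <->
  cmeasurable f /\ mu.-integrable [set: T] (EFin \o (fun x => sqn (f x))).
Proof.
split=> -[mf]; last first.
  move/integrableP => [_ foo]; split=> //; apply: le_lt_trans foo.
  by under [leRHS]eq_integral do rewrite /= ger0_norm ?sqn_ge0//.
move=> foo; split => //; apply/integrableP; split; first exact: measurable_EFin_sqn.
by under eq_integral do rewrite /= ger0_norm ?sqn_ge0//.
Qed.

Lemma csquare_integrable_lin a f g : csquare_integrable f -> csquare_integrable g ->
  csquare_integrable (fun x => a * f x + g x).
Proof.
move=> /csquare_integrableP[mf If] /csquare_integrableP[mg Ig].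
have mfg : cmeasurable (fun x => a * f x + g x).
  by apply: cmeasurableD => //; exact: cmeasurableM (cmeasurable_cst _) mf.
apply/csquare_integrableP; split => //.
pose h x := 2 * sqn a * sqn (f x) + 2 * sqn (g x).
have Ih : mu.-integrable [set: T] (EFin \o h).
  by apply: integrable_addr; exact: integrable_mulr.
apply: (le_integrable _ _ _ Ih) => //; first exact: measurable_EFin_sqn.
move=> x _; rewrite lee_fin/= /h ger0_norm ?sqn_ge0// ger0_norm ?addr_ge0 ?mulr_ge0 ?sqn_ge0//.
by rewrite -mulrA -sqnM; exact: sqnD.
Qed.

Lemma cintegrable_mulJ f g : csquare_integrable f -> csquare_integrable g ->
  cintegrable (fun x => f x * (g x)^*).
Proof.
move=> /csquare_integrableP[mf If] /csquare_integrableP[mg Ig].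
have Ih : mu.-integrable [set: T] (EFin \o (fun x => sqn (f x) + sqn (g x))).
  exact: integrable_addr.
apply: (cintegrable_dom _ Ih).
- by apply: cmeasurableM => //; exact: cmeasurableJ.
- move=> x; rewrite ler_norml !cReImE /sqn.
  move: (complex.Re (f x)) (complex.Im (f x)) (complex.Re (g x)) (complex.Im (g x)) => a b p q.
  apply/andP; split.
    have := sqr_ge0 (a + p); have := sqr_ge0 (b + q).
    have := sqr_ge0 (a - p); have := sqr_ge0 (b - q); rewrite !expr2; lra.
  have := sqr_ge0 (a + p); have := sqr_ge0 (b + q).
  have := sqr_ge0 (a - p); have := sqr_ge0 (b - q); rewrite !expr2; lra.
- move=> x; rewrite ler_norml !cReImE /sqn.
  move: (complex.Re (f x)) (complex.Im (f x)) (complex.Re (g x)) (complex.Im (g x)) => a b p q.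
  apply/andP; split.
    have := sqr_ge0 (a + q); have := sqr_ge0 (b + p).
    have := sqr_ge0 (a - q); have := sqr_ge0 (b - p); rewrite !expr2; lra.
  have := sqr_ge0 (a + q); have := sqr_ge0 (b + p).
  have := sqr_ge0 (a - q); have := sqr_ge0 (b - p); rewrite !expr2; lra.
Qed.

Lemma csquare_integrable0 : csquare_integrable (fun=> 0).
Proof.
split; first exact: cmeasurable_cst.
by under eq_integral do rewrite /sqn/= expr0n/= addr0; rewrite integral0 ltry.
Qed.

Definition L2_fun : {pred T -> R[i]} := mem [set f | csquare_integrable f].

(* Functions rather than classes modulo null functions, so that the norm is only
   a seminorm: equality a.e. of [u] and [v] is [hnorm2 (L2ip mu) (u - v) = 0]. *)
Record L2 := L2Sub { L2val :> T -> R[i] ; L2P : L2val \in L2_fun }.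

HB.instance Definition _ := [isSub for L2val].
HB.instance Definition _ := [Choice of L2 by <:].

Lemma L2_submod_closed : submod_closed L2_fun.
Proof.
split; first by rewrite inE; exact: csquare_integrable0.
by move=> a f g; rewrite !inE => Hf Hg; exact: (csquare_integrable_lin a Hf Hg).
Qed.
HB.instance Definition _ := GRing.isSubmodClosed.Build _ _ L2_fun L2_submod_closed.
HB.instance Definition _ := [SubChoice_isSubLmodule of L2 by <:].

End ComplexIntegral.

Lemma cintegrable_ae d (T : measurableType d) (R : realType) (mu : {measure set T -> \bar R})
    (f g : T -> R[i]) : cintegrable mu f -> cmeasurable g ->
  {ae mu, forall x, f x = g x} -> cintegrable mu g.
Proof.
move=> [fR fI] [gR gI] fg.
have key (h : R[i] -> R) : mu.-integrable [set: T] (EFin \o (h \o f)) ->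
    measurable_fun [set: T] (h \o g) -> mu.-integrable [set: T] (EFin \o (h \o g)).
  move=> ih mh; have mhE : measurable_fun [set: T] (EFin \o (h \o g)) by exact/measurable_EFinP.
  apply/integrableP; split => //.
  have /integrableP[mf] := ih; congr (_ < _)%E.
  apply: ae_eq_integral => //; try exact: measurableT_comp.
  by move: fg; apply: filterS => x fgx _ /=; rewrite fgx.
by split; [exact: (key (@complex.Re R))|exact: (key (@complex.Im R))].
Qed.

(** * Completeness of L^2 (Riesz-Fischer) *)

Section RieszFischer.
Context d {T : measurableType d} {R : realType}.
Variable mu : {measure set T -> \bar R}.

(** Fatou's lemma after replacing [g] by the lower limit of the sequence, with which it agrees
    almost everywhere. *)
Lemma fatou_ae_le (f : nat -> T -> R) (g : T -> R) (e : \bar R) :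
    (forall n, measurable_fun [set: T] (f n)) -> measurable_fun [set: T] g ->
    (forall n x, 0 <= f n x) -> (forall x, 0 <= g x) ->
    {ae mu, forall x, f n x @[n --> \oo] --> g x} ->
    (forall n, (\int[mu]_x (f n x)%:E <= e)%E) ->
  (\int[mu]_x (g x)%:E <= e)%E.
Proof.
move=> mf mg f0 g0 fg fe.
have mf' n : measurable_fun [set: T] (EFin \o f n) by exact/measurable_EFinP.
have -> : (\int[mu]_x (g x)%:E = \int[mu]_x limn_einf (fun n => (f n x)%:E))%E.
  apply: ae_eq_integral => //; first exact/measurable_EFinP.
    have -> : (fun x => limn_einf (fun n => (f n x)%:E)) =
              (fun x => - limn_esup (fun n => - (f n x)%:E))%E.
      by apply/funext => x; rewrite limn_esupN oppeK.
    apply: measurableT_comp => //.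
    apply: (measurable_fun_limn_esup (f := fun n x => - (f n x)%:E)%E) => n.
    by under eq_fun do rewrite -EFinN; apply/measurable_EFinP; exact: measurableT_comp (mf n).
  apply: filterS fg => x fgx _.
  have /cvg_limn_einf_sup[->] // : (f n x)%:E @[n --> \oo] --> (g x)%:E.
  by apply: cvg_EFin; [exact: nearW|exact: fgx].
apply: (le_trans (fatou mu measurableT mf' _)) => /=.
  by move=> n x _; rewrite lee_fin.
rewrite limn_einf_lim; apply: lime_le; first exact: is_cvg_einfs.
apply: nearW => n; apply: le_trans (fe n).
by apply: ereal_inf_lbound; exists n => /=.
Qed.


Lemma measurable_nneseries (h : nat -> T -> \bar R) :
    (forall k, measurable_fun [set: T] (h k)) -> (forall k x, (0 <= h k x)%E) ->
  measurable_fun [set: T] (fun x => \sum_(0 <= k <oo) h k x)%E.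
Proof.
move=> mh h0.
exact: (@ge0_emeasurable_sum _ _ _ setT h xpredT (fun k x _ _ => h0 k x) (fun k _ => mh k)).
Qed.

(** The rate is chosen with 8 = 4 * 2. Weighting the squared increments by [4 ^ k] leaves integrals
    at most [2 ^ - k], whose sum is at most 2. So the weighted series is finite almost everywhere,
    and there the increments decay like [2 ^ - k]. *)
Let cauchy_subseq_cvg (v : nat -> T -> R) :
    (forall n, measurable_fun [set: T] (v n)) ->
    (forall k, \int[mu]_x ((v k.+1 x - v k x) ^+ 2)%:E <= ((8 ^+ k)^-1)%:E)%E ->
  {ae mu, forall x, cvgn (v ^~ x)}.
Proof.
move=> mv dv.
pose w k x : R := 4 ^+ k * (v k.+1 x - v k x) ^+ 2.
have w0 k x : 0 <= w k x by rewrite mulr_ge0// ?sqr_ge0// exprn_ge0.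
have mw k : measurable_fun [set: T] (w k).
  apply: measurable_funM; first exact: measurable_cst.
  by apply: measurable_funX; exact: measurable_funB.
have mEw k : measurable_fun [set: T] (EFin \o w k) by exact/measurable_EFinP.
pose S x := (\sum_(0 <= k <oo) (w k x)%:E)%E.
have mS : measurable_fun [set: T] S.
  by apply: measurable_nneseries => // k x; rewrite lee_fin.
have S0 x : (0 <= S x)%E by apply: nneseries_ge0 => k _ _; rewrite lee_fin.
have IS : (\int[mu]_x S x <= 2%:E)%E.
  rewrite integral_nneseries//; last by move=> n x _; rewrite lee_fin.
  apply: lime_le.
    by apply: is_cvg_nneseries => n _ _; apply: integral_ge0 => x _; rewrite lee_fin.
  apply: nearW => n.
  apply: (@le_trans _ _ (2 - 2 * (2 ^+ n)^-1)%:E); last first.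
    by rewrite lee_fin lerBlDr lerDl mulr_ge0// invr_ge0 exprn_ge0.
  elim: n => [|n IH]; first by rewrite big_geq// expr0 invr1 mulr1 subrr.
  rewrite big_nat_recr//=.
  apply: (le_trans (leeD IH (_ : _ <= ((2 ^+ n)^-1)%:E)%E)).
    under eq_integral do rewrite EFinM.
    rewrite ge0_integralZl_EFin ?exprn_ge0//; last 2 first.
      by move=> x _; rewrite lee_fin sqr_ge0.
      by apply/measurable_EFinP/measurable_funX; exact: measurable_funB.
    apply: (le_trans (lee_wpmul2l _ (dv n))); first by rewrite lee_fin exprn_ge0.
    rewrite -EFinM lee_fin (_ : 8 = 4 * 2 :> R); last by ring.
    by rewrite exprMn invfM mulrA mulfV ?mul1r// expf_neq0.
  rewrite -EFinD lee_fin exprS invfM.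
  have : 0 < (2 ^+ n : R)^-1 by rewrite invr_gt0 exprn_gt0.
  lra.
have iS : mu.-integrable [set: T] S.
  apply/integrableP; split => //.
  by under eq_integral do rewrite gee0_abs//; apply: le_lt_trans IS _; rewrite ltry.
have := integrable_ae measurableT iS; apply: filterS => x /(_ I) Sx.
(* The square of [S x + 1] is at least [S x], so [C] can stand for the square root of [S x]. *)
pose C := fine (S x) + 1.
have S1 : 0 <= fine (S x) by rewrite fine_ge0.
have Cw k : w k x <= fine (S x).
  rewrite -lee_fin fineK// /S; apply: le_trans (nneseries_lim_ge k.+1 _).
    rewrite big_nat_recr//= leeDr// sume_ge0// => i _; by rewrite lee_fin.
  by move=> i _ _; rewrite lee_fin.
have bd k : `|v k.+1 x - v k x| <= geometric C (2^-1) k.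
  rewrite /geometric/= exprVn -ler_sqr ?nnegrE//; last first.
    by rewrite mulr_ge0// ?invr_ge0 ?exprn_ge0// /C; lra.
  rewrite real_normK ?num_real// exprMn exprVn -exprM mulnC exprM ler_pdivlMr; last first.
    by rewrite exprn_gt0// exprn_gt0.
  rewrite (_ : 2 ^+ 2 = 4 :> R) ?expr2; last by ring.
  rewrite mulrC; apply: (le_trans (Cw k)); rewrite /C.
  have := sqr_ge0 (fine (S x)); rewrite expr2; nra.
have cs : cvgn (series (telescope (v ^~ x))).
  apply: normed_cvg; apply: series_le_cvg; last first.
  - by apply: (@is_cvg_geometric_series R C (2^-1)); rewrite ger0_norm ?invr_ge0//; lra.
  - by move=> k; exact: bd.
  - by move=> k; apply: le_trans (bd k).
  - by move=> k; rewrite /=.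
have -> : v ^~ x = (fun n => v 0%N x + series (telescope (v ^~ x)) n).
  by apply/funext => n; exact: (eq_sum_telescope (v ^~ x) n).
by apply: is_cvgD => //; exact: is_cvg_cst.
Qed.

Lemma real_riesz_fischer (u : nat -> T -> R) :
    (forall n, measurable_fun [set: T] (u n)) ->
    (forall e : R, 0 < e -> exists N : nat, forall m n, (N <= m)%N -> (N <= n)%N ->
      (\int[mu]_x ((u m x - u n x) ^+ 2)%:E < e%:E)%E) ->
  exists2 l : T -> R, measurable_fun [set: T] l &
    forall e : R, 0 < e -> exists N : nat, forall n, (N <= n)%N ->
      (\int[mu]_x ((u n x - l x) ^+ 2)%:E <= e%:E)%E.
Proof.
move=> mu_ cu.
have /choice[phi Hphi] : forall k : nat, exists N : nat, forall m n, (N <= m)%N -> (N <= n)%N ->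
    (\int[mu]_x ((u m x - u n x) ^+ 2)%:E < ((8 ^+ k)^-1)%:E)%E.
  by move=> k; apply: cu; rewrite invr_gt0 exprn_gt0.
(* The sum places both [psi k] and [psi k.+1] beyond [phi k]; the term [k] makes [psi (k + N)] at
   least [N]. *)
pose psi k := (k + \sum_(0 <= i < k.+1) phi i)%N.
have psi_ge k : (phi k <= psi k)%N by rewrite /psi big_nat_recr//=; lia.
have psi_geS k : (phi k <= psi k.+1)%N by rewrite /psi !(big_nat_recr _.+1)//= big_nat_recr//=; lia.
pose v k := u (psi k).
have mv k : measurable_fun [set: T] (v k) by exact: mu_.
have vc : {ae mu, forall x, cvgn (v ^~ x)}.
  apply: cauchy_subseq_cvg => [n|k]; first exact: mu_.
  by apply/ltW/Hphi.
(* The upper limit is measurable on the whole space, including the null set where the subsequence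
   diverges. *)
pose l x := fine (limn_esup (fun n => (v n x)%:E)).
have ml : measurable_fun [set: T] l.
  apply: measurableT_comp; first exact: fine_measurable.
  by apply: (measurable_fun_limn_esup (f := fun n x => (v n x)%:E)) => n; apply/measurable_EFinP.
exists l => // e e0; have [N HN] := cu _ e0; exists N => n Nn.
apply: (@fatou_ae_le (fun k x => (u n x - v (k + N)%N x) ^+ 2)) => //.
- by move=> k; apply: measurable_funX; exact: measurable_funB.
- by apply: measurable_funX; exact: measurable_funB.
- by move=> k x; exact: sqr_ge0.
- by move=> x; exact: sqr_ge0.
- apply: filterS vc => x cx.
  have lx : v k x @[k --> \oo] --> l x.
    have Ec : (v k x)%:E @[k --> \oo] --> (limn (v ^~ x))%:E.
      by apply: cvg_EFin; [exact: nearW|exact: cx].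
    by rewrite /l (cvg_limn_einf_sup Ec).2 /=; exact: cx.
  rewrite (cvg_shiftn N (fun k => (u n x - v k x) ^+ 2)).
  have ul : u n x - v k x @[k --> \oo] --> u n x - l x.
    by apply: cvgB => //; exact: cvg_cst.
  by rewrite expr2; under eq_fun do rewrite expr2; exact: cvgM.
- by move=> k; apply/ltW/HN => //; rewrite /psi; lia.
Qed.

End RieszFischer.

Section L2space.
Context d {T : measurableType d} {R : realType}.
Variable mu : {measure set T -> \bar R}.
Implicit Types u v : L2 mu.

Definition L2ip u v : R[i] := cint mu (fun x => u x * (v x)^*).
Definition L2mk f (Hf : csquare_integrable mu f) : L2 mu := L2Sub (mem_set Hf).

Lemma L2_square u : csquare_integrable mu u.
Proof. by have := L2P u; rewrite inE. Qed.
Lemma L2_meas u : cmeasurable u.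
Proof. by have [] := L2_square u. Qed.
Lemma L2_cintegrable u v : cintegrable mu (fun x => u x * (v x)^*).
Proof. by apply: cintegrable_mulJ; exact: L2_square. Qed.

Lemma L2addE u v x : (u + v) x = u x + v x. Proof. by []. Qed.
Lemma L2subE u v x : (u - v) x = u x - v x. Proof. by []. Qed.
Lemma L2scaleE a u x : (a *: u) x = a * u x. Proof. by []. Qed.

Lemma L2ipE u : complex.Re (L2ip u u) = \int[mu]_x sqn (u x).
Proof.
by rewrite /L2ip/cint/=; apply: eq_Rintegral => x _; rewrite -sqnE.
Qed.

Lemma L2_prehilbert : prehilbert L2ip.
Proof.
split.
- move=> a u v w; rewrite /L2ip -cintZ; last exact: L2_cintegrable.
  rewrite -cintD; [|exact/cintegrableZ/L2_cintegrable|exact: L2_cintegrable].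
  by apply: eq_cint => x; rewrite L2addE L2scaleE mulrDl mulrA.
- move=> u v; rewrite /L2ip -cintJ; last exact: L2_cintegrable.
  by apply: eq_cint => x; rewrite rmorphM/= conjcK mulrC.
- by move=> u; rewrite L2ipE; apply: Rintegral_ge0 => x _; exact: sqn_ge0.
Qed.

Lemma hnorm2_L2 u : ((hnorm2 L2ip u)%:E = \int[mu]_x (sqn (u x))%:E)%E.
Proof.
rewrite /hnorm2 L2ipE /Rintegral fineK// ge0_fin_numE; first by have [] := L2_square u.
by apply: integral_ge0 => x _; rewrite lee_fin sqn_ge0.
Qed.

Lemma hnorm2_L2_eq0 u : hnorm2 L2ip u = 0 -> {ae mu, forall x, u x = 0}.
Proof.
move=> u0; have := hnorm2_L2 u; rewrite u0 => E.
have := ae_eq_integral_abs mu measurableT (measurable_EFin_sqn (L2_meas u)).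
under eq_integral do rewrite /= ger0_norm ?sqn_ge0//.
rewrite -E => -[/(_ erefl) + _]; apply: filterS => x /= /(_ I)[] /eqP.
by move=> /eqP; exact: sqn_eq0.
Qed.

Lemma L2_ae_eq u v : hnorm2 L2ip (u - v) = 0 -> {ae mu, forall x, u x = v x}.
Proof.
move/hnorm2_L2_eq0; apply: filterS => x; rewrite L2subE => /eqP.
by rewrite subr_eq0 => /eqP.
Qed.

Lemma hnorm2_L2_ae u : {ae mu, forall x, u x = 0} -> hnorm2 L2ip u = 0.
Proof.
move=> u0; apply: EFin_inj; rewrite hnorm2_L2.
transitivity (\int[mu]_x (cst 0%E x))%E; last by rewrite integral0.
apply: ae_eq_integral => //; first exact/measurable_EFin_sqn/L2_meas.
by apply: filterS u0 => x /= -> _; rewrite /sqn/= expr0n/= addr0.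
Qed.

Lemma L2_complete : hcomplete L2ip.
Proof.
move=> s cs.
have part (p : R[i] -> R) : (forall a b, p (a - b) = p a - p b) ->
    (forall a, p a ^+ 2 <= sqn a) ->
    (forall u, measurable_fun [set: T] (fun x => p (u x))) ->
  exists2 l : T -> R, measurable_fun [set: T] l &
    forall e : R, 0 < e -> exists N : nat, forall n, (N <= n)%N ->
      (\int[mu]_x ((p (s n x) - l x) ^+ 2)%:E <= e%:E)%E.
  move=> pB ple mp; apply: real_riesz_fischer => [n|e e0]; first exact: mp.
  have [N HN] := cs _ e0; exists N => m n Nm Nn.
  apply: le_lt_trans (_ : (hnorm2 L2ip (s m - s n))%:E < _)%E; last by rewrite lte_fin HN.
  rewrite hnorm2_L2; apply: ge0_le_integral => //.
  - by move=> x _; rewrite lee_fin sqr_ge0.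
  - by apply/measurable_EFinP; apply: measurable_funX; apply: measurable_funB; exact: mp.
  - exact/measurable_EFin_sqn/L2_meas.
  - by move=> x _; rewrite lee_fin -pB; exact: ple.
have [lR mlR HR] : exists2 l : T -> R, measurable_fun [set: T] l &
    forall e : R, 0 < e -> exists N : nat, forall n, (N <= n)%N ->
      (\int[mu]_x ((complex.Re (s n x) - l x) ^+ 2)%:E <= e%:E)%E.
  apply: part => [a b|a|u]; first by rewrite cReD cReN.
    by rewrite /sqn lerDl sqr_ge0.
  by have [] := L2_meas u.
have [lI mlI HI] : exists2 l : T -> R, measurable_fun [set: T] l &
    forall e : R, 0 < e -> exists N : nat, forall n, (N <= n)%N ->
      (\int[mu]_x ((complex.Im (s n x) - l x) ^+ 2)%:E <= e%:E)%E.
  apply: part => [a b|a|u]; first by rewrite cImD cImN.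
    by rewrite /sqn lerDr sqr_ge0.
  by have [] := L2_meas u.
pose l x := lR x +i* lI x.
have ml : cmeasurable l by [].
have small e : 0 < e -> exists N : nat, forall n, (N <= n)%N ->
    (\int[mu]_x (sqn (s n x - l x))%:E <= e%:E)%E.
  move=> e0; have e2 : 0 < e / 2 by rewrite divr_gt0.
  have [N1 H1] := HR _ e2; have [N2 H2] := HI _ e2.
  exists (maxn N1 N2) => n; rewrite geq_max => /andP[/H1 b1 /H2 b2].
  rewrite [leRHS](_ : _ = (e / 2)%:E + (e / 2)%:E)%E; last by rewrite -EFinD -splitr.
  apply: le_trans (leeD b1 b2); rewrite -ge0_integralD//=.
  - by under eq_integral do rewrite /sqn cReD cImD cReN cImN EFinD.
  - by move=> x _; rewrite lee_fin sqr_ge0.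
  - apply/measurable_EFinP; apply: measurable_funX; apply: measurable_funB => //.
    by have [] := L2_meas (s n).
  - by move=> x _; rewrite lee_fin sqr_ge0.
  - apply/measurable_EFinP; apply: measurable_funX; apply: measurable_funB => //.
    by have [] := L2_meas (s n).
have Ll : csquare_integrable mu l.
  have [N HN] := small _ ltr01.
  have dl : csquare_integrable mu (fun x => s N x - l x).
    split; first by apply: cmeasurableB => //; exact: L2_meas.
    by apply: le_lt_trans (HN _ (leqnn _)) _; rewrite ltry.
  have := csquare_integrable_lin (-1) dl (L2_square (s N)).
  by rewrite (_ : (fun x => _) = l)//; apply/funext => x; rewrite mulN1r opprB subrK.
exists (L2mk Ll); apply/cvgrPdistC_le => e e0.
have [N HN] := small _ e0; exists N => // n Nn.
rewrite subr0 ger0_norm; last exact/hnorm2_ge0/L2_prehilbert.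
by rewrite -lee_fin hnorm2_L2; exact: HN.
Qed.

End L2space.

(** * Periodization of integrals over the line *)

Section IntegerEnumeration.

(** The enumeration 0, -1, 1, -2, 2, and so on. It turns sums over the integers into series and into
    integrals for counting measure on [nat], where the general theory of [L2] applies. *)
Definition int_of_nat (n : nat) : int := if odd n then Negz n./2 else Posz n./2.

Lemma int_of_nat_bij : set_bij [set: nat] [set: int] int_of_nat.
Proof.
split=> //.
- move=> m n _ _; rewrite /int_of_nat.
  by case: ifP => om; case: ifP => on // [mn];
    rewrite -[LHS]odd_double_half -[RHS]odd_double_half om on mn.
- move=> [m|m] _.
    by exists m.*2 => //; rewrite /int_of_nat odd_double doubleK.
  by exists m.*2.+1 => //; rewrite /int_of_nat /= odd_double/= uphalf_double.
Qed.

Lemma esum_int {R : realType} (a : int -> \bar R) : (forall k, (0 <= a k)%E) ->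
  (esum [set: int] a = \sum_(0 <= n <oo) a (int_of_nat n))%E.
Proof. by move=> a0; rewrite -[esum _ a]/(\esum_(k in [set: int]) a k) (reindex_esum _ _ _ a int_of_nat_bij) nneseries_esumT. Qed.

End IntegerEnumeration.

(** * Translation invariance of Lebesgue measure and tilings of the line *)

Section LebesgueTranslation.
Context {R : realType}.
Local Notation mu := (@lebesgue_measure R).
Local Open Scope ereal_scope.

Lemma ae_lebesgueS (P Q : R -> Prop) : (forall x, P x -> Q x) ->
  {ae mu, forall x, P x} -> {ae mu, forall x, Q x}.
Proof. by move=> PQ; apply: filterS; [exact: (ae_filter_ringOfSetsType mu)|exact: PQ]. Qed.

Lemma ae_lebesgueS2 (P1 P2 Q : R -> Prop) : (forall x, P1 x -> P2 x -> Q x) ->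
  {ae mu, forall x, P1 x} -> {ae mu, forall x, P2 x} -> {ae mu, forall x, Q x}.
Proof. by move=> PQ; apply: filterS2; [exact: (ae_filter_ringOfSetsType mu)|exact: PQ]. Qed.

Let shift (c : R) : measurableTypeR R -> measurableTypeR R := fun x => (x + c)%R.

Lemma measurable_shift (c : R) : measurable_fun [set: measurableTypeR R] (shift c).
Proof. exact: measurable_funD. Qed.

(** Both measures agree on half-open intervals, and these determine Lebesgue measure. *)
Lemma lebesgue_measure_shift (c : R) (A : set R) : measurable A ->
  pushforward mu (shift c) A = mu A.
Proof.
move=> mA; apply/esym.
have ms := measurable_shift c.
apply: lebesgue_measure_unique => //= _ [[a b]] _ <-.
rewrite /pushforward.
have -> : shift c @^-1` `]a, b]%classic = `](a - c)%R, (b - c)%R]%classic.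
  by apply/seteqP; split => x; rewrite /= /shift !in_itv/= ltrBlDr lerBrDr.
by rewrite !lebesgue_measure_itv/= !lte_fin ltrD2r; case: ifP => // _; congr EFin; ring.
Qed.

Lemma ge0_integral_shift (c : R) (D : set R) (f : R -> \bar R) : measurable D ->
    measurable_fun [set: R] f -> (forall x, 0 <= f x) ->
  \int[mu]_(x in D) f x = \int[mu]_(x in (fun x => (x + c)%R) @^-1` D) f (x + c)%R.
Proof.
move=> mD mf f0; have ms := measurable_shift c.
rewrite -(@ge0_integral_pushforward _ _ _ _ _ _ ms mu D f)//; last exact: measurable_funTS.
by apply: eq_measure_integral => //= A mA _; exact/esym/lebesgue_measure_shift.
Qed.

Lemma integrable_shift (c : R) (f : R -> R) :
  mu.-integrable [set: R] (EFin \o f) -> mu.-integrable [set: R] (EFin \o (fun x => f (x + c)%R)).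
Proof.
move=> /integrableP[mf foo]; apply/integrableP; split.
  by apply: (measurableT_comp mf); exact: measurable_shift.
rewrite -(@ge0_integral_shift c setT (fun x => `|(EFin \o f) x|))//.
by apply: measurableT_comp.
Qed.

Lemma Rintegral_shift (c : R) (f : R -> R) : mu.-integrable [set: R] (EFin \o f) ->
  (\int[mu]_x f (x + c) = \int[mu]_x f x)%R.
Proof.
move=> iF; rewrite /Rintegral; congr fine; apply/esym.
rewrite integralE [RHS]integralE; have mf := measurable_int _ iF.
congr (_ - _).
  by rewrite (ge0_integral_shift c) ?preimage_setT//; [apply: eq_integral => x _; by rewrite !funeposE|exact: measurable_funepos].
by rewrite (ge0_integral_shift c) ?preimage_setT//; [apply: eq_integral => x _; by rewrite !funenegE|exact: measurable_funeneg].
Qed.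

Lemma ae_shift (c : R) (P : R -> Prop) : {ae mu, forall x, P x} ->
  {ae mu, forall x, P (x + c)%R}.
Proof.
move=> [N [mN N0 subN]].
exists ((fun x : R => (x + c)%R) @^-1` N); split.
- by rewrite -[X in measurable X]setTI; exact: measurable_shift.
- by have := lebesgue_measure_shift c mN; rewrite /pushforward N0.
- by move=> x /= Px; apply: subN.
Qed.

Section Tiling.
Variable h : R.
Hypothesis h0 : (0 < h)%R.

(** The step [h] is 1 for brackets, and the inverse of the length of the support when the transform
    of a compactly supported function is sampled. *)
Definition tile (k : int) : set R := `[(h * k%:~R)%R, (h * k%:~R + h)%R[%classic.
Let tiles n := tile (int_of_nat n).

Lemma tileP x k : tile k x <-> Num.floor (x / h)%R = k.
Proof.
rewrite /tile/= in_itv/=; split=> [/andP[a b]|<-].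
  apply: floor_def; rewrite ler_pdivlMr// ltr_pdivrMr// mulrC a/=.
  by rewrite intrD mulrDl mul1r (mulrC _ h).
rewrite mulrC -ler_pdivlMr// floor_le/= -[X in (_ + X)%R]mul1r -mulrDl -ltr_pdivrMr//.
by have := floorD1_gt (x / h)%R; rewrite intrD.
Qed.

Let tiles_cover : \bigcup_n tiles n = [set: R].
Proof.
apply/seteqP; split=> // x _; have [_ _ surj] := int_of_nat_bij.
have [n _ En] := surj (Num.floor (x / h)%R) I.
by exists n => //; apply/tileP; rewrite En.
Qed.

Let tiles_disjoint : trivIset [set: nat] tiles.
Proof.
move=> i j _ _ [x [/tileP xi /tileP xj]]; have [_ inj _] := int_of_nat_bij.
by apply: inj; rewrite ?inE// -xi -xj.
Qed.

Lemma ge0_integral_tiling (f : R -> \bar R) : measurable_fun [set: R] f ->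
    (forall x, 0 <= f x) ->
  \int[mu]_x f x = \int[mu]_(x in `[0%R, h[%classic) \esum_(k in [set: int]) f (x + h * k%:~R)%R.
Proof.
move=> mf f0; under [RHS]eq_integral do rewrite esum_int//.
rewrite integral_nneseries//; last first.
  by move=> n; apply: measurable_funTS; apply: measurableT_comp => //; exact: measurable_shift.
rewrite -tiles_cover ge0_integral_bigcup//; last 2 first.
- by move=> n; exact: measurable_itv.
- by rewrite tiles_cover.
apply: eq_eseriesr => n _; rewrite (ge0_integral_shift (h * (int_of_nat n)%:~R))//; last exact: measurable_itv.
congr (integral _ _ _); apply/seteqP; split => x /=; rewrite /tiles/tile/= !in_itv/=.
  by rewrite lerDr (addrC (h * _)%R h) ltrD2r.
by rewrite lerDr (addrC (h * _)%R h) ltrD2r.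
Qed.

(** The exceptional set lies in the union of countably many translates of a null set. *)
Lemma ae_periodic (P : R -> Prop) : (forall x (k : int), P x -> P (x + h * k%:~R)%R) ->
  {ae mu, forall x, `[0%R, h[%classic x -> P x} -> {ae mu, forall x, P x}.
Proof.
move=> perP aeP.
have : {ae mu, forall x, forall n : nat, `[0%R, h[%classic (x - h * (int_of_nat n)%:~R)%R ->
    P (x - h * (int_of_nat n)%:~R)%R}.
  by apply/ae_foralln => n; exact: (ae_shift (- (h * (int_of_nat n)%:~R))%R aeP).
apply: ae_lebesgueS => x Hx; have : (\bigcup_n tiles n) x by rewrite tiles_cover.
move=> [n _ xn]; rewrite -(subrK (h * (int_of_nat n)%:~R)%R x); apply/perP/Hx.
by move: xn; rewrite /tiles/tile/= !in_itv/= subr_ge0 ltrBlDl.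
Qed.

End Tiling.
End LebesgueTranslation.

(** * Sums over the integers and periodization of integrals *)

Section IntegerSums.
Context {R : realType}.
Local Notation mu := (@lebesgue_measure R).
Local Notation count := (@counting nat R).
Implicit Types u : int -> R.

Lemma esum_shift (a : int -> \bar R) (j : int) :
  esum [set: int] (fun k => a (k + j)) = esum [set: int] a.
Proof.
apply/esym; apply: (@reindex_esum R _ _ [set: int] [set: int] (fun k => k + j) a).
by split=> //; [move=> x y _ _ /addIr|move=> x _; exists (x - j) => //; rewrite subrK].
Qed.

(** Under absolute summability [zsum] is an integral for counting measure; linearity and
    Cauchy-Schwarz for brackets are obtained through this identity. *)
Lemma zsumE u : count.-integrable [set: nat] (EFin \o (u \o int_of_nat)) ->
  zsum u = \int[count]_n u (int_of_nat n).
Proof.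
move=> iu; rewrite /zsum /Rintegral integralE fineB; last 2 first.
- exact: integrable_pos_fin_num.
- exact: integrable_neg_fin_num.
congr (fine _ - fine _).
  rewrite -[LHS]/(esum _ _) esum_int// ge0_integral_count//.
  by apply: eq_eseriesr => n _; rewrite !funeposE.
rewrite -[LHS]/(esum _ _) esum_int// ge0_integral_count//.
by apply: eq_eseriesr => n _; rewrite !funenegE.
Qed.

Lemma czsumE (u : int -> R[i]) : cintegrable count (u \o int_of_nat) ->
  czsum u = cint count (u \o int_of_nat).
Proof. by move=> [iR iI]; rewrite /czsum /cint zsumE// zsumE. Qed.

Lemma zsum_shift u (j : int) : zsum (fun k => u (k + j)) = zsum u.
Proof.
rewrite /zsum; congr (fine _ - fine _).
  rewrite -(esum_shift ((EFin \o u)^\+)%E j); apply: eq_esum => k _.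
  by rewrite !funeposE.
rewrite -(esum_shift ((EFin \o u)^\-)%E j); apply: eq_esum => k _.
by rewrite !funenegE.
Qed.

Lemma czsum_shift (u : int -> R[i]) (j : int) : czsum (fun k => u (k + j)) = czsum u.
Proof. by rewrite /czsum (zsum_shift (fun k => complex.Re (u k))) (zsum_shift (fun k => complex.Im (u k))). Qed.

Let I01 : set R := `[0, 1[%classic.

Lemma ge0_integral_periodization (f : R -> \bar R) : measurable_fun [set: R] f ->
    (forall x, (0 <= f x)%E) ->
  (\int[mu]_x f x = \int[mu]_(x in I01) \esum_(k in [set: int]) f (x + k%:~R)%R)%E.
Proof.
move=> mf f0; rewrite (ge0_integral_tiling ltr01 mf f0).
by apply: eq_integral => x _; apply: eq_esum => k _; rewrite mul1r.
Qed.

Lemma measurable_esum_shift (f : R -> \bar R) : measurable_fun [set: R] f ->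
    (forall x, (0 <= f x)%E) ->
  measurable_fun [set: R] (fun x => \esum_(k in [set: int]) f (x + k%:~R)%R).
Proof.
move=> mf f0.
have -> : (fun x => \esum_(k in [set: int]) f (x + k%:~R)%R) =
   (fun x => \sum_(0 <= n <oo) f (x + (int_of_nat n)%:~R)%R)%E.
  by apply/funext => x; rewrite -[LHS]/(esum _ _) esum_int.
apply: measurable_nneseries => // n.
by apply: (measurableT_comp mf); exact: measurable_shift.
Qed.

Lemma ae_periodic1 (P : R -> Prop) : (forall x (k : int), P x -> P (x + k%:~R)) ->
  {ae mu, forall x, I01 x -> P x} -> {ae mu, forall x, P x}.
Proof.
move=> perP aeP; apply: (ae_periodic ltr01 _ aeP) => x k Px.
by rewrite mul1r; exact: perP.
Qed.

(** The periodization of the absolute value of [g] has a finite integral over one period, hence is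
    finite almost everywhere there, and by periodicity on the line. *)
Lemma ae_summable (g : R -> R) : mu.-integrable [set: R] (EFin \o g) ->
  {ae mu, forall x,
     count.-integrable [set: nat] (EFin \o (fun n => g (x + (int_of_nat n)%:~R)))}.
Proof.
move=> ig; have /integrableP[mg goo] := ig.
pose F (x : R) : \bar R := (`|g x|%:E)%E.
have mF : measurable_fun [set: R] F.
  by apply/measurable_EFinP; apply: measurableT_comp => //; exact/measurable_EFinP.
have F0 x : (0 <= F x)%E by rewrite lee_fin.
pose S (x : R) : \bar R := (\esum_(k in [set: int]) F (x + k%:~R)%R)%E.
have mS : measurable_fun [set: R] S by exact: measurable_esum_shift.
have S0 x : (0 <= S x)%E by apply: esum_ge0.
have iS : mu.-integrable I01 S.
  apply/integrableP; split; first exact: measurable_funTS.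
  under eq_integral do rewrite gee0_abs//.
  by rewrite -ge0_integral_periodization.
have aeS : {ae mu, forall x, S x \is a fin_num}.
  apply: (@ae_periodic1 (fun x => S x \is a fin_num)); last first.
    by have := @integrable_ae _ _ _ mu I01 (measurable_itv _) S iS; apply: ae_lebesgueS.
  move=> x k Sx; suff -> : S (x + k%:~R) = S x by [].
  rewrite /S -[RHS](esum_shift (fun j => F (x + j%:~R)) k); apply: eq_esum => j _.
  by rewrite intrD (addrC j%:~R) addrA.
apply: ae_lebesgueS aeS => x Sx; apply/integrableP; split => //.
rewrite ge0_integral_count//.
have := Sx; rewrite ge0_fin_numE// /S -[esum _ _]/(esum _ _) esum_int//.
Qed.

(** Positive and negative parts are periodized separately, in accordance with the definition of
    [zsum] as a difference. *)
Lemma Rintegral_periodization (g : R -> R) : mu.-integrable [set: R] (EFin \o g) ->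
  mu.-integrable I01 (EFin \o (fun x => zsum (fun k => g (x + k%:~R)))) /\
  \int[mu]_x g x = \int[mu]_(x in I01) zsum (fun k => g (x + k%:~R)).
Proof.
move=> ig; have mg := measurable_int _ ig.
have mI : measurable (I01 : set (measurableTypeR R)) by exact: measurable_itv.
have key (F : R -> \bar R) : measurable_fun [set: R] F -> (forall x, 0 <= F x)%E ->
    (\int[mu]_x F x \is a fin_num)%E ->
    let S (x : R) : \bar R := (\esum_(k in [set: int]) F (x + k%:~R)%R)%E in
    mu.-integrable I01 (EFin \o (fun x => fine (S x))) /\
    (\int[mu]_x F x = \int[mu]_(x in I01) (fine (S x))%:E)%E.
  move=> mF F0 Ffin S.
  have mS : measurable_fun [set: R] S by exact: measurable_esum_shift.
  have S0 x : (0 <= S x)%E by apply: esum_ge0.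
  have ES := ge0_integral_periodization mF F0.
  have iS : mu.-integrable I01 S.
    apply/integrableP; split; first exact: measurable_funTS.
    under eq_integral do rewrite gee0_abs//.
    by rewrite -ES -ge0_fin_numE// integral_ge0.
  have mfS : measurable_fun I01 (EFin \o (fun x => fine (S x))).
    apply/measurable_EFinP; apply: measurable_funTS; apply: measurableT_comp.
      exact: fine_measurable.
    exact: mS.
  (* [fine] alters [S] only where it is infinite, which is a null set since [S] is integrable. *)
  have E : (\int[mu]_(x in I01) (fine (S x))%:E = \int[mu]_(x in I01) S x)%E.
    apply: ae_eq_integral => //; first exact: measurable_funTS.
    have := integrable_ae mI iS; apply: ae_lebesgueS => x Sx Ix.
    by rewrite fineK// Sx.
  split; last by rewrite E ES.
  apply/integrableP; split => //.
  under eq_integral do rewrite /= ger0_norm ?fine_ge0//.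
  by rewrite E -ES -ge0_fin_numE// integral_ge0.
have [ip Ep] := key _ (measurable_funepos mg) (funepos_ge0 _) (integrable_pos_fin_num measurableT ig).
have [im Em] := key _ (measurable_funeneg mg) (funeneg_ge0 _) (integrable_neg_fin_num measurableT ig).
have zE (x : R) : zsum (fun k => g (x + k%:~R)) =
    fine (\esum_(k in [set: int]) ((EFin \o g)^\+)%E (x + k%:~R)) -
    fine (\esum_(k in [set: int]) ((EFin \o g)^\-)%E (x + k%:~R)).
  rewrite /zsum; congr (fine _ - fine _); apply: eq_esum => k _.
    by rewrite !funeposE.
  by rewrite !funenegE.
under eq_fun do rewrite zE.
split; first by have := integrableB mI ip im.
rewrite RintegralB// /Rintegral integralE fineB ?Ep ?Em//.
  by rewrite -Ep; exact: integrable_pos_fin_num.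
by rewrite -Em; exact: integrable_neg_fin_num.
Qed.

(** Integrals over a period are kept as integrals over the line, the form in which [cint] and
    [trigonometric_uniqueness] are stated. *)
Definition unit_indicator (x : R) : R[i] := (\1_I01 x)%:C.

Lemma cint_periodization (g : R -> R[i]) : cintegrable mu g ->
  let p x := unit_indicator x * czsum (fun k => g (x + k%:~R)) in
  cintegrable mu p /\ cint mu g = cint mu p.
Proof.
move=> [iR iI] p; have mI : measurable (I01 : set (measurableTypeR R)) by exact: measurable_itv.
have [jR ER] := Rintegral_periodization iR.
have [jI EI] := Rintegral_periodization iI.
have pR : (fun x => complex.Re (p x)) =
    (fun x => zsum (fun k => complex.Re (g (x + k%:~R)))) \_ I01.
  apply/funext => x; rewrite /p /unit_indicator /patch cReM indicE /=.
  by case: ifP => _ /=; rewrite ?mul1r !mul0r subr0.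
have pI : (fun x => complex.Im (p x)) =
    (fun x => zsum (fun k => complex.Im (g (x + k%:~R)))) \_ I01.
  apply/funext => x; rewrite /p /unit_indicator /patch cImM indicE /=.
  by case: ifP => _ /=; rewrite ?mul1r !mul0r addr0.
split.
  split.
    by rewrite pR -restrict_EFin; exact/(integrable_mkcond _ mI).
  by rewrite pI -restrict_EFin; exact/(integrable_mkcond _ mI).
rewrite /cint ER EI; congr (_ +i* _).
  by rewrite Rintegral_mkcond -pR.
by rewrite Rintegral_mkcond -pI.
Qed.

End IntegerSums.

(** * Uniqueness of Fourier coefficients *)

Section Exponential.
Context {R : realType}.
Implicit Types x y : R.

Lemma expiD x y : expi (x + y) = expi x * expi y.
Proof. by apply: complexP; rewrite /expi !cReImE/= ?cosD ?sinD// addrC. Qed.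
Lemma expi0 : expi (0 : R) = 1.
Proof. by rewrite /expi cos0 sin0. Qed.
Lemma expiN x : expi (- x) = (expi x)^*.
Proof. by rewrite /expi cosN sinN. Qed.
Lemma expi_period (k : int) : expi (k%:~R * (2 * pi) : R) = 1.
Proof.
have n1 (n : nat) : expi (n%:R * (2 * pi) : R) = 1.
  elim: n => [|n IH]; first by rewrite mul0r expi0.
  rewrite -natr1 mulrDl expiD IH mul1r mul1r.
  by rewrite /expi (mulrC 2) mulr_natr cos2pi sin2pi.
by case: k => n; [exact: n1|rewrite NegzE mulrNz mulNr expiN n1 conjc1].
Qed.

Lemma sqn_expi x : sqn (expi x) = 1.
Proof. by rewrite /sqn/= cos2Dsin2. Qed.
Lemma measurable_sin : measurable_fun [set: R] (@sin R).
Proof. by apply: continuous_measurable_fun; exact: continuous_sin. Qed.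
Lemma measurable_cos : measurable_fun [set: R] (@cos R).
Proof. by apply: continuous_measurable_fun; exact: continuous_cos. Qed.
Lemma cmeasurable_expi d (T : measurableType d) (f : T -> R) :
  measurable_fun [set: T] f -> cmeasurable (fun z : T => expi (f z)).
Proof.
move=> mf; split => /=.
  by apply: (measurableT_comp measurable_cos mf).
by apply: (measurableT_comp measurable_sin mf).
Qed.
Lemma bernoulli_ge (s : R) n : 0 <= s <= 1 -> 1 - n%:R * s <= (1 - s) ^+ n.
Proof.
move=> /andP[s0 s1]; elim: n => [|n IH]; first by rewrite mul0r subr0.
rewrite exprS; have : (1 - s) * (1 - n%:R * s) <= (1 - s) * (1 - s) ^+ n.
  by rewrite ler_wpM2l// subr_ge0.
apply: le_trans; have : 0 <= n%:R * (s * s) by rewrite !mulr_ge0.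
rewrite -natr1; nra.
Qed.

Lemma bernoulli_le (s : R) n : 0 <= s <= 1 -> (1 - s) ^+ n * (1 + n%:R * s) <= 1.
Proof.
move=> /andP[s0 s1]; elim: n => [|n IH]; first by rewrite mul0r addr0 mulr1.
rewrite exprS; apply: le_trans IH.
have p0 : 0 <= (1 - s) ^+ n by rewrite exprn_ge0// subr_ge0.
rewrite -mulrA mulrCA ler_wpM2l//.
have : 0 <= n%:R * (s * s) by rewrite !mulr_ge0.
rewrite -natr1; nra.
Qed.

(* These polynomials in [t] separate the two halves of the interval [[0, 1]]. *)
Definition step_poly (t : R) n : R := (1 - t ^+ n) ^+ (2 ^ n).

Lemma step_poly_bound (t : R) n : 0 <= t <= 1 -> 0 <= step_poly t n <= 1.
Proof.
move=> /andP[t0 t1]; have tn : 0 <= t ^+ n <= 1 by rewrite exprn_ge0// exprn_ile1.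
by rewrite /step_poly exprn_ge0 ?exprn_ile1//; lra.
Qed.

(** Bernoulli's inequality bounds the value below by [1 - (2 * t) ^+ n]: the exponent [2 ^ n] is
    what puts the threshold at 1/2. These are the functions of the Brosowski-Deutsch proof of the
    Stone-Weierstrass theorem. *)
Lemma step_poly_cvg1 (t : R) : 0 <= t < 1 / 2 -> step_poly t n @[n --> \oo] --> (1 : R).
Proof.
move=> /andP[t0 t1].
have c : 1 - (2 * t) ^+ n @[n --> \oo] --> (1 : R).
  rewrite -[X in _ --> X]subr0; apply: cvgB; first exact: cvg_cst.
  by apply: cvg_expr; rewrite ger0_norm; lra.
apply: (@squeeze_cvgr _ _ _ _ (fun n => 1 - (2 * t) ^+ n) (fun=> 1)); last 2 first.
- exact: c.
- exact: cvg_cst.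
apply: nearW => n.
have tn : 0 <= t ^+ n <= 1 by rewrite exprn_ge0// exprn_ile1//; lra.
apply/andP; split; last first.
  by have /andP[] := @step_poly_bound t n (ltac:(lra)).
apply: le_trans (bernoulli_ge (2 ^ n) tn).
by rewrite natrX exprMn.
Qed.

(** By [bernoulli_le] the value is at most the inverse of [1 + (2 * t) ^+ n], and [2 * t] exceeds
    1. *)
Lemma step_poly_cvg0 (t : R) : 1 / 2 < t <= 1 -> step_poly t n @[n --> \oo] --> (0 : R).
Proof.
move=> /andP[t1 t2]; have t0 : 0 <= t by lra.
have c : ((2 * t)^-1) ^+ n @[n --> \oo] --> (0 : R).
  apply: cvg_expr; rewrite ger0_norm ?invr_ge0; last by lra.
  by rewrite invf_lt1; lra.
apply: (@squeeze_cvgr _ _ _ _ (fun=> 0) (fun n => ((2 * t)^-1) ^+ n)); last 2 first.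
- exact: cvg_cst.
- exact: c.
apply: nearW => n.
have tn : 0 <= t ^+ n <= 1 by rewrite exprn_ge0// exprn_ile1//; lra.
have /andP[p0 p1] := @step_poly_bound t n (ltac:(lra)).
rewrite p0/= exprVn -div1r ler_pdivlMr; last by rewrite exprn_gt0//; lra.
apply: le_trans (bernoulli_le (2 ^ n) tn); rewrite -/(step_poly t n).
by rewrite ler_wpM2l// natrX exprMn lerDr.
Qed.

End Exponential.

(** * Integrable functions on a period whose Fourier coefficients all vanish *)

Section TrigonometricUniqueness.
Context {R : realType}.
Local Notation mu := (@lebesgue_measure R).
Variables (a w : R) (G : R -> R[i]).
Hypothesis w0 : 0 < w.
Let L := 2 * pi / w.
Hypothesis iG : cintegrable mu G.
Hypothesis G0 : forall x, ~ `[a, a + L[%classic x -> G x = 0.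
Hypothesis G_coef : forall k : int, cint mu (fun x => G x * expi (k%:~R * (w * x))) = 0.

Let e (k : int) (x : R) : R[i] := expi (k%:~R * (w * x)).

Let me k : cmeasurable (e k : measurableTypeR R -> R[i]).
Proof.
apply: cmeasurable_expi; apply: measurable_funM; first exact: measurable_cst.
by apply: measurable_funM; [exact: measurable_cst|exact: measurable_id].
Qed.

(** Bounded [m] such that every Fourier coefficient of [m * G] vanishes; boundedness keeps these
    products integrable. *)
Let annihilated (m : measurableTypeR R -> R[i]) := [/\ cmeasurable m, exists C, forall x, sqn (m x) <= C &
  forall k, cint mu (fun x => m x * G x * e k x) = 0].

Let integrable_annihilated m k : annihilated m -> cintegrable mu (fun x => m x * G x * e k x).
Proof.
move=> [mm [C mC] _]; under eq_fun do rewrite mulrC.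
apply: (@cintegrableM_bounded _ _ _ _ _ _ 1) => //.
  by move=> x; rewrite sqn_expi.
exact: (@cintegrableM_bounded _ _ _ _ _ _ C).
Qed.

Let annihilated1 : annihilated (fun=> 1).
Proof.
split; first exact: cmeasurable_cst.
  by exists (sqn 1) => x.
by move=> k; rewrite -(G_coef k); apply: eq_cint => x; rewrite mul1r.
Qed.

Let annihilatedD m m' : annihilated m -> annihilated m' -> annihilated (fun x => m x + m' x).
Proof.
move=> Hm Hm'; have [mm [C mC] z] := Hm; have [mm' [C' mC'] z'] := Hm'; split.
- exact: cmeasurableD.
- exists (2 * C + 2 * C') => x; apply: (le_trans (sqnD _ _)).
  by apply: lerD; rewrite ler_wpM2l.
- move=> k; have := cintD (integrable_annihilated k Hm) (integrable_annihilated k Hm').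
  by rewrite z z' addr0 => <-; apply: eq_cint => x; rewrite !mulrDl.
Qed.

Let annihilatedZ b m : annihilated m -> annihilated (fun x => b * m x).
Proof.
move=> Hm; have [mm [C mC] z] := Hm; split.
- by apply: cmeasurableM => //; exact: cmeasurable_cst.
- by exists (sqn b * C) => x; rewrite sqnM ler_wpM2l// sqn_ge0.
- move=> k; have := cintZ b (integrable_annihilated k Hm).
  by rewrite z mulr0 => <-; apply: eq_cint => x; rewrite !mulrA.
Qed.

Let annihilated_e j m : annihilated m -> annihilated (fun x => e j x * m x).
Proof.
move=> Hm; have [mm [C mC] z] := Hm; split.
- exact: cmeasurableM.
- by exists C => x; rewrite sqnM sqn_expi mul1r.
- move=> k; rewrite -(z (j + k)); apply: eq_cint => x.
  by rewrite /e intrD mulrDl expiD; ring.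
Qed.

(** The stable functions form an algebra containing the exponentials. Powers of trigonometric
    polynomials are thus reached without being expanded into exponentials. *)
Let stable (q : R -> R[i]) := forall m, annihilated m -> annihilated (fun x => q x * m x).

Let stableM q q' : stable q -> stable q' -> stable (fun x => q x * q' x).
Proof.
by move=> Sq Sq' m /Sq'/Sq; congr annihilated; apply/funext => x; rewrite mulrA.
Qed.
Let stableD q q' : stable q -> stable q' -> stable (fun x => q x + q' x).
Proof.
move=> Sq Sq' m Hm; have := annihilatedD (Sq _ Hm) (Sq' _ Hm).
by congr annihilated; apply/funext => x; rewrite mulrDl.
Qed.
Let stableZ b q : stable q -> stable (fun x => b * q x).
Proof.
by move=> Sq m /Sq/(annihilatedZ b); congr annihilated; apply/funext => x; rewrite mulrA.
Qed.
Let stable1 : stable (fun=> 1).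
Proof. by move=> m; congr annihilated; apply/funext => x; rewrite mul1r. Qed.
Let stableX q n : stable q -> stable (fun x => q x ^+ n).
Proof.
move=> Sq; elim: n => [|n IH]; first by under eq_fun do rewrite expr0; exact: stable1.
by under eq_fun do rewrite exprS; exact: stableM.
Qed.

(* For [y] in [[a, a + L[] the product of sines is positive exactly when [a < y < x]. *)
Let t (x y : R) : R := 1 / 2 - sin (w * (y - a) / 2) * sin (w * (x - y) / 2) / 2.

Let t_stable x : stable (fun y => (t x y)%:C).
Proof.
pose b := w * (a + x) / 2; pose c := w * (x - a) / 2.
(* The product of the two sines is half of [cos (w * y - b) - cos c], so as a function of [y] only
   the frequencies 0, 1 and -1 occur. *)
have E : (fun y => (t x y)%:C) = (fun y => (1 / 2 + cos c / 4)%:C * 1 +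
    ((- (1 / 8))%:C * expi (- b)) * e 1 y + ((- (1 / 8))%:C * expi b) * e (-1) y).
  apply/funext => y.
  have -> : t x y = 1 / 2 + cos c / 4 - cos (w * y - b) / 4.
    have -> : c = w * (y - a) / 2 + w * (x - y) / 2 by rewrite /c; field.
    have -> : w * y - b = w * (y - a) / 2 - w * (x - y) / 2 by rewrite /b; field.
    by rewrite /t cosD cosB; field.
  rewrite /e (_ : (-1)%:~R * (w * y) = - (w * y)); last by rewrite mulN1r.
  rewrite [1%:~R * (w * y)]mul1r cosB; apply: complexP; rewrite !cReImE /= cosN sinN cosN sinN; by field.
rewrite E; apply: stableD; last exact/stableZ/annihilated_e.
by apply: stableD; [exact/stableZ|exact/stableZ/annihilated_e].
Qed.

Let t01 x y : 0 <= t x y <= 1.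
Proof.
set A := sin (w * (y - a) / 2); set B := sin (w * (x - y) / 2).
have : `|A * B| <= 1.
  rewrite normrM -[leRHS]mulr1 ler_pM// ler_norml ?sin_geN1 ?sin_le1//.
rewrite ler_norml /t -/A -/B; lra.
Qed.

Let cint_step_poly x n : cint mu (fun y => (step_poly (t x y) n)%:C * G y) = 0.
Proof.
have S : stable (fun y => (step_poly (t x y) n)%:C).
  have -> : (fun y => (step_poly (t x y) n)%:C) =
      (fun y => (1 + (-1) * (t x y)%:C ^+ n) ^+ (2 ^ n)).
    by apply/funext => y; rewrite mulN1r /step_poly rmorphXn rmorphB rmorphXn.
  by apply: stableX; apply: stableD => //; exact/stableZ/stableX/t_stable.
have [_ _ /(_ 0) z] := S _ annihilated1; rewrite -[RHS]z.
by apply: eq_cint => y; rewrite mulr1 /e mul0r expi0 mulr1.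
Qed.

Let L0 : 0 < L. Proof. by rewrite /L divr_gt0// mulr_gt0// pi_gt0. Qed.

(** Since [w * L = 2 * pi], both half angles lie strictly between 0 and [pi], where the sine is
    positive. *)
Let t_lt x y : a < y < x -> x < a + L -> t x y < 1 / 2.
Proof.
move=> /andP[ay yx] xL.
have wL : w * L = 2 * pi by rewrite /L; field; rewrite gt_eqF.
have s1 : 0 < sin (w * (y - a) / 2).
  apply: sin_gt0_pi; apply/andP; split; first by rewrite divr_gt0// mulr_gt0// subr_gt0.
  have : w * (y - a) < w * L by rewrite ltr_pM2l//; lra.
  by rewrite wL; lra.
have s2 : 0 < sin (w * (x - y) / 2).
  apply: sin_gt0_pi; apply/andP; split; first by rewrite divr_gt0// mulr_gt0// subr_gt0.
  have : w * (x - y) < w * L by rewrite ltr_pM2l//; lra.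
  by rewrite wL; lra.
by have := mulr_gt0 s1 s2; rewrite /t; lra.
Qed.

Let t_gt x y : a < x -> x < y < a + L -> 1 / 2 < t x y.
Proof.
move=> ax /andP[xy yL].
have wL : w * L = 2 * pi by rewrite /L; field; rewrite gt_eqF.
have s1 : 0 < sin (w * (y - a) / 2).
  apply: sin_gt0_pi; apply/andP; split; first by rewrite divr_gt0// mulr_gt0// subr_gt0; lra.
  have : w * (y - a) < w * L by rewrite ltr_pM2l//; lra.
  by rewrite wL; lra.
have s2 : 0 < sin (w * (y - x) / 2).
  apply: sin_gt0_pi; apply/andP; split; first by rewrite divr_gt0// mulr_gt0// subr_gt0.
  have : w * (y - x) < w * L by rewrite ltr_pM2l//; lra.
  by rewrite wL; lra.
have E : sin (w * (x - y) / 2) = - sin (w * (y - x) / 2).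
  by rewrite -sinN; congr sin; field.
by have := mulr_gt0 s1 s2; rewrite /t E; lra.
Qed.

Let ae_neq (x : R) : {ae mu, forall y, y != x}.
Proof.
exists [set x : R]; split; [exact: measurable_set1|exact: lebesgue_measure_set1|].
by move=> y /= /negP; rewrite negbK => /eqP.
Qed.

(** For [x] inside the period, [step_poly (t x y) n] tends to the indicator of [y < x] while staying
    in the unit interval, so the vanishing integrals pass to the limit by dominated convergence. *)
Let primitive0 (g : R -> R) : mu.-integrable [set: R] (EFin \o g) ->
    (forall x, ~ `[a, a + L[%classic x -> g x = 0) ->
    (forall x n, \int[mu]_y (step_poly (t x y) n * g y) = 0) -> \int[mu]_y g y = 0 ->
  forall x, \int[mu]_(y in [set` `]-oo, x]]) g y = 0.
Proof.
move=> ig g0 gt g1 x; have /measurable_int/measurable_EFinP mg := ig.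
have mI : measurable ([set` `]-oo, x]] : set (measurableTypeR R)) by exact: measurable_itv.
have mgI : measurable_fun [set: measurableTypeR R] (g \_ [set` `]-oo, x]]).
  by apply/(measurable_restrictT _ mI); exact: measurable_funTS.
rewrite Rintegral_mkcond.
have [xa|ax] := leP x a.
  rewrite /Rintegral (@ae_eq_integral _ _ _ mu setT (cst 0%E)) ?integral0//.
    exact/measurable_EFinP.
  apply: ae_lebesgueS (ae_neq a) => y ya _; rewrite /patch; case: ifPn => //.
  rewrite inE/= in_itv/= => yx; congr EFin; apply: g0; rewrite /= in_itv/=.
  by move=> /andP[]; rewrite le_eqVlt eq_sym (negbTE ya)/= => ay _; lra.
have [xL|Lx] := ltP x (a + L); last first.
  rewrite -[RHS]g1; apply: eq_Rintegral => y _; rewrite /patch; case: ifPn => //.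
  rewrite notin_setE/= in_itv/= => /negP; rewrite -ltNge => xy.
  by apply/esym/g0; rewrite /= in_itv/= => /andP[_ yL]; lra.
pose f_ n y := (step_poly (t x y) n * g y)%:E.
have mt n : measurable_fun [set: measurableTypeR R] (fun y => step_poly (t x y) n).
  have ms (c b : R) (F : R -> R) : (forall y, F y = c * y + b) ->
      measurable_fun [set: measurableTypeR R] (fun y => sin (F y)).
    move=> FE; apply: (measurableT_comp measurable_sin).
    rewrite (funext FE).
    exact: (measurable_funD (measurable_funM (measurable_cst c) (@measurable_id _ _ _))
      (measurable_cst b)).
  apply: measurable_funX; apply: measurable_funB => //.
  apply: measurable_funX; apply: measurable_funB => //.
  apply: measurable_funM => //; apply: measurable_funM.
    by apply: (ms (w / 2) (- (w * a / 2))) => y; field.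
  by apply: (ms (- (w / 2)) (w * x / 2)) => y; field.
have mf n : measurable_fun [set: measurableTypeR R] (f_ n).
  by apply/measurable_EFinP; exact: measurable_funM.
have mE : measurable_fun [set: measurableTypeR R] (EFin \o (g \_ [set` `]-oo, x]])).
  exact/measurable_EFinP.
have Hc : {ae mu, forall y, [set: R] y -> f_ ^~ y @ \oo --> (EFin \o (g \_ [set` `]-oo, x]])) y}.
  (* At [y = a] and [y = x] the value of [t] is exactly 1/2, the threshold that neither limit lemma
     covers; these two points are discarded. *)
  apply: ae_lebesgueS2 (ae_neq a) (ae_neq x) => y ya yx _ /=.
  rewrite /f_ /patch; apply: cvg_EFin; first exact: nearW.
  rewrite /comp/=.
  have [yL|yL] := pselect (`[a, a + L[%classic y); last first.
    by rewrite g0// if_same; under eq_fun do rewrite mulr0; exact: cvg_cst.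
  move: yL; rewrite /= in_itv/= => /andP[ay yL].
  have {}ay : a < y by rewrite lt_neqAle eq_sym ya.
  have [yx'|xy] := ltP y x.
    rewrite mem_set/=; last by rewrite in_itv/= ltW.
    rewrite -[X in _ --> X]mul1r; apply: cvgM; last exact: cvg_cst.
    apply: step_poly_cvg1; have /andP[-> _] := t01 x y.
    by rewrite t_lt// ay.
  have {}xy : x < y by rewrite lt_neqAle eq_sym yx.
  rewrite memNset/=; last by rewrite in_itv/= leNgt xy.
  rewrite -[X in _ --> X](mul0r (g y)); apply: cvgM; last exact: cvg_cst.
  by apply: step_poly_cvg0; have /andP[_ ->] := t01 x y; rewrite t_gt// xy.
have Hb : {ae mu, forall y n, [set: R] y -> (`|f_ n y| <= `|g y|%:E)%E}.
  apply: (aeW mu) => y n _; rewrite /f_ /= lee_fin normrM ler_piMl//.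
  by have /andP[? ?] := step_poly_bound n (t01 x y); rewrite ger0_norm.

have [_ _ c] := dominated_convergence measurableT mf mE Hc (integrable_norm ig) Hb.
have z n : (\int[mu]_y f_ n y)%E = 0%E.
  have i n' : mu.-integrable [set: R] (f_ n').
      apply: (le_integrable _ _ _ ig) => // y _.
      rewrite lee_fin normrM ler_piMl//.
      by have /andP[? ?] := step_poly_bound n' (t01 x y); rewrite ger0_norm.
    by rewrite -[LHS]fineK ?integrable_fin_num//; congr EFin; exact: gt.
rewrite /Rintegral; have := cvg_lim (@ereal_hausdorff _) c.
by under eq_fun do rewrite z; rewrite lim_cst// => <-.
Qed.

Let vanish (g : R -> R) : mu.-integrable [set: R] (EFin \o g) ->
    (forall x, ~ `[a, a + L[%classic x -> g x = 0) ->
    (forall x n, \int[mu]_y (step_poly (t x y) n * g y) = 0) -> \int[mu]_y g y = 0 ->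
  {ae mu, forall x, g x = 0}.
Proof.
move=> ig g0 gt g1; have z := primitive0 ig g0 gt g1.
have ly y : mu.-integrable `]-oo, y] (EFin \o g).
  by apply: integrableS ig => //; exact: measurable_itv.
(* Lebesgue differentiation: almost everywhere [g] is the derivative of its primitive, which is
   constantly 0. *)
have := FTC1Ny ly (open_integrable_locally openT ig).
apply: ae_lebesgueS => x [_ <-].
rewrite (_ : (fun x0 => _) = cst 0); last by apply/funext => y; exact: z.
exact: derive1_cst.
Qed.

Lemma trigonometric_uniqueness : {ae mu, forall x, G x = 0}.
Proof.
have cs := cint_step_poly; have [iR iI] := iG.
have c1 : cint mu G = 0.
  rewrite -[RHS](G_coef 0); apply: eq_cint => x.
  by rewrite mul0r expi0 mulr1.
have zR : {ae mu, forall x, complex.Re (G x) = 0}.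
  apply: vanish => //.
  - by move=> x /G0 ->.
  - move=> x n; have := congr1 (@complex.Re R) (cs x n); rewrite /cint/= => <-.
    by apply: eq_Rintegral => y _; rewrite cReM/= mul0r subr0.
  - by have := congr1 (@complex.Re R) c1.
have zI : {ae mu, forall x, complex.Im (G x) = 0}.
  apply: vanish => //.
  - by move=> x /G0 ->.
  - move=> x n; have := congr1 (@complex.Im R) (cs x n); rewrite /cint/= => <-.
    by apply: eq_Rintegral => y _; rewrite cImM/= mul0r addr0.
  - by have := congr1 (@complex.Im R) c1.
by apply: ae_lebesgueS2 zR zI => x r i; apply: complexP.
Qed.

End TrigonometricUniqueness.

(** * Plancherel's theorem *)

Section FullPeriod.
Context {R : realType}.
Local Notation mu := (@lebesgue_measure R).

Let is_derive_scale (c x : R) : is_derive x 1 (fun y : R => c * y) c.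
Proof.
have := is_deriveZ (f := id) c (is_derive_id x (1 : R)).
by rewrite /GRing.scale/= mulr1.
Qed.
Let is_derive_sinZ (c x : R) : is_derive x 1 (fun y => sin (c * y)) (c * cos (c * x)).
Proof.
have := is_derive1_comp (is_derive_sin (c * x)) (is_derive_scale c x).
by rewrite mulrC.
Qed.
Let is_derive_cosZ (c x : R) : is_derive x 1 (fun y => cos (c * y)) (- (c * sin (c * x))).
Proof.
have := is_derive1_comp (is_derive_cos (c * x)) (is_derive_scale c x).
by rewrite mulrC mulrN.
Qed.

Let integral_primitive (F f : R -> R) (a b : R) : a < b -> continuous f ->
  (forall x : R, is_derive x 1 F (f x)) -> \int[mu]_(x in `[a, b[%classic) f x = F b - F a.
Proof.
move=> ab cf dF.
have cF : continuous F.
  by move=> x; apply: differentiable_continuous; apply/derivable1_diffP; have [] := dF x.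
have fi : mu.-integrable `[a, b[%classic (EFin \o f).
  apply: (@integrableS _ _ _ mu `[a, b]%classic); [exact: measurable_itv|exact: measurable_itv| |].
    exact: subset_itv_co_cc.
  apply: continuous_compact_integrable; first exact: segment_compact.
  exact: continuous_subspaceT.
rewrite Rintegral_itv_bndo_bndc// /Rintegral (continuous_FTC2 (F := F))//.
- exact: continuous_subspaceT.
- split.
  + by move=> x _; have [] := dF x.
  + by apply: cvg_at_right_filter; exact: cF.
  + by apply: cvg_at_left_filter; exact: cF.
- by move=> x _; rewrite derive1E; apply: derive_val.
Qed.

Lemma cint_full_period (a L : R) (k : int) : 0 < L ->
  cint mu (fun x => (\1_(`[a, a + L[%classic : set R) x)%:C * expi (k%:~R * (2 * pi / L * x))) =
  if k == 0 then L%:C else 0.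
Proof.
move=> L0; set I : set R := `[a, a + L[%classic.
have aL : a < a + L by rewrite ltrDl.
have mI : measurable (I : set (measurableTypeR R)) by exact: measurable_itv.
have restr (f : R -> R) : \int[mu]_x (\1_I x * f x) = \int[mu]_(x in I) f x.
  rewrite [RHS]Rintegral_mkcond; apply: eq_Rintegral => x _.
  by rewrite /patch indicE; case: ifP => _; rewrite ?mul1r ?mul0r.
pose c := k%:~R * (2 * pi / L).
have -> : cint mu (fun x => (\1_I x)%:C * expi (k%:~R * (2 * pi / L * x))) =
  (\int[mu]_(x in I) cos (c * x)) +i* (\int[mu]_(x in I) sin (c * x)).
  rewrite /cint; congr (_ +i* _); rewrite -restr; apply: eq_Rintegral => x _.
    by rewrite cReM/= mul0r subr0 /c mulrA.
  by rewrite cImM/= mul0r addr0 /c mulrA.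
have [k0|k0] := eqVneq k 0.
  have -> : c = 0 by rewrite /c k0 mul0r.
  under eq_Rintegral do rewrite mul0r cos0.
  under [X in _ +i* X]eq_Rintegral do rewrite mul0r sin0.
  have -> : \int[mu]_(x in I) (1 : R) = L.
    rewrite Rintegral_cst// mul1r /I/= lebesgue_measure_itv/= lte_fin aL.
    by rewrite /= addrAC subrr add0r.
  by rewrite Rintegral_cst// mul0r.
have c0 : c != 0.
  rewrite /c mulf_neq0 ?intr_eq0// gt_eqF// divr_gt0// mulr_gt0// pi_gt0//.
have cL : c * (a + L) = c * a + k%:~R * (2 * pi).
  by rewrite /c; field; rewrite gt_eqF.
have per : expi (c * (a + L)) = expi (c * a).
  by rewrite cL expiD expi_period mulr1.
have [pc ps] : cos (c * (a + L)) = cos (c * a) /\ sin (c * (a + L)) = sin (c * a).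
  by case: per.
have ccos : continuous (fun x : R => cos (c * x)).
  by move=> x; apply: differentiable_continuous; apply/derivable1_diffP; have [] := is_derive_cosZ c x.
have csin : continuous (fun x : R => sin (c * x)).
  by move=> x; apply: differentiable_continuous; apply/derivable1_diffP; have [] := is_derive_sinZ c x.
have dsin (x : R) : is_derive x 1 (fun y => c^-1 * sin (c * y)) (cos (c * x)).
  have := is_deriveZ (f := fun y => sin (c * y)) c^-1 (is_derive_sinZ c x).
  by rewrite /GRing.scale/= mulrA mulVf// mul1r.
have dcos (x : R) : is_derive x 1 (fun y => - c^-1 * cos (c * y)) (sin (c * x)).
  have := is_deriveZ (f := fun y => cos (c * y)) (- c^-1) (is_derive_cosZ c x).
  by rewrite /GRing.scale/= mulrNN mulrA mulVf// mul1r.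
rewrite (integral_primitive aL ccos dsin) (integral_primitive aL csin dcos).
by rewrite pc ps !subrr.
Qed.
End FullPeriod.

(** * The Fourier integral of integrable functions *)

Section FourierIntegral.
Context {R : realType}.
Local Notation mu := (@lebesgue_measure R).
Implicit Types f g : R -> R[i].

Let phase (z : measurableTypeR R * measurableTypeR R) : R := - (2 * pi * z.2 * z.1).

Let kernel f (z : measurableTypeR R * measurableTypeR R) : R[i] := f z.2 * expi (phase z).

Let cmeasurable_kernel f : cmeasurable (f : measurableTypeR R -> R[i]) -> cmeasurable (kernel f).
Proof.
move=> [mR mI]; apply: cmeasurableM.
  by split; [exact: (measurableT_comp mR measurable_snd)|exact: (measurableT_comp mI measurable_snd)].
apply: cmeasurable_expi; apply: measurableT_comp => //.
apply: measurable_funM; last exact: measurable_fst.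
by apply: measurable_funM; [exact: measurable_cst|exact: measurable_snd].
Qed.

Let measurable_partial_Rintegral (k : measurableTypeR R * measurableTypeR R -> R) :
  measurable_fun [set: measurableTypeR R * measurableTypeR R] k ->
  measurable_fun [set: measurableTypeR R] (fun y => \int[mu]_x k (y, x)).
Proof.
move=> mk; have mE : measurable_fun setT (EFin \o k) by exact/measurable_EFinP.
apply: measurableT_comp; first exact: fine_measurable.
have -> : (fun y => \int[mu]_x (k (y, x))%:E)%E =
  (fun y => \int[mu]_x (EFin \o k)^\+ (y, x) - \int[mu]_x (EFin \o k)^\- (y, x))%E.
  apply/funext => y; rewrite integralE; congr (_ - _)%E.
    by apply: eq_integral => x _; rewrite !funeposE.
  by apply: eq_integral => x _; rewrite !funenegE.
apply: emeasurable_funB.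
  apply: (measurable_fun_fubini_tonelli_F (m2 := mu) ((EFin \o k)^\+)%E) => //.
  exact: measurable_funepos.
apply: (measurable_fun_fubini_tonelli_F (m2 := mu) ((EFin \o k)^\-)%E) => //.
exact: measurable_funeneg.
Qed.

Lemma cmeasurable_fourier_integral f : cmeasurable (f : measurableTypeR R -> R[i]) ->
  cmeasurable (fourier_integral f : measurableTypeR R -> R[i]).
Proof.
move=> /cmeasurable_kernel[mR mI]; split.
  exact: (measurable_partial_Rintegral mR).
exact: (measurable_partial_Rintegral mI).
Qed.

Lemma cmeasurable_phase (c : R) :
  cmeasurable (fun x : measurableTypeR R => expi (- (2 * pi * x * c))).
Proof.
apply: cmeasurable_expi; apply: measurableT_comp => //.
apply: measurable_funM; last exact: measurable_cst.
by apply: measurable_funM; [exact: measurable_cst|exact: measurable_id].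
Qed.

Lemma cintegrable_phase f c : cintegrable mu f ->
  cintegrable mu (fun x => f x * expi (- (2 * pi * x * c))).
Proof.
move=> cf; under eq_fun do rewrite mulrC.
apply: (@cintegrableM_bounded _ _ _ _ _ _ 1) => //; first exact: cmeasurable_phase.
by move=> x; rewrite sqn_expi.
Qed.

Lemma fourier_integral_lin a f g : cintegrable mu f -> cintegrable mu g ->
  fourier_integral (fun x => a * f x + g x) =
  (fun y => a * fourier_integral f y + fourier_integral g y).
Proof.
move=> cf cg; apply/funext => y; rewrite /fourier_integral.
rewrite -[cintegral]/(cint mu) -cintZ; last exact: cintegrable_phase.
rewrite -cintD; [|exact/cintegrableZ/cintegrable_phase|exact: cintegrable_phase].
by apply: eq_cint => x; rewrite mulrDl mulrA.
Qed.

Let absint f := (\int[mu]_x (`|complex.Re (f x)| + `|complex.Im (f x)|)%:E)%E.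

Let absint_fin f : cintegrable mu f -> (absint f < +oo)%E.
Proof.
move=> [iR iI]; apply: integrable_lty => //.
exact: (integrable_addr (integrable_norm iR) (integrable_norm iI)).
Qed.

(* Fubini applied to [(y, x) |-> f x * g y * expi (- 2 pi x y)]. *)
Lemma fourier_multiplication_formula f g : cintegrable mu f -> cintegrable mu g ->
  cint mu (fun y => fourier_integral f y * g y) = cint mu (fun x => f x * fourier_integral g x).
Proof.
move=> cf cg; have mf := cintegrable_meas cf; have mg := cintegrable_meas cg.
pose K z := kernel f z * g z.1.
have mK : cmeasurable K.
  apply: cmeasurableM; first exact: cmeasurable_kernel.
  have [mR mI] := mg.
  by split; [exact: (measurableT_comp mR measurable_fst)|exact: (measurableT_comp mI measurable_fst)].
(* The sum of the absolute values of the two parts dominates the modulus, so [A z.2 * B z.1] bounds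
   both parts of [K z] and is integrable on the product by Tonelli. *)
pose A x : R := `|complex.Re (f x)| + `|complex.Im (f x)|.
pose B x : R := `|complex.Re (g x)| + `|complex.Im (g x)|.
have mA : measurable_fun [set: measurableTypeR R] A.
  by have [? ?] := mf; apply: measurable_funD; exact: measurableT_comp.
have mB : measurable_fun [set: measurableTypeR R] B.
  by have [? ?] := mg; apply: measurable_funD; exact: measurableT_comp.
have A0 x : 0 <= A x by rewrite addr_ge0.
have B0 x : 0 <= B x by rewrite addr_ge0.
have iAB : (mu \x mu)%E.-integrable [set: measurableTypeR R * measurableTypeR R]
    (EFin \o (fun z => A z.2 * B z.1)).
  apply/integrable12ltyP.
    apply/measurable_EFinP; apply: measurable_funM.
      exact: (measurableT_comp mA measurable_snd).
    exact: (measurableT_comp mB measurable_fst).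
  have -> : (\int[mu]_y \int[mu]_x `|(EFin \o (fun z => A z.2 * B z.1)%R) (y, x)|
      = absint f * absint g)%E.
    transitivity (\int[mu]_y (absint f * (B y)%:E))%E.
      apply: eq_integral => y _ /=.
      under eq_integral do rewrite /= ger0_norm ?mulr_ge0// EFinM.
      by rewrite ge0_integralZr//; [exact/measurable_EFinP|move=> x _; rewrite lee_fin|rewrite lee_fin].
    rewrite ge0_integralZl//.
    - exact/measurable_EFinP.
    - by move=> x _; rewrite lee_fin.
    - by apply: integral_ge0 => x _; rewrite lee_fin addr_ge0.
  by apply: lte_mul_pinfty; [apply: integral_ge0 => x _; rewrite lee_fin addr_ge0|
    rewrite ge0_fin_numE; [exact: absint_fin|apply: integral_ge0 => x _; rewrite lee_fin addr_ge0]|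
    exact: absint_fin].
have sqle (z : R[i]) (c : R) : 0 <= c -> sqn z <= c ^+ 2 -> `|complex.Re z| <= c /\ `|complex.Im z| <= c.
  move=> c0 zc; have := sqr_ge0 (complex.Re z); have := sqr_ge0 (complex.Im z).
  rewrite -!(@ler_sqr _ `|_|) ?nnegrE// !real_normK ?num_real//; move: zc; rewrite /sqn; lra.
have sq1 (z : R[i]) : sqn z <= (`|complex.Re z| + `|complex.Im z|) ^+ 2.
  rewrite /sqn sqrrD !real_normK ?num_real// mulr2n.
  have : 0 <= `|complex.Re z| * `|complex.Im z| by rewrite mulr_ge0.
  lra.
have cK : cintegrable (mu \x mu)%E K.
  have bK z : sqn (K z) <= (A z.2 * B z.1) ^+ 2.
    rewrite /K /kernel !sqnM sqn_expi mulr1 exprMn.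
    by apply: ler_pM; rewrite ?sqn_ge0//; exact: sq1.
  apply: (cintegrable_dom mK iAB) => z.
    by have [] := sqle _ _ (mulr_ge0 (A0 z.2) (B0 z.1)) (bK z).
  by have [] := sqle _ _ (mulr_ge0 (A0 z.2) (B0 z.1)) (bK z).
have section1 y : cintegrable mu (fun x => K (y, x)).
  rewrite /K/kernel/=; under eq_fun do rewrite mulrC.
  exact/cintegrableZ/cintegrable_phase.
have section2 x : cintegrable mu (fun y => K (y, x)).
  have -> : (fun y => K (y, x)) = (fun y => f x * (g y * expi (- (2 * pi * y * x)))).
    apply/funext => y; rewrite /K /kernel /phase/= -mulrA; congr (_ * _).
    by rewrite mulrC; congr (_ * expi (- _)); ring.
  exact/cintegrableZ/cintegrable_phase.
have fub (p : R[i] -> R) :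
    (mu \x mu)%E.-integrable [set: measurableTypeR R * measurableTypeR R] (EFin \o (fun z => p (K z))) ->
    (forall y, mu.-integrable [set: R] (EFin \o (fun x => p (K (y, x))))) ->
    (forall x, mu.-integrable [set: R] (EFin \o (fun y => p (K (y, x))))) ->
  \int[mu]_y (\int[mu]_x p (K (y, x))) = \int[mu]_x (\int[mu]_y p (K (y, x))).
  move=> ip i1 i2; apply: (congr1 fine).
  transitivity (\int[mu]_y \int[mu]_x (EFin \o (fun z => p (K z))) (y, x))%E.
    by apply: eq_integral => y _; rewrite fineK//; exact: (integrable_fin_num _ (i1 y)).
  rewrite (Fubini ip); apply: eq_integral => x _; rewrite fineK//.
  exact: (integrable_fin_num _ (i2 x)).
have [KR KI] := cK.
have E1 : cint mu (fun y => fourier_integral f y * g y) = cint mu (fun y => cint mu (fun x => K (y, x))).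
  apply: eq_cint => y; rewrite mulrC /fourier_integral -[cintegral]/(cint mu) -cintZ.
    by apply: eq_cint => x; rewrite /K /kernel /phase/= mulrC.
  exact: cintegrable_phase.
have E2 : cint mu (fun x => f x * fourier_integral g x) = cint mu (fun x => cint mu (fun y => K (y, x))).
  apply: eq_cint => x; rewrite /fourier_integral -[cintegral]/(cint mu) -cintZ.
    apply: eq_cint => y; apply/esym; rewrite /K /kernel /phase/= -mulrA; congr (_ * _).
    by rewrite mulrC; congr (_ * expi (- _)); ring.
  exact: cintegrable_phase.
rewrite E1 E2; apply: complexP.
  exact: (fub (@complex.Re R) KR (fun y => (section1 y).1) (fun x => (section2 x).1)).
exact: (fub (@complex.Im R) KI (fun y => (section1 y).2) (fun x => (section2 x).2)).
Qed.

End FourierIntegral.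

(** * Isometry for functions supported in a bounded interval *)

Section CompactIsometry.
Context {R : realType}.
Local Notation mu := (@lebesgue_measure R).
Variables (a L : R).
Hypothesis L0 : 0 < L.
Let I : set R := `[a, a + L[%classic.
Let mI : measurable (I : set (measurableTypeR R)). Proof. exact: measurable_itv. Qed.
Let ind (x : measurableTypeR R) : R[i] := (\1_I x)%:C.
Let w := 2 * pi / L.
Let E (k : int) (x : measurableTypeR R) : R[i] := expi (k%:~R * (w * x)).
Let c : R := (Num.sqrt L)^-1.

Let cmeas_ind : cmeasurable ind.
Proof. by apply: cmeasurable_real; exact: measurable_indic. Qed.

Let ind_sqn x : sqn (ind x) = \1_I x.
Proof. by rewrite sqn_real indicE; case: (_ \in _); rewrite ?expr1n ?expr0n. Qed.

Let ind_out x : ~ I x -> ind x = 0.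
Proof. by move=> Ix; rewrite /ind indicE memNset. Qed.

Let ind_id x : ind x * ind x = ind x.
Proof. by rewrite /ind indicE; case: (_ \in _); rewrite ?mulr1 ?mulr0. Qed.

Let ind_conj x : (ind x)^* = ind x.
Proof. by rewrite /ind indicE; case: (_ \in _); rewrite ?conjc1 ?conjc0. Qed.

Let cmeas_E k : cmeasurable (E k).
Proof.
apply: cmeasurable_expi; apply: measurable_funM; first exact: measurable_cst.
by apply: measurable_funM; [exact: measurable_cst|exact: measurable_id].
Qed.

Let muI : mu I = L%:E.
Proof. by rewrite /I lebesgue_measure_itv/= lte_fin ltrDl L0 -EFinB addrAC subrr add0r. Qed.

Let integrable_ind : mu.-integrable [set: R] (EFin \o \1_I).
Proof. exact: integrable_indic_itv. Qed.

Let cint_ind : cintegrable mu ind.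
Proof.
apply: (cintegrable_dom cmeas_ind integrable_ind) => x /=; first by rewrite ger0_norm.
by rewrite normr0.
Qed.

Let c2L : c ^+ 2 * L = 1.
Proof. by rewrite /c exprVn sqr_sqrtr ?ltW// mulVf// gt_eqF. Qed.

Let square_basis (b : R) k : csquare_integrable mu (fun x => b%:C * (ind x * E k x)).
Proof.
split.
  apply: cmeasurableM; first exact: cmeasurable_cst.
  exact: cmeasurableM.
under eq_integral do rewrite !sqnM sqn_expi mulr1 ind_sqn EFinM.
rewrite ge0_integralZl_EFin ?sqn_ge0//; last first.
  by apply/measurable_EFinP; exact: measurable_indic.
by rewrite integral_indic// setIT [X in (_ * X)%E]muI -EFinM ltry.
Qed.

Let basis n : L2 mu := L2mk (square_basis c (int_of_nat n)).

Let ip_basis (u : L2 mu) n : L2ip u (basis n) =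
  c%:C * cint mu (fun x => u x * (ind x * E (int_of_nat n) x)^*).
Proof.
rewrite /L2ip -cintZ; last first.
  have := cintegrable_mulJ (L2_square u) (square_basis 1 (int_of_nat n)).
  by under eq_fun do rewrite mul1r.
apply: eq_cint => x; rewrite -[basis n x]/(c%:C * (ind x * E (int_of_nat n) x)).
by rewrite (conjcM c%:C) (conjc_real c) mulrCA.
Qed.

Let basis_orthonormal i j : L2ip (basis i) (basis j) = (i == j)%:R.
Proof.
rewrite ip_basis; set k := int_of_nat i - int_of_nat j.
have -> : cint mu (fun x => basis i x * (ind x * E (int_of_nat j) x)^*) =
    c%:C * cint mu (fun x => ind x * E k x).
  rewrite -cintZ.
    apply: eq_cint => x; rewrite -[basis i x]/(c%:C * (ind x * E (int_of_nat i) x)).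
    rewrite conjcM ind_conj.
    have -> : E k x = E (int_of_nat i) x * (E (int_of_nat j) x)^*.
      by rewrite /E -expiN -expiD; congr expi; rewrite /k intrD mulrNz mulrDl mulNr.
    by rewrite -[in RHS]ind_id; ring.
  under eq_fun do rewrite mulrC; apply: (@cintegrableM_bounded _ _ _ _ _ _ 1) => //.
  by move=> x; rewrite sqn_expi.
rewrite (cint_full_period a k L0) mulrA -rmorphM -expr2.
have -> : (k == 0) = (i == j).
  rewrite /k subr_eq0; apply/eqP/eqP => [|->//].
  by have [_ inj _] := int_of_nat_bij; apply: inj; rewrite inE.
by case: eqP => _; rewrite ?mulr0// -rmorphM c2L.
Qed.

(** For fixed [theta] the samples of the transform at [theta + k / L] are, up to the factor [c], the
    Fourier coefficients over [I] of [f] modulated by [theta]. Parseval makes the sum of their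
    squares equal to [L * Nf] for every [theta]; integrating over a tile of length [L^-1] gives the
    norm of the transform. *)
Lemma fourier_integral_compact_isometry (f : R -> R[i]) : csquare_integrable mu f ->
    (forall x, ~ I x -> f x = 0) ->
  [/\ cintegrable mu f, csquare_integrable mu (fourier_integral f) &
    (\int[mu]_x (sqn (fourier_integral f x))%:E = \int[mu]_x (sqn (f x))%:E)%E].
Proof.
move=> f2 f0; have [mf _] := f2.
have f_ind x : f x = f x * ind x.
  have [Ix|/f0 ->] := pselect (I x); last by rewrite mul0r.
  by rewrite /ind indicE mem_set// mulr1.
have if_ : cintegrable mu f.
  (* On a bounded interval square integrable functions are integrable: [f] is multiplied by the
     indicator of [I], which is the element with factor 1 and frequency 0. *)
  have := cintegrable_mulJ f2 (square_basis 1 0).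
  congr (cintegrable _ _); apply/funext => x.
  by rewrite mul1r /E mul0r expi0 mulr1 ind_conj -f_ind.
pose h := L^-1.
have h0 : 0 < h by rewrite invr_gt0.
have mF := cmeasurable_fourier_integral mf.
pose Nf := hnorm2 (@L2ip _ _ _ mu) (L2mk f2).
have key (theta : R) :
    (\esum_(k in [set: int]) (sqn (fourier_integral f (theta + h * k%:~R)))%:E = (L * Nf)%:E)%E.
  pose ft x := expi (- (2 * pi * x * theta)) * f x.
  have sq_ft x : sqn (ft x) = sqn (f x) by rewrite sqnM sqn_expi mul1r.
  have ft2 : csquare_integrable mu ft.
    split; first by apply: cmeasurableM => //; exact: cmeasurable_phase.
    by under eq_integral do rewrite sq_ft; have [] := f2.
  pose u := L2mk ft2.
  have Nu : hnorm2 (@L2ip _ _ _ mu) u = Nf.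
    by apply: EFin_inj; rewrite !hnorm2_L2; apply: eq_integral => x _; rewrite sq_ft.
  have coef n : L2ip u (basis n) = c%:C * fourier_integral f (theta + h * (int_of_nat n)%:~R).
    rewrite ip_basis; congr (_ * _); apply: eq_cint => x.
    have -> : expi (- (2 * pi * x * (theta + h * (int_of_nat n)%:~R))) =
        expi (- (2 * pi * x * theta)) * (E (int_of_nat n) x)^*.
      by rewrite /E -expiN -expiD; congr expi; rewrite /w /h; field; rewrite gt_eqF.
    by rewrite conjcM ind_conj -[u x]/(ft x) /ft [in RHS]f_ind; ring.
  have [s [s_orth sle s_cvg]] := parseval (L2_prehilbert mu) basis_orthonormal (@L2_complete _ _ _ mu) u.
  (* The exponentials are complete over [I]: the remainder [u - s], cut to [I], has all its
     coefficients zero. *)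
  have us : {ae mu, forall x, (u x - s x) * ind x = 0}.
    have wL : 2 * pi / w = L.
      by rewrite /w invf_div mulrCA mulfV ?mulr1// gt_eqF// mulr_gt0// pi_gt0.
    have w0 : 0 < w by rewrite /w divr_gt0// mulr_gt0// pi_gt0.
    apply: (trigonometric_uniqueness (a := a) w0).
    - have := cintegrable_mulJ (L2_square (u - s)) (square_basis 1 0).
      congr (cintegrable _ _); apply/funext => x.
      by rewrite mul1r /E mul0r expi0 mulr1 ind_conj.
    - by rewrite wL => x /ind_out ->; rewrite mulr0.
    (* The inner product conjugates the basis vector, so the coefficient of frequency [k] comes from
       the vector of index [- k]. *)
    - move=> k; have [_ _ surj] := int_of_nat_bij; have [n _ En] := surj (- k) Logic.I.
      have := s_orth n; rewrite ip_basis => /eqP; rewrite mulf_eq0 => /orP[|/eqP <-].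
        move=> /eqP/(congr1 (@complex.Re R)) /= c0.
        by have := c2L; rewrite c0 expr0n mul0r => /eqP; rewrite eq_sym oner_eq0.
      apply: eq_cint => x; rewrite conjcM ind_conj mulrA; congr (_ * _).
      by rewrite /E -expiN En mulrNz mulNr opprK.
  (* Bessel gives that the norm of [s] is at most that of [u]. Conversely [u] equals [s] almost
     everywhere on [I] and vanishes outside. *)
  have us' : Nf = hnorm2 (@L2ip _ _ _ mu) s.
    apply/eqP; rewrite eq_le -{2}Nu sle andbT -Nu -lee_fin !hnorm2_L2.
    apply: ae_ge0_le_integral => //.
    - by move=> x _; rewrite lee_fin sqn_ge0.
    - exact/measurable_EFin_sqn/L2_meas.
    - by move=> x _; rewrite lee_fin sqn_ge0.
    - exact/measurable_EFin_sqn/L2_meas.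
    - apply: ae_lebesgueS us => x /= ux _; rewrite lee_fin.
      have [Ix|Ix] := pselect (I x); last by rewrite sq_ft (f0 _ Ix) /sqn/= expr0n/= addr0 sqn_ge0.
      move: ux; rewrite /ind indicE mem_set// mulr1 => /eqP; rewrite subr_eq0 => /eqP E'.
      by rewrite -E'.
  rewrite -[esum _ _]/(esum _ (fun k => (sqn (fourier_integral f (theta + h * k%:~R)))%:E)).
  rewrite esum_int; last by move=> k; rewrite lee_fin sqn_ge0.
  apply: cvg_lim => //.
  have -> : (fun n => \sum_(0 <= i < n) (sqn (fourier_integral f (theta + h * (int_of_nat i)%:~R)))%:E)%E
    = EFin \o (fun n => L * \sum_(0 <= i < n) sqn (L2ip u (basis i))).
    apply/funext => n /=; rewrite sumEFin mulr_sumr; congr EFin; apply: eq_bigr => i _.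
    by rewrite coef sqnM sqn_real mulrA (mulrC L) c2L mul1r.
  apply: cvg_EFin; first exact: nearW.
  by rewrite us'; apply: cvgM => //; exact: cvg_cst.
have EF : (\int[mu]_x (sqn (fourier_integral f x))%:E = \int[mu]_x (sqn (f x))%:E)%E.
  rewrite (ge0_integral_tiling h0 (measurable_EFin_sqn mF)); last first.
    by move=> x; rewrite lee_fin sqn_ge0.
  under eq_integral do rewrite key.
  rewrite integral_cst; last exact: measurable_itv.
  rewrite /= lebesgue_measure_itv/= lte_fin h0 oppr0 adde0 -EFinM.
  rewrite -[RHS](hnorm2_L2 (L2mk f2)) -/Nf; congr EFin.
  by rewrite mulrAC /h mulfV ?mul1r// gt_eqF.
split => //; split => //.
by rewrite EF; have [] := f2.
Qed.

End CompactIsometry.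

(** * Extension to all square integrable functions by density *)

Section Plancherel.
Context {R : realType}.
Local Notation mu := (@lebesgue_measure R).
Local Notation L2R := (L2 mu).
Local Notation ip := (@L2ip _ _ _ mu).
Local Notation N := (hnorm2 ip).
Let Hip : prehilbert ip := L2_prehilbert mu.

Section Truncation.
Variable n : nat.
(** The symmetric window in the form [[a, a + L[] of the compact isometry; [n.+1] keeps its length
    positive. *)
Let J : set R := `[- n.+1%:R, - n.+1%:R + 2 * n.+1%:R[%classic.
Let mJ : measurable (J : set (measurableTypeR R)). Proof. exact: measurable_itv. Qed.

Let square_trunc (u : L2R) : csquare_integrable mu (fun x => (\1_J x)%:C * u x).
Proof.
have [mu_ uoo] := L2_square u; split.
  apply: cmeasurableM => //; apply: cmeasurable_real; exact: measurable_indic.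
apply: le_lt_trans uoo; apply: ge0_le_integral => //.
- by move=> x _; rewrite lee_fin sqn_ge0.
- apply: measurable_EFin_sqn; apply: cmeasurableM => //; apply: cmeasurable_real; exact: measurable_indic.
- exact: measurable_EFin_sqn.
- move=> x _; rewrite lee_fin sqnM sqn_real indicE; case: (_ \in _).
    by rewrite expr1n mul1r.
  by rewrite expr0n mul0r sqn_ge0.
Qed.

Definition truncation (u : L2R) : L2R := L2mk (square_trunc u).

Let J_gt0 : 0 < 2 * n.+1%:R :> R. Proof. by rewrite mulr_gt0. Qed.

Let truncation_out u x : ~ J x -> truncation u x = 0.
Proof. by move=> Jx; rewrite /truncation/= indicE memNset// mul0r. Qed.

Lemma truncation_cintegrable u : cintegrable mu (truncation u).
Proof.
by have [] := fourier_integral_compact_isometry J_gt0 (L2_square _) (@truncation_out u).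
Qed.

Let square_fourier_truncation u : csquare_integrable mu (fourier_integral (truncation u)).
Proof.
by have [] := fourier_integral_compact_isometry J_gt0 (L2_square _) (@truncation_out u).
Qed.

Definition fourier_truncation (u : L2R) : L2R := L2mk (square_fourier_truncation u).

Lemma hnorm2_fourier_truncation u : N (fourier_truncation u) = N (truncation u).
Proof.
apply: EFin_inj; rewrite !hnorm2_L2.
by have [] := fourier_integral_compact_isometry J_gt0 (L2_square _) (@truncation_out u).
Qed.

Lemma truncation_lin a u v : truncation (a *: u + v) = a *: truncation u + truncation v.
Proof.
apply/val_inj/funext => x; rewrite -[LHS]/((\1_J x)%:C * (a * u x + v x)).
by rewrite -[RHS]/(a * ((\1_J x)%:C * u x) + (\1_J x)%:C * v x) mulrDr mulrCA.
Qed.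

Lemma fourier_truncation_lin a u v :
  fourier_truncation (a *: u + v) = a *: fourier_truncation u + fourier_truncation v.
Proof.
apply/val_inj; rewrite -[LHS]/(fourier_integral (truncation (a *: u + v))) truncation_lin.
exact: (fourier_integral_lin a (truncation_cintegrable u) (truncation_cintegrable v)).
Qed.

Lemma fourier_truncation_ip u v :
  ip (fourier_truncation u) (fourier_truncation v) = ip (truncation u) (truncation v).
Proof.
apply: (polarization Hip fourier_truncation_lin truncation_lin).
exact: hnorm2_fourier_truncation.
Qed.

End Truncation.

Let in_window (x : R) n : (x \in (`[- n.+1%:R, - n.+1%:R + 2 * n.+1%:R[%classic : set R)) =
  (- n.+1%:R <= x < n.+1%:R).
Proof.
rewrite (_ : - n.+1%:R + 2 * n.+1%:R = n.+1%:R :> R); last by ring.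
by apply/idP/idP; rewrite inE/= in_itv/=.
Qed.

Let truncE n (u : L2R) x : truncation n u x = if - n.+1%:R <= x < n.+1%:R then u x else 0.
Proof. by rewrite /truncation/= indicE in_window; case: ifP; rewrite ?mul1r ?mul0r. Qed.

Let window_near (x : R) : \forall n \near \oo, - n.+1%:R <= x < n.+1%:R.
Proof.
exists (Num.trunc `|x|) => // n /= Mn.
have : `|x| < n.+1%:R by apply: (lt_le_trans (truncnS_gt _)); rewrite ler_nat.
by rewrite ltr_norml => /andP[/ltW -> ->].
Qed.

Lemma truncation_cvg u : hcvg ip (fun n => truncation n u) u.
Proof.
pose f_ n x : \bar R := (sqn (truncation n u x - u x))%:E.
have mf n : measurable_fun [set: measurableTypeR R] (f_ n).
  exact: (measurable_EFin_sqn (L2_meas (truncation n u - u))).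
have [mu_ iu] := (csquare_integrableP _ _).1 (L2_square u).
have Hc : {ae mu, forall x, [set: R] x -> f_ ^~ x @ \oo --> (cst 0%E x)}.
  apply: (aeW mu) => x _; apply: cvg_near_cst.
  apply: filterS (window_near x) => n xn.
  by rewrite /f_ truncE xn subrr /sqn/= expr0n/= addr0.
have Hb : {ae mu, forall x n, [set: R] x -> (`|f_ n x| <= (sqn (u x))%:E)%E}.
  apply: (aeW mu) => x n _; rewrite /f_ gee0_abs lee_fin ?sqn_ge0// truncE.
  case: ifP => _; first by rewrite subrr {1}/sqn/= expr0n/= addr0 sqn_ge0.
  by rewrite sub0r /sqn !cReImE !sqrrN.
have [_ _ c] := dominated_convergence measurableT mf (measurable_cst _) Hc iu Hb.
rewrite integral0 in c.
have E n : (\int[mu]_x f_ n x)%E = (N (truncation n u - u))%:E by rewrite hnorm2_L2.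
have {}c : (N (truncation n u - u))%:E @[n --> \oo] --> 0%:E.
  by under eq_fun do rewrite -E; exact: c.
exact: (fine_cvg c).
Qed.

Lemma fourier_truncation_cauchy u : hcauchy ip (fun n => fourier_truncation n u).
Proof.
move=> e e0; have [M HM] := hcvg_cauchy Hip (truncation_cvg u) e0.
exists M => m n Mm Mn.
wlog mn : m n Mm Mn / (m <= n)%N.
  move=> H; have [|/ltnW] := leqP m n => mn; first exact: H.
  by rewrite (hnorm2BC Hip); exact: H.
(* The smaller window is contained in the larger one, so both transforms are taken in window [n],
   where the transform is linear and isometric. *)
have E : truncation m u = truncation n (truncation m u).
  apply/val_inj/funext => x; rewrite [LHS]truncE [RHS]truncE truncE.
  case: (boolP (- m.+1%:R <= x < m.+1%:R)) => xm; last by rewrite if_same.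
  suff -> : - n.+1%:R <= x < n.+1%:R by [].
  have : m.+1%:R <= n.+1%:R :> R by rewrite ler_nat.
  by move: xm => /andP[]; move: (m.+1%:R) (n.+1%:R) => p q *; apply/andP; split; lra.
have FE m' n' v v' : truncation m' v = truncation n' v' ->
    fourier_truncation m' v = fourier_truncation n' v'.
  by move=> tE; apply/val_inj; rewrite -[LHS]/(fourier_integral (truncation m' v)) tE.
have -> : fourier_truncation m u - fourier_truncation n u =
    fourier_truncation n (-1 *: u + truncation m u).
  by rewrite fourier_truncation_lin scaleN1r [RHS]addrC (FE m n u (truncation m u) E).
rewrite hnorm2_fourier_truncation truncation_lin scaleN1r -E [X in N X]addrC.
exact: HM.
Qed.

Let fourier_limit u : exists v, hcvg ip (fun n => fourier_truncation n u) v.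
Proof. exact: (L2_complete (fourier_truncation_cauchy u)). Qed.

Definition fourierL2 u : L2R := projT1 (cid (fourier_limit u)).

Lemma fourierL2_cvg u : hcvg ip (fun n => fourier_truncation n u) (fourierL2 u).
Proof. exact: (projT2 (cid (fourier_limit u))). Qed.

Lemma fourierL2_ip u v : ip (fourierL2 u) (fourierL2 v) = ip u v.
Proof.
apply: (hcvg_ip_eq Hip (fourierL2_cvg u) (fourierL2_cvg v) (truncation_cvg u) (truncation_cvg v)).
by move=> n; exact: fourier_truncation_ip.
Qed.

Lemma hnorm2_fourierL2 u : N (fourierL2 u) = N u.
Proof. by rewrite /hnorm2 fourierL2_ip. Qed.

(** [fourierL2] chooses a limit, which is determined only up to seminorm zero; hence linearity in
    this form. *)
Lemma fourierL2_lin a u v : N (fourierL2 (a *: u + v) - (a *: fourierL2 u + fourierL2 v)) = 0.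
Proof.
apply: (hcvg_unique Hip (fourierL2_cvg _)).
under eq_fun do rewrite fourier_truncation_lin.
exact: (hcvg_lin Hip a (fourierL2_cvg u) (fourierL2_cvg v)).
Qed.

Let square_conj (u : L2R) : csquare_integrable mu (fun x => (u x)^*).
Proof.
have [mu_ uoo] := L2_square u; split; first exact: cmeasurableJ.
by under eq_integral do rewrite sqnJ.
Qed.

Let conj (u : L2R) : L2R := L2mk (square_conj u).

Let hnorm2_conjB u v : N (conj u - conj v) = N (u - v).
Proof.
apply: EFin_inj; rewrite !hnorm2_L2; apply: eq_integral => x _.
by rewrite -sqnJ -[(conj u - conj v) x]/((u x)^* - (v x)^*) rmorphB /= !conjcK.
Qed.

Let conjK u : conj (conj u) = u.
Proof. by apply/val_inj/funext => x; rewrite /= conjcK. Qed.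

Let hnorm2_conj u : N (conj u) = N u.
Proof.
by apply: EFin_inj; rewrite !hnorm2_L2; apply: eq_integral => x _; rewrite sqnJ.
Qed.

(** The multiplication formula in the limit of truncations; the conjugations convert its bilinear
    pairing into the inner product. *)
Let fourierL2_conj u v : ip (fourierL2 u) (conj v) = ip u (conj (fourierL2 v)).
Proof.
have cv w_ w : hcvg ip w_ w -> hcvg ip (fun n => conj (w_ n)) (conj w).
  by apply: (hcvg_le Hip) => n; rewrite hnorm2_conjB.
apply: (hcvg_ip_eq Hip (fourierL2_cvg u) (cv _ _ (truncation_cvg v)) (truncation_cvg u)
  (cv _ _ (fourierL2_cvg v))) => n.
have := fourier_multiplication_formula (truncation_cintegrable n u) (truncation_cintegrable n v).
move=> M; transitivity (cint mu (fun y => fourier_integral (truncation n u) y * truncation n v y)).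
  by apply: eq_cint => x; congr (_ * _); exact: conjcK.
by rewrite M; apply: eq_cint => x; congr (_ * _); apply/esym; exact: conjcK.
Qed.

(** The preimage is the inverse transform, written as the conjugate of the transform of the
    conjugate of [v]. By [fourierL2_conj] the inner product of its transform with [v] is [ip u u];
    as all norms agree, the distance is 0. *)
Lemma fourierL2_surj v : exists u, N (fourierL2 u - v) = 0.
Proof.
exists (conj (fourierL2 (conj v))).
set u := conj _.
have E : ip (fourierL2 u) v = ip u u by rewrite -[in LHS](conjK v) fourierL2_conj.
rewrite (hnorm2B Hip) E hnorm2_fourierL2 -/(N u).
have -> : N u = N v by rewrite /u hnorm2_conj hnorm2_fourierL2 hnorm2_conj.
by ring.
Qed.

(** The transforms of the truncations converge pointwise to the integral, by domination, and in mean
    to [fourierL2 u]; Fatou's lemma identifies the two limits. *)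
Lemma fourierL2_integral (u : L2R) : cintegrable mu u ->
  {ae mu, forall y, fourierL2 u y = fourier_integral u y}.
Proof.
move=> iu; have mu_ := cintegrable_meas iu.
have pw (p : R[i] -> R) y : (forall z, `|p z| <= `|complex.Re z| + `|complex.Im z|) ->
    (forall f : R -> R[i], cmeasurable f -> measurable_fun [set: measurableTypeR R] (fun x => p (f x))) ->
    (forall z : R[i], z = 0 -> p z = 0) ->
  \int[mu]_x p (truncation n u x * expi (- (2 * pi * x * y))) @[n --> \oo] -->
  \int[mu]_x p (u x * expi (- (2 * pi * x * y))).
  move=> p_le mp p0.
  pose v x := u x * expi (- (2 * pi * x * y)).
  have [iR iI] : cintegrable mu v by exact: cintegrable_phase.
  pose g x := `|complex.Re (v x)| + `|complex.Im (v x)|.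
  have ig : mu.-integrable [set: R] (EFin \o g).
    exact: (integrable_addr (integrable_norm iR) (integrable_norm iI)).
  pose f_ n x := (p (truncation n u x * expi (- (2 * pi * x * y))))%:E.
  have mf n : measurable_fun [set: measurableTypeR R] (f_ n).
    apply/measurable_EFinP; apply: (mp (fun x => truncation n u x * expi (- (2 * pi * x * y)))).
    exact: (cmeasurableM (L2_meas (truncation n u)) (cmeasurable_phase y)).
  have mv : measurable_fun [set: measurableTypeR R] (fun x => (p (v x))%:E).
    apply/measurable_EFinP; apply: (mp v).
    by apply: cmeasurableM => //; exact: cmeasurable_phase.
  have Hc : {ae mu, forall x, [set: R] x -> f_ ^~ x @ \oo --> (p (v x))%:E}.
    apply: (aeW mu) => x _; apply: cvg_near_cst.
    by apply: filterS (window_near x) => n xn; rewrite /f_ truncE xn.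
  have Hb : {ae mu, forall x n, [set: R] x -> (`|f_ n x| <= (g x)%:E)%E}.
    apply: (aeW mu) => x n _; rewrite /f_ truncE lee_fin; case: ifP => _; first exact: p_le.
    by rewrite mul0r p0// normr0 addr_ge0.
  have [ipv _ c] := dominated_convergence measurableT mf mv Hc ig Hb.
  apply: fine_cvg; rewrite fineK; last exact: (integrable_fin_num _ ipv).
  exact: c.
have pwR y : complex.Re (fourier_truncation n u y) @[n --> \oo] --> complex.Re (fourier_integral u y).
  apply: (pw (@complex.Re R)) => [z|f []//|z ->//]; by rewrite lerDl.
have pwI y : complex.Im (fourier_truncation n u y) @[n --> \oo] --> complex.Im (fourier_integral u y).
  apply: (pw (@complex.Im R)) => [z|f []//|z ->//]; by rewrite lerDr.
have mF := cmeasurable_fourier_integral mu_.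
have mD : cmeasurable (fun y => fourierL2 u y - fourier_integral u y).
  by apply: cmeasurableB => //; exact: L2_meas.
have small (e : R) : 0 < e -> (\int[mu]_y (sqn (fourierL2 u y - fourier_integral u y))%:E <= e%:E)%E.
  move=> e0; have /cvgr_lt/(_ _ e0)[M _ HM] := fourierL2_cvg u.
  apply: (@fatou_ae_le _ _ _ mu (fun n y => sqn (fourierL2 u y - fourier_truncation (n + M) u y))).
  - by move=> n; apply: measurable_sqn; exact: (L2_meas (fourierL2 u - fourier_truncation (n + M) u)).
  - exact: measurable_sqn.
  - by move=> n y; exact: sqn_ge0.
  - by move=> y; exact: sqn_ge0.
  - apply: (aeW mu) => y.
    rewrite (cvg_shiftn M (fun n => sqn (fourierL2 u y - fourier_truncation n u y))).
    rewrite /sqn !cReImE; under eq_fun do rewrite !cReImE.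
    by apply: cvgD; apply: cvgM; apply: cvgB => //; exact: cvg_cst.
  - move=> n; rewrite -[X in (X <= _)%E](hnorm2_L2 (fourierL2 u - fourier_truncation (n + M) u)).
    by rewrite lee_fin (hnorm2BC Hip); apply/ltW/HM; rewrite /=; lia.
have z : (\int[mu]_y (sqn (fourierL2 u y - fourier_integral u y))%:E = 0)%E.
  apply/eqP; rewrite eq_le; apply/andP; split; last first.
    by apply: integral_ge0 => y _; rewrite lee_fin sqn_ge0.
  by apply/lee_addgt0Pr => e e0; rewrite add0e; exact: small.
have [/(_ _)] := ae_eq_integral_abs mu measurableT (measurable_EFin_sqn mD).
under eq_integral do rewrite gee0_abs ?lee_fin ?sqn_ge0//.
move=> /(_ z) + _; apply: ae_lebesgueS => y /= /(_ Logic.I)[] /eqP.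
by move=> /eqP/sqn_eq0/eqP; rewrite subr_eq0 => /eqP.
Qed.

End Plancherel.

(** * The operator [fourier] and its action on [L2] *)

Section FourierOperator.
Context {R : realType}.
Local Notation mu := (@lebesgue_measure R).
Local Notation L2R := (L2 mu).
Local Notation ip := (@L2ip _ _ _ mu).
Local Notation N := (hnorm2 ip).
Implicit Types f g : R -> R[i].
Let Hip : prehilbert ip := L2_prehilbert mu.

Lemma L2funP f : L2fun f <-> csquare_integrable mu f.
Proof.
have Lfun2P (g : R -> R) : g \in Lfun mu (2%:E : \bar R) <->
    measurable_fun [set: measurableTypeR R] g /\ mu.-integrable [set: R] (EFin \o (fun x => g x ^+ 2)).
  split=> [g2|[mg ig]].
    split; last exact: Lfun2_integrable_sqr.
    by have := sub_Lfun_mfun g2; rewrite inE.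
  apply/andP; rewrite !inE; split => //.
  rewrite /= /finite_norm unlock /Lnorm.
  apply: poweR_lty; apply: le_lt_trans (integrable_lty measurableT ig).
  rewrite le_eqVlt; apply/orP; left; apply/eqP; apply: eq_integral => x _ /=.
  by rewrite powR_mulrn// real_normK// num_real.
rewrite csquare_integrableP; split.
  move=> [/Lfun2P[mR iR] /Lfun2P[mI iI]]; split => //.
  exact: (integrable_addr iR iI).
move=> [[mR mI] i2]; split; apply/Lfun2P; split => //.
  apply: (le_integrable _ _ _ i2) => //.
    by apply/measurable_EFinP; exact: measurable_funX.
  by move=> x _; rewrite lee_fin !ger0_norm ?sqn_ge0 ?sqr_ge0// /sqn lerDl sqr_ge0.
apply: (le_integrable _ _ _ i2) => //.
  by apply/measurable_EFinP; exact: measurable_funX.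
by move=> x _; rewrite lee_fin !ger0_norm ?sqn_ge0 ?sqr_ge0// /sqn lerDr sqr_ge0.
Qed.

Let L2mk_irrelevance f g (Hf : csquare_integrable mu f) (Hg : csquare_integrable mu g) :
  f = g -> L2mk Hf = L2mk Hg.
Proof. by move=> fg; apply/val_inj. Qed.

(** Because [fourier] is chosen by [xget], its properties hold only once some operator is shown to
    have them; [fourierL2] is that witness. *)
Lemma fourier_spec : unitary_L2 (@fourier R) /\
  forall f, L1fun f -> L2fun f -> fourier f = fourier_integral f %[ae mu].
Proof.
suff ex : exists F : (R -> R[i]) -> (R -> R[i]), [set F | unitary_L2 F /\
    forall f, L1fun f -> L2fun f -> F f = fourier_integral f %[ae mu]] F.
  exact: (xgetPex (fun f => f) ex).
pose F f : R -> R[i] := if pselect (csquare_integrable mu f) is left H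
  then fourierL2 (L2mk H) else f.
have FE f (H : csquare_integrable mu f) : F f = fourierL2 (L2mk H).
  by rewrite /F; case: pselect => // H'; congr (L2val (fourierL2 _)); exact: L2mk_irrelevance.
exists F; split; first split.
- by move=> f /L2funP H; apply/L2funP; rewrite (FE _ H); exact: L2_square.
- move=> a f g /L2funP Hf /L2funP Hg.
  rewrite (FE _ (csquare_integrable_lin a Hf Hg)) (FE _ Hf) (FE _ Hg).
  have := fourierL2_lin a (L2mk Hf) (L2mk Hg).
  rewrite (_ : a *: L2mk Hf + L2mk Hg = L2mk (csquare_integrable_lin a Hf Hg)); last exact: val_inj.
  by move/L2_ae_eq; apply: ae_lebesgueS => x + _.
- move=> f g /L2funP Hf /L2funP Hg; rewrite (FE _ Hf) (FE _ Hg).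
  exact: fourierL2_ip.
- move=> g /L2funP Hg; have [u /L2_ae_eq Hu] := fourierL2_surj (L2mk Hg).
  exists u; first by apply/L2funP; exact: L2_square.
  rewrite (FE _ (L2_square u)).
  rewrite (_ : L2mk _ = u); last exact: val_inj.
  by move: Hu; apply: ae_lebesgueS => x + _.
- move=> f f1 /L2funP Hf; rewrite (FE _ Hf).
  by have := fourierL2_integral (u := L2mk Hf) f1; apply: ae_lebesgueS => x + _.
Qed.

Lemma fourier_square f : csquare_integrable mu f -> csquare_integrable mu (fourier f).
Proof. by have [[H _ _ _] _] := fourier_spec => /L2funP/H/L2funP. Qed.

Definition hatL2 (u : L2R) : L2R := L2mk (fourier_square (L2_square u)).

Lemma hatL2_ip u v : ip (hatL2 u) (hatL2 v) = ip u v.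
Proof.
have [[_ _ H _] _] := fourier_spec; apply: H; apply/L2funP; exact: L2_square.
Qed.

Lemma hatL2_ae_lin a u v :
  {ae mu, forall y, hatL2 (a *: u + v) y = a * hatL2 u y + hatL2 v y}.
Proof.
have [[_ H _ _] _] := fourier_spec.
have := H a u v ((L2funP u).2 (L2_square u)) ((L2funP v).2 (L2_square v)).
by apply: ae_lebesgueS => y /(_ Logic.I).
Qed.

Lemma hatL2_surj v : exists u, N (hatL2 u - v) = 0.
Proof.
have [[_ _ _ H] _] := fourier_spec.
have [f /L2funP Hf E] := H v ((L2funP v).2 (L2_square v)).
exists (L2mk Hf); apply: hnorm2_L2_ae; apply: ae_lebesgueS E => y /(_ Logic.I) E.
by apply/eqP; rewrite L2subE subr_eq0; apply/eqP.
Qed.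

Lemma hatL2_integral (u : L2R) : cintegrable mu u ->
  {ae mu, forall y, hatL2 u y = fourier_integral u y}.
Proof.
have [_ H] := fourier_spec => iu; have := H u iu ((L2funP u).2 (L2_square u)).
by apply: ae_lebesgueS => y /(_ Logic.I).
Qed.

(** Expanding both sides into inner products avoids the linearity of the transform, which is known
    almost everywhere only. *)
Lemma hatL2B u v : N (hatL2 u - hatL2 v) = N (u - v).
Proof. by rewrite !(hnorm2B Hip) /hnorm2 !hatL2_ip. Qed.

Lemma hatL2_hcvg s l : hcvg ip s l -> hcvg ip (fun n => hatL2 (s n)) (hatL2 l).
Proof. by apply: (hcvg_le Hip) => n; rewrite hatL2B. Qed.

End FourierOperator.

(** * The Fourier transform turns translations into modulations *)

Section Translation.
Context {R : realType}.
Local Notation mu := (@lebesgue_measure R).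
Local Notation L2R := (L2 mu).
Local Notation ip := (@L2ip _ _ _ mu).
Local Notation N := (hnorm2 ip).
Let Hip : prehilbert ip := L2_prehilbert mu.

Lemma cintegrable_shift (c : R) (f : R -> R[i]) : cintegrable mu f ->
  cintegrable mu (fun x => f (x + c)).
Proof. by move=> [iR iI]; split; [exact: (integrable_shift c iR)|exact: (integrable_shift c iI)]. Qed.

Lemma cint_shift (c : R) (f : R -> R[i]) : cintegrable mu f ->
  cint mu (fun x => f (x + c)) = cint mu f.
Proof.
move=> [iR iI]; apply: complexP; first exact: (Rintegral_shift c iR).
exact: (Rintegral_shift c iI).
Qed.

Lemma cmeasurable_shift (c : R) (f : R -> R[i]) : cmeasurable (f : measurableTypeR R -> R[i]) ->
  cmeasurable ((fun x => f (x + c)) : measurableTypeR R -> R[i]).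
Proof.
move=> [mR mI]; split.
  exact: (measurableT_comp mR (measurable_shift c)).
exact: (measurableT_comp mI (measurable_shift c)).
Qed.

Lemma integral_sqn_translate (k : int) (f : R -> R[i]) :
  cmeasurable (f : measurableTypeR R -> R[i]) ->
  (\int[mu]_x (sqn (translate k f x))%:E = \int[mu]_x (sqn (f x))%:E)%E.
Proof.
move=> mf; rewrite [RHS](ge0_integral_shift (- k%:~R)) ?preimage_setT//.
- exact: measurable_EFin_sqn.
- by move=> x; rewrite lee_fin sqn_ge0.
Qed.

Lemma square_translate (k : int) (f : R -> R[i]) : csquare_integrable mu f ->
  csquare_integrable mu (translate k f).
Proof.
move=> [mf foo]; split; first exact: cmeasurable_shift.
by rewrite integral_sqn_translate.
Qed.

Let translateL2 k (u : L2R) : L2R := L2mk (square_translate k (L2_square u)).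

Let translateL2_hcvg k s l : hcvg ip s l -> hcvg ip (fun n => translateL2 k (s n)) (translateL2 k l).
Proof.
apply: (hcvg_le Hip) => n; rewrite -lee_fin !hnorm2_L2.
by rewrite -(integral_sqn_translate k (L2_meas (s n - l))).
Qed.

Let modulation (k : int) (y : measurableTypeR R) : R[i] := expi (- (2 * pi * k%:~R * y)).

Let cmeasurable_modulation k : cmeasurable (modulation k).
Proof.
apply: cmeasurable_expi; apply: measurableT_comp => //.
Qed.

Let square_modulation k (u : L2R) : csquare_integrable mu (fun y => modulation k y * u y).
Proof.
have [mu_ uoo] := L2_square u; split; first exact: cmeasurableM.
by under eq_integral do rewrite sqnM sqn_expi mul1r.
Qed.

Let modulateL2 k (u : L2R) : L2R := L2mk (square_modulation k u).

Let modulateL2_hcvg k s l : hcvg ip s l -> hcvg ip (fun n => modulateL2 k (s n)) (modulateL2 k l).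
Proof.
apply: (hcvg_le Hip) => n; rewrite -lee_fin !hnorm2_L2.
apply: ge0_le_integral => //.
- by move=> x _; rewrite lee_fin sqn_ge0.
- exact: (measurable_EFin_sqn (L2_meas (modulateL2 k (s n) - modulateL2 k l))).
- exact: (measurable_EFin_sqn (L2_meas (s n - l))).
- move=> x _; rewrite lee_fin -[(modulateL2 k (s n) - _) x]/(modulation k x * s n x - modulation k x * l x).
  by rewrite -mulrBr sqnM sqn_expi mul1r.
Qed.

Lemma fourier_integral_translate k (f : R -> R[i]) y : cintegrable mu f ->
  fourier_integral (translate k f) y = modulation k y * fourier_integral f y.
Proof.
move=> cf; rewrite /fourier_integral -![cintegral]/(cint mu).
have ck : cintegrable mu (fun x => translate k f x * expi (- (2 * pi * x * y))).
  by apply: cintegrable_phase; exact: cintegrable_shift.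
rewrite -(cint_shift k%:~R ck) -cintZ; last exact: cintegrable_phase.
apply: eq_cint => x; rewrite /translate addrK mulrCA; congr (_ * _).
by rewrite /modulation -expiD; congr expi; ring.
Qed.

(** A change of variables proves the rule for truncations, where the transform is an integral.
    Translation and modulation are isometric, so both sides pass to the limit. *)
Lemma fourier_translate k (u : L2R) :
  {ae mu, forall y, fourier (translate k u) y = expi (- (2 * pi * k%:~R * y)) * fourier u y}.
Proof.
suff : N (hatL2 (translateL2 k u) - modulateL2 k (hatL2 u)) = 0 by move/L2_ae_eq.
apply: (hcvg_unique Hip (s_ := fun n => hatL2 (translateL2 k (truncation n u)))).
  exact/hatL2_hcvg/translateL2_hcvg/truncation_cvg.
apply: (@hcvg_le _ _ _ Hip _ _ (fun n => modulateL2 k (hatL2 (truncation n u))) (modulateL2 k (hatL2 u))).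
  move=> n; rewrite (@hnorm2_eq0_sub _ _ _ Hip _ (modulateL2 k (hatL2 (truncation n u))))//.
  apply: hnorm2_L2_ae.
  have ct := truncation_cintegrable n u.
  have ctk : cintegrable mu (translateL2 k (truncation n u)) by exact: cintegrable_shift.
  apply: ae_lebesgueS2 (hatL2_integral ct) (hatL2_integral ctk) => y E1 E2.
  apply/eqP; rewrite L2subE subr_eq0 E2 -[modulateL2 k _ y]/(modulation k y * hatL2 (truncation n u) y).
  by rewrite E1 -fourier_integral_translate.
exact/modulateL2_hcvg/hatL2_hcvg/truncation_cvg.
Qed.

End Translation.

(** * Brackets and periodic multipliers *)

Section Bracket.
Context {R : realType}.
Local Notation mu := (@lebesgue_measure R).
Local Notation count := (@counting nat R).
Implicit Types (u v m : measurableTypeR R -> R[i]) (x : R).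

(** The values of [u] along [x + Z], indexed by [nat] so that a square summable fibre is an element
    of [L2 count]. *)
Definition fiber u x (n : nat) : R[i] := u (x + (int_of_nat n)%:~R).
Definition square_summable u x := csquare_integrable count (fiber u x).
Definition periodic m := forall x (k : int), m (x + k%:~R) = m x.
Definition square_sum u x : \bar R := (\esum_(k in [set: int]) (sqn (u (x + k%:~R)))%:E)%E.

Lemma cmeasurable_nat (a : nat -> R[i]) : cmeasurable a.
Proof. by split=> _ Y _. Qed.

Lemma square_sum_ge0 u x : (0 <= square_sum u x)%E.
Proof. by apply: esum_ge0 => k _; rewrite lee_fin sqn_ge0. Qed.

Lemma square_sumE u x : square_sum u x = (\int[count]_n (sqn (fiber u x n))%:E)%E.
Proof.
rewrite /square_sum -[LHS]/(esum _ _) esum_int; last by move=> k; rewrite lee_fin sqn_ge0.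
by rewrite ge0_integral_count// => n; rewrite lee_fin sqn_ge0.
Qed.

Lemma square_summableP u x : square_summable u x <-> (square_sum u x < +oo)%E.
Proof.
rewrite square_sumE; split; first by case.
by move=> oo; split => //; exact: cmeasurable_nat.
Qed.

(** A bracket at [x] depends on its arguments along all of [x + Z], so an almost everywhere identity
    must first be made to hold on the whole orbit. *)
Lemma ae_all_shifts (P : R -> Prop) : {ae mu, forall x, P x} ->
  {ae mu, forall x, forall k : int, P (x + k%:~R)}.
Proof.
move=> aeP; have : {ae mu, forall x, forall n : nat, P (x + (int_of_nat n)%:~R)}.
  by apply/ae_foralln => n; exact: (ae_shift (int_of_nat n)%:~R aeP).
apply: ae_lebesgueS => x Px k; have [_ _ surj] := int_of_nat_bij.
by have [n _ <-] := surj k Logic.I.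
Qed.

Lemma ae_square_summable u : csquare_integrable mu u ->
  {ae mu, forall x, square_summable u x}.
Proof.
move=> /csquare_integrableP[_ /ae_summable]; apply: ae_lebesgueS => x iu.
by apply/csquare_integrableP; split; [exact: cmeasurable_nat|exact: iu].
Qed.

Lemma fiber_mulJ_cintegrable u v x : square_summable u x -> square_summable v x ->
  cintegrable count (fun n => fiber u x n * (fiber v x n)^*).
Proof. exact: cintegrable_mulJ. Qed.

Lemma bracketE u v x : square_summable u x -> square_summable v x ->
  bracket u v x = cint count (fun n => fiber u x n * (fiber v x n)^*).
Proof.
move=> su sv; apply: (czsumE (u := fun k => u (x + k%:~R) * (v (x + k%:~R))^*)).
exact: fiber_mulJ_cintegrable.
Qed.

Lemma bracket_periodic u v x (k : int) : bracket u v (x + k%:~R) = bracket u v x.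
Proof.
rewrite /bracket -(czsum_shift (fun j => u (x + j%:~R) * (v (x + j%:~R))^*) k).
by congr czsum; apply/funext => j; rewrite intrD (addrC j%:~R) addrA.
Qed.

Lemma square_sum_periodic u x (k : int) : square_sum u (x + k%:~R) = square_sum u x.
Proof.
rewrite /square_sum -[RHS](esum_shift (fun j => (sqn (u (x + j%:~R)))%:E) k).
by apply: eq_esum => j _; rewrite intrD (addrC j%:~R) addrA.
Qed.

Lemma bracketC u v x : square_summable u x -> square_summable v x ->
  bracket v u x = (bracket u v x)^*.
Proof.
move=> su sv; rewrite !bracketE// -cintJ; last exact: fiber_mulJ_cintegrable.
by apply: eq_cint => n; rewrite conjcM conjcK mulrC.
Qed.

Let fiberL2 u x (su : square_summable u x) : L2 count := L2mk su.

Lemma bracket_cauchy_schwarz u v x : square_summable u x -> square_summable v x ->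
  sqn (bracket u v x) <= fine (square_sum u x) * fine (square_sum v x).
Proof.
move=> su sv; rewrite bracketE// !square_sumE.
have := cauchy_schwarz (L2_prehilbert count) (fiberL2 su) (fiberL2 sv).
by rewrite -!(hnorm2_L2 (fiberL2 _)).
Qed.

Lemma bracket_self u x : square_summable u x -> bracket u u x = (fine (square_sum u x))%:C.
Proof.
move=> su; rewrite bracketE// square_sumE -(hnorm2_L2 (fiberL2 su))/=.
exact: (hnorm2E (L2_prehilbert count) (fiberL2 su)).
Qed.

Lemma bracket_linl u v w a x : square_summable u x -> square_summable v x -> square_summable w x ->
  bracket (fun y => a * u y + v y) w x = a * bracket u w x + bracket v w x.
Proof.
move=> su sv sw; have su' : square_summable (fun y => a * u y + v y) x.
  exact: (csquare_integrable_lin a su sv).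
rewrite !bracketE// -cintZ; last exact: fiber_mulJ_cintegrable.
rewrite -cintD; [|exact/cintegrableZ/fiber_mulJ_cintegrable|exact: fiber_mulJ_cintegrable].
by apply: eq_cint => n; rewrite mulrA -mulrDl.
Qed.

Lemma eq_bracket u v u' v' x : (forall k : int, u (x + k%:~R) = u' (x + k%:~R)) ->
  (forall k : int, v (x + k%:~R) = v' (x + k%:~R)) -> bracket u v x = bracket u' v' x.
Proof. by move=> uu' vv'; rewrite /bracket; congr czsum; apply/funext => k; rewrite uu' vv'. Qed.

Lemma square_sum_mul m u x : periodic m -> square_summable u x ->
  square_sum (fun y => m y * u y) x = (sqn (m x) * fine (square_sum u x))%:E.
Proof.
move=> pm su; rewrite !square_sumE -(hnorm2_L2 (fiberL2 su)).
transitivity (hnorm2 (@L2ip _ _ _ count) (m x *: fiberL2 su))%:E; last first.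
  by rewrite (hnorm2Z (L2_prehilbert count)).
by rewrite hnorm2_L2; apply: eq_integral => n _; rewrite /fiber pm.
Qed.

(** On the fibre over [x] a periodic [m] is the constant [m x]. *)
Lemma bracket_mull m u v x : periodic m -> square_summable u x -> square_summable v x ->
  bracket (fun y => m y * u y) v x = m x * bracket u v x.
Proof.
move=> pm su sv; have s0 : square_summable (fun=> 0) x.
  exact: csquare_integrable0.
rewrite (@eq_bracket _ v (fun y => m x * u y + (fun=> 0) y) v)//; last first.
  by move=> k; rewrite pm addr0.
rewrite bracket_linl//.
have -> : bracket (fun=> 0) v x = 0.
  apply: sqn_eq0; apply/eqP; rewrite eq_le sqn_ge0 andbT.
  apply: (le_trans (bracket_cauchy_schwarz s0 sv)).
  suff -> : square_sum (fun=> 0) x = 0%E by rewrite mul0r.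
  by apply: esum1 => k _; rewrite /sqn/= expr0n/= addr0.
by rewrite addr0.
Qed.

Lemma measurable_square_sum u : cmeasurable u ->
  measurable_fun [set: measurableTypeR R] (square_sum u).
Proof.
move=> mu_; apply: (measurable_esum_shift (f := fun x => (sqn (u x))%:E)).
  exact: measurable_EFin_sqn.
by move=> x; rewrite lee_fin sqn_ge0.
Qed.

Lemma measurable_zsum (g : R -> R) : measurable_fun [set: measurableTypeR R] g ->
  measurable_fun [set: measurableTypeR R] (fun x => zsum (fun k => g (x + k%:~R))).
Proof.
move=> mg; have mE : measurable_fun [set: R] (EFin \o g) by exact/measurable_EFinP.
have fm (F : R -> \bar R) : measurable_fun [set: R] F -> (forall x, 0 <= F x)%E ->
    measurable_fun [set: R] (fun x => fine (\esum_(k in [set: int]) F (x + k%:~R)%R)).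
  move=> mF F0; apply: measurableT_comp; first exact: fine_measurable.
  exact: measurable_esum_shift.
have -> : (fun x => zsum (fun k => g (x + k%:~R))) = (fun x : R =>
    fine (\esum_(k in [set: int]) ((EFin \o g)^\+)%E (x + k%:~R)%R) -
    fine (\esum_(k in [set: int]) ((EFin \o g)^\-)%E (x + k%:~R)%R)).
  apply/funext => x; rewrite /zsum; congr (fine _ - fine _); apply: eq_esum => k _.
    by rewrite !funeposE.
  by rewrite !funenegE.
apply: measurable_funB; apply: fm => //; [exact: measurable_funepos|exact: measurable_funeneg].
Qed.

Lemma cmeasurable_bracket u v : cmeasurable u -> cmeasurable v -> cmeasurable (bracket u v : measurableTypeR R -> R[i]).
Proof.
move=> mu_ mv; have [mR mI] := cmeasurableM mu_ (cmeasurableJ mv).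
by split; [exact: (measurable_zsum mR)|exact: (measurable_zsum mI)].
Qed.

(** Periodizing the integral produces a fibre sum, from which [m] factors out. Integrability of the
    product is asked for because [m] may be unbounded. *)
Lemma cint_mul_bracket u v m : csquare_integrable mu u -> csquare_integrable mu v ->
    cmeasurable m -> periodic m -> cintegrable mu (fun x => m x * u x * (v x)^*) ->
  let p x := unit_indicator x * (m x * bracket u v x) in
  cintegrable mu p /\ cint mu (fun x => m x * u x * (v x)^*) = cint mu p.
Proof.
move=> u2 v2 mm pm ig p; have [ip' ->] := cint_periodization ig.
have mp : cmeasurable p.
  apply: cmeasurableM.
    by apply: cmeasurable_real; apply: measurable_indic; exact: measurable_itv.
  by apply: cmeasurableM => //; apply: cmeasurable_bracket; [have [] := u2|have [] := v2].
have E : {ae mu, forall x,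
    unit_indicator x * czsum (fun k => m (x + k%:~R) * u (x + k%:~R) * (v (x + k%:~R))^*) = p x}.
  apply: ae_lebesgueS2 (ae_square_summable u2) (ae_square_summable v2) => x su sv.
  by congr (_ * _); exact: (bracket_mull pm su sv).
split; last exact: (cint_ae (cintegrable_meas ip') mp E).
exact: (cintegrable_ae ip' mp E).
Qed.

End Bracket.

(** * Orthogonality to translates read off the bracket *)

Section Multipliers.
Context {R : realType}.
Local Notation mu := (@lebesgue_measure R).
Local Notation L2R := (L2 mu).
Local Notation ip := (@L2ip _ _ _ mu).
Implicit Types (u v p : L2R) (m : measurableTypeR R -> R[i]).

Let wave (k : int) (x : measurableTypeR R) : R[i] := expi (k%:~R * (2 * pi * x)).

Lemma wave_periodic k : periodic (wave k).
Proof.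
move=> x j; rewrite /wave mulrDr mulrDr expiD.
suff -> : expi (k%:~R * (2 * pi * j%:~R)) = 1 :> R[i] by rewrite mulr1.
by rewrite (mulrC (2 * pi)) mulrA -intrM expi_period.
Qed.

Lemma cmeasurable_wave k : cmeasurable (wave k).
Proof. by apply: cmeasurable_expi; apply: measurableT_comp => //. Qed.

Lemma bracket_ae_eq0 u v :
    (forall k : int, cint mu (fun x => wave k x * u x * (v x)^*) = 0) ->
  {ae mu, forall x, bracket u v x = 0}.
Proof.
move=> coef; pose G (x : R) := unit_indicator x * bracket u v x.
have Gk k : cintegrable mu (fun x => unit_indicator x * (wave k x * bracket u v x)) /\
    cint mu (fun x => unit_indicator x * (wave k x * bracket u v x)) = 0.
  have ig : cintegrable mu (fun x => wave k x * u x * (v x)^*).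
    have := cintegrableM_bounded (cmeasurable_wave k) (C := 1) _ (L2_cintegrable u v).
    rewrite (_ : (fun x => _) = (fun x => wave k x * u x * (v x)^*)); last first.
      by apply/funext => x; rewrite mulrA.
    by apply => x; rewrite sqn_expi.
  have [ip1 E] := cint_mul_bracket (L2_square u) (L2_square v) (cmeasurable_wave k)
    (@wave_periodic k) ig.
  by split => //; rewrite -E.
have G_int : cintegrable mu G.
  have [+ _] := Gk 0; rewrite (_ : (fun x => _) = G)//; apply/funext => x.
  by rewrite /wave mul0r expi0 mul1r.
have G0 : {ae mu, forall x, G x = 0}.
  (* Frequency [2 * pi] and origin 0 make the period the unit interval. *)
  apply: (@trigonometric_uniqueness _ 0 (2 * pi)) => //.
  - by rewrite mulr_gt0// pi_gt0.
  - move=> x; rewrite add0r divff ?gt_eqF ?mulr_gt0 ?pi_gt0// => xI.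
    by rewrite /G /unit_indicator indicE memNset// mul0r.
  - move=> k; have [_ <-] := Gk k; apply: eq_cint => x.
    by rewrite /G -mulrA (mulrC (bracket _ _ _)).
apply: ae_periodic1 => [x k|]; first by rewrite bracket_periodic.
apply: ae_lebesgueS G0 => x + xI; rewrite /G /unit_indicator indicE mem_set//.
by rewrite mul1r.
Qed.

Lemma cint_bracket_ae_eq0 u v m : cmeasurable m -> periodic m ->
    cintegrable mu (fun x => m x * u x * (v x)^*) ->
  {ae mu, forall x, m x * bracket u v x = 0} ->
  cint mu (fun x => m x * u x * (v x)^*) = 0.
Proof.
move=> mm pm ig z; have [ip1 ->] := cint_mul_bracket (L2_square u) (L2_square v) mm pm ig.
transitivity (cint mu (fun=> 0)); last by rewrite /cint !Rintegral_cst// !mul0r.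
apply: cint_ae; [exact: (cintegrable_meas ip1)|exact: (cmeasurable_cst _)|].
by apply: ae_lebesgueS z => x ->; rewrite mulr0.
Qed.

Lemma bracket_orthogonal u v : (forall k, inner u (translate k v) = 0) <->
  {ae mu, forall x, bracket (hatL2 u) (hatL2 v) x = 0}.
Proof.
have E k : inner u (translate k v) = cint mu (fun x => wave k x * hatL2 u x * (hatL2 v x)^*).
  have <- : ip u (L2mk (square_translate k (L2_square v))) = inner u (translate k v) by [].
  rewrite -hatL2_ip; apply: cint_ae; [exact/cintegrable_meas/L2_cintegrable| |].
    apply: cmeasurableM; last exact/cmeasurableJ/L2_meas.
    by apply: cmeasurableM; [exact: cmeasurable_wave|exact: L2_meas].
  apply: ae_lebesgueS (fourier_translate k v) => x Ex.
  rewrite -[hatL2 (L2mk _) x]/(fourier (translate k v) x) Ex conjcM -expiN opprK.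
  by rewrite mulrCA mulrA /wave; congr (expi _ * _ * _); ring.
split=> [H|H k].
  by apply: bracket_ae_eq0 => k; rewrite -E.
rewrite E; apply: cint_bracket_ae_eq0; [exact: cmeasurable_wave|exact: wave_periodic| |].
  have := cintegrableM_bounded (cmeasurable_wave k) (C := 1) _ (L2_cintegrable (hatL2 u) (hatL2 v)).
  rewrite (_ : (fun x => _) = (fun x => wave k x * hatL2 u x * (hatL2 v x)^*)); last first.
    by apply/funext => x; rewrite mulrA.
  by apply => x; rewrite sqn_expi.
by apply: ae_lebesgueS H => x ->; rewrite mulr0.
Qed.

End Multipliers.

Section ClosedSubspaces.
Context {R : realType}.
Local Notation mu := (@lebesgue_measure R).
Local Notation L2R := (L2 mu).
Local Notation ip := (@L2ip _ _ _ mu).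
Local Notation N := (hnorm2 ip).
Let Hip : prehilbert ip := L2_prehilbert mu.
Implicit Types (u v : L2R).

Lemma normsq_L2 u : normsq u = (N u)%:E.
Proof. by rewrite hnorm2_L2; apply: eq_integral => x _; rewrite normc_sqr. Qed.

Variable W : set (R -> R[i]).
Hypothesis closedW : closed_subspace W.

Lemma closed_subspace_ae u v : W u -> N (u - v) = 0 -> W v.
Proof.
move=> Wu uv; have [_ _ _ cl] := closedW; apply: cl => [|e e0].
  by apply/L2funP; exact: L2_square.
exists u => //; rewrite -[fun x => _]/(L2val (v - u)) normsq_L2.
by rewrite (hnorm2BC Hip) uv lte_fin.
Qed.

Lemma closed_subspace_projection u :
  exists2 h : L2R, W h & forall g : L2R, W g -> ip (u - h) g = 0.
Proof.
have [_ W0 W_lin cl] := closedW.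
apply: (orthogonal_projection Hip (W := [set v : L2R | W v])) => //.
- by move=> a v w Wv Ww; exact: W_lin.
- move=> v Hv; apply: cl => [|e e0]; first by apply/L2funP; exact: L2_square.
  have [g Wg ge] := Hv e e0; exists g => //.
  by rewrite -[fun x => _]/(L2val (v - g)) normsq_L2 lte_fin.
- exact: L2_complete.
Qed.

End ClosedSubspaces.

(** * Members of [W] as periodic multiples of the transform of [phi] *)

Section FrameMultipliers.
Context {R : realType}.
Local Notation mu := (@lebesgue_measure R).
Local Notation L2R := (L2 mu).
Local Notation ip := (@L2ip _ _ _ mu).
Local Notation N := (hnorm2 ip).
Local Notation I01 := (`[0, 1[%classic : set R).
Let Hip : prehilbert ip := L2_prehilbert mu.
Implicit Types (u v : L2R) (m : measurableTypeR R -> R[i]).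

Variables (W : set (R -> R[i])) (phi : L2R).
Hypothesis closedW : closed_subspace W.
Hypothesis frameW : is_frame W (fun k => translate k phi).
Let p := hatL2 phi.

(** The component [h2] of [h] orthogonal to [W] has zero bracket with [p], so its inner product with
    [h], an integral of [m] times [[p, h2]], vanishes. It is also orthogonal to [h1], hence to
    itself. *)
Lemma multiplier_mem m (h : L2R) : cmeasurable m -> periodic m ->
  {ae mu, forall x, hatL2 h x = m x * p x} -> W h.
Proof.
move=> mm pm hE; have [h1 Wh1 orth] := closed_subspace_projection closedW h.
apply: (closed_subspace_ae closedW Wh1); rewrite (hnorm2BC Hip).
set h2 := h - h1; have [Wk _] := frameW.
have /bracket_orthogonal b2 : forall k, inner h2 (translate k phi) = 0.
  by move=> k; exact: (orth (L2mk (square_translate k (L2_square phi))) (Wk k)).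
have b2' : {ae mu, forall x, m x * bracket p (hatL2 h2) x = 0}.
  have := ae_lebesgueS2 _ (ae_square_summable (L2_square p)) (ae_square_summable (L2_square (hatL2 h2))).
  move=> /(_ _ (fun x sp s2 => bracketC s2 sp)); apply: ae_lebesgueS2 b2 => x b ->.
  by rewrite b conjc0 mulr0.
have meas : cmeasurable (fun x => m x * p x * (hatL2 h2 x)^*).
  by apply: cmeasurableM; [apply: cmeasurableM => //; exact: L2_meas|exact/cmeasurableJ/L2_meas].
have E : {ae mu, forall x, hatL2 h x * (hatL2 h2 x)^* = m x * p x * (hatL2 h2 x)^*}.
  by apply: ae_lebesgueS hE => x ->.
have hh2 : ip h h2 = 0.
  rewrite -hatL2_ip; rewrite -(cint_bracket_ae_eq0 mm pm _ b2').
    by apply: cint_ae => //; exact/cintegrable_meas/L2_cintegrable.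
  exact: (cintegrable_ae (L2_cintegrable _ _) meas E).
rewrite /hnorm2 {1}/h2 (ipBl Hip) hh2 (ip_conj Hip h2) (orth _ Wh1).
by rewrite conjc0 subr0.
Qed.

(* The quotient of brackets [[w, p] / [p, p]], with value 0 where [[p, p] = 0]. *)
Let mult (w : L2R) (x : measurableTypeR R) : R[i] :=
  bracket (hatL2 w) p x * ((fine (square_sum p x))^-1)%:C.

Let cmeasurable_mult w : cmeasurable (mult w).
Proof.
apply: cmeasurableM; first by apply: cmeasurable_bracket; exact: L2_meas.
apply: cmeasurable_real.
rewrite (_ : (fun x => _) = (fun x => fine (square_sum p x) `^ (-1))); last first.
  by apply/funext => x; rewrite powR_inv1// fine_ge0// square_sum_ge0.
apply: (measurableT_comp (measurable_powR _)).
apply: measurableT_comp; first exact: fine_measurable.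
exact: (measurable_square_sum (L2_meas p)).
Qed.

Let periodic_mult w : periodic (mult w).
Proof. by move=> x k; rewrite /mult bracket_periodic square_sum_periodic. Qed.

(** Cauchy-Schwarz on each fibre bounds the squared modulus of [[w, p]] divided by [[p, p]] by
    [[w, w]]; integrating over a period bounds the norm by that of [w]. *)
Let square_mult w : csquare_integrable mu (fun x => mult w x * p x).
Proof.
have mm : cmeasurable (fun x => mult w x * p x).
  by apply: cmeasurableM; [exact: cmeasurable_mult|exact: L2_meas].
split => //; have [mw] := L2_square (hatL2 w); apply: le_lt_trans.
have tile (u : measurableTypeR R -> R[i]) : cmeasurable u ->
    (\int[mu]_x (sqn (u x))%:E = \int[mu]_(x in I01) square_sum u x)%E.
  move=> mu_; apply: (ge0_integral_periodization (f := fun x => (sqn (u x))%:E)).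
    exact: measurable_EFin_sqn.
  by move=> x; rewrite lee_fin sqn_ge0.
rewrite !tile//.
apply: ae_ge0_le_integral; first exact: measurable_itv.
- by move=> x _; exact: square_sum_ge0.
- by apply: measurable_funTS; apply: measurable_square_sum => //; exact: L2_meas.
- by move=> x _; exact: square_sum_ge0.
- by apply: measurable_funTS; apply: measurable_square_sum => //; exact: L2_meas.
apply: ae_lebesgueS2 (ae_square_summable (L2_square p)) (ae_square_summable (L2_square (hatL2 w))).
move=> x sp sw _.
rewrite square_sum_mul//.
have [n0 n1] := (square_sum_ge0 p x, square_sum_ge0 (hatL2 w) x).
have /square_summableP sw' := sw.
rewrite -[leRHS]fineK ?ge0_fin_numE// lee_fin /mult sqnM sqn_real.
have := bracket_cauchy_schwarz sw sp; have := fine_ge0 n0; have := fine_ge0 n1.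
move: (sqn _) (fine _) (fine _) => b s t t0 s0 bs.
have [->|sn] := eqVneq s 0; first by rewrite mulr0.
have -> : b * s^-1 ^+ 2 * s = b / s by field.
by rewrite ler_pdivrMr// lt0r sn.
Qed.

Lemma multiplier_exists (w : L2R) : W w -> exists2 m, cmeasurable m /\ periodic m &
  {ae mu, forall x, hatL2 w x = m x * p x}.
Proof.
move=> Ww; exists (mult w) => //.
have [h /L2_ae_eq hE'] := hatL2_surj (L2mk (square_mult w)).
have hE : {ae mu, forall x, hatL2 h x = mult w x * p x} by exact: hE'.
(* Membership of [h] puts [w - h] in [W], where the frame inequality may be applied to it. *)
have Wh : W h by exact: (multiplier_mem (cmeasurable_mult w) (@periodic_mult w) hE').
suff : N (w - h) = 0.
  rewrite -hatL2B => /L2_ae_eq; by apply: ae_lebesgueS2 hE => x <-.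
have WG : W (w - h).
  have [_ _ lin _] := closedW; have := lin (-1) _ _ Wh Ww.
  rewrite (_ : (fun x => _) = L2val (w - h))//; apply/funext => x.
  by rewrite L2subE mulN1r addrC.
have [_ [alpha [beta [alpha0 _ /(_ _ WG)[low _]]]]] := frameW.
have /bracket_orthogonal orth : {ae mu, forall x, bracket (hatL2 (w - h)) p x = 0}.
  have GE : {ae mu, forall x, forall k : int, hatL2 (w - h) (x + k%:~R) =
      - mult w (x + k%:~R) * p (x + k%:~R) + hatL2 w (x + k%:~R)}.
    apply: (@ae_all_shifts _ (fun y => hatL2 (w - h) y = - mult w y * p y + hatL2 w y)).
    have := hatL2_ae_lin (-1) h w; rewrite scaleN1r addrC.
    by apply: ae_lebesgueS2 hE => x E ->; rewrite E mulN1r mulNr.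
  have sp := ae_square_summable (L2_square p).
  have := ae_lebesgueS2 (fun x a b => conj a b) sp (ae_square_summable (L2_square (hatL2 w))).
  apply: ae_lebesgueS2 GE => x GE [spx swx].
  rewrite (@eq_bracket _ _ p (fun y => - mult w x * p y + hatL2 w y) p)//; last first.
    by move=> k; rewrite GE periodic_mult.
  rewrite bracket_linl// bracket_self// /mult mulNr -mulrA -rmorphM/= addrC.
  have [s0|s0] := eqVneq (fine (square_sum p x)) 0; last by rewrite mulVf// mulr1 subrr.
  (* Where [[p, p] = 0] the multiplier has the default value 0, and Cauchy-Schwarz makes [[w, p]]
     vanish as well. *)
  rewrite s0 mulr0 mulr0 subr0.
  have := bracket_cauchy_schwarz swx spx; rewrite s0 mulr0 => b0.
  by apply: sqn_eq0; apply/eqP; rewrite eq_le b0 sqn_ge0.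
(* All frame coefficients of [w - h] are zero, so [alpha] times its squared norm is at most 0. *)
move: low; rewrite esum1; last by move=> k _; rewrite orth normc0 expr0n.
rewrite normsq_L2 -EFinM lee_fin pmulr_rle0// => G0.
by apply/eqP; rewrite eq_le G0 (hnorm2_ge0 Hip).
Qed.

End FrameMultipliers.

(** * The quotient formula for the oblique projection *)

Section FrameQuotient.
Context {R : realType}.
Local Notation mu := (@lebesgue_measure R).
Local Notation L2R := (L2 mu).
Local Notation ip := (@L2ip _ _ _ mu).
Local Notation N := (hnorm2 ip).
Let Hip : prehilbert ip := L2_prehilbert mu.
Implicit Types (u v w : L2R) (m : measurableTypeR R -> R[i]).

Lemma bracket_multiplier u v w m : periodic m -> {ae mu, forall x, u x = m x * v x} ->
  {ae mu, forall x, bracket u w x = m x * bracket v w x}.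
Proof.
move=> pm /ae_all_shifts uE.
have sv := ae_square_summable (L2_square v).
have := ae_lebesgueS2 (fun x a b => conj a b) sv (ae_square_summable (L2_square w)).
apply: ae_lebesgueS2 uE => x uE [svx swx].
by rewrite (@eq_bracket _ _ w (fun y => m y * v y) w)// bracket_mull.
Qed.

Variables (W V : set (R -> R[i])) (phi phi1 : L2R).
Hypothesis closedW : closed_subspace W.
Hypothesis closedV : closed_subspace V.
Hypothesis sumWV : direct_sum_L2 W (orthogonal_complement V).
Hypothesis frameW : is_frame W (fun k => translate k phi).
Hypothesis frameV : is_frame V (fun k => translate k phi1).
Let p := hatL2 phi.
Let q := hatL2 phi1.

Lemma ae_bracket_eq0 : {ae mu, forall x, bracket p q x = 0 -> p x = 0}.
Proof.
pose E : set (measurableTypeR R) := [set x | bracket p q x = 0].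
pose m (x : measurableTypeR R) : R[i] := (\1_E x)%:C.
have mE : measurable E.
  have [mR mI] := cmeasurable_bracket (L2_meas p) (L2_meas q).
  have -> : E = ((fun x => complex.Re (bracket p q x)) @^-1` [set 0]) `&`
      ((fun x => complex.Im (bracket p q x)) @^-1` [set 0]).
    apply/seteqP; split => x [xR xI]; last exact: complexP.
    by split; [exact: xR|exact: xI].
  apply: measurableI; rewrite -[X in measurable X]setTI; first exact: mR.
  exact: mI.
have mm : cmeasurable m by apply: cmeasurable_real; exact: measurable_indic.
have pm : periodic m.
  move=> x k; rewrite /m !indicE -[x + _ \in E]/`[<bracket p q (x + k%:~R) = 0>].
  by rewrite bracket_periodic.
have mp2 : csquare_integrable mu (fun x => m x * p x).
  have [mp poo] := L2_square p; have mmp := cmeasurableM mm mp.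
  split => //; apply: le_lt_trans poo; apply: ge0_le_integral => //.
  - by move=> x _; rewrite lee_fin sqn_ge0.
  - exact: measurable_EFin_sqn.
  - exact: measurable_EFin_sqn.
  - move=> x _; rewrite lee_fin sqnM sqn_real indicE.
    by case: (_ \in _); rewrite ?expr1n ?mul1r// expr0n mul0r sqn_ge0.
have [h /L2_ae_eq hE'] := hatL2_surj (L2mk mp2).
have hE : {ae mu, forall x, hatL2 h x = m x * p x} by exact: hE'.
have Wh : W h := multiplier_mem closedW frameW mm pm hE'.
have Uh : orthogonal_complement V h.
  split; first by apply/L2funP; exact: L2_square.
  move=> g Vg; have [sV _ _ _] := closedV; have /L2funP g2 := sV _ Vg.
  pose g' : L2R := L2mk g2; rewrite -[inner h g]/(ip h g').
  have [m1 [mm1 pm1] gE] := multiplier_exists (w := g') closedV frameV Vg.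
  have meas : cmeasurable (fun x => m x * p x * (hatL2 g' x)^*).
    by apply: cmeasurableM; [apply: cmeasurableM => //; exact: L2_meas|exact/cmeasurableJ/L2_meas].
  have Ehg : {ae mu, forall x, hatL2 h x * (hatL2 g' x)^* = m x * p x * (hatL2 g' x)^*}.
    by apply: ae_lebesgueS hE => x ->.
  have b0 : {ae mu, forall x, m x * bracket p (hatL2 g') x = 0}.
    have sp := ae_square_summable (L2_square p).
    have sg := ae_square_summable (L2_square (hatL2 g')).
    have sq := ae_square_summable (L2_square q).
    (* [bracket_multiplier] acts on the first argument, so the multiplier of [g'] is extracted from
       [[g', p]] and carried over to [[p, g']] by conjugation. *)
    have pg := ae_lebesgueS2 (fun x sp sg => bracketC sg sp) sp sg.
    have pq := ae_lebesgueS2 (fun x sp sq => bracketC sp sq) sp sq.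
    have := ae_lebesgueS2 (fun x a b => conj a b) pg pq.
    apply: ae_lebesgueS2 (bracket_multiplier p pm1 gE) => x Eg [-> Eq].
    rewrite Eg Eq conjcM conjcK /m indicE.
    have [|] := boolP (x \in E); last by rewrite mul0r.
    by rewrite inE /E/= => ->; rewrite !mulr0.
  rewrite -hatL2_ip -(cint_bracket_ae_eq0 mm pm _ b0).
    by apply: cint_ae => //; exact/cintegrable_meas/L2_cintegrable.
  exact: (cintegrable_ae (L2_cintegrable _ _) meas Ehg).
have [_ /(_ h Wh Uh) h0] := sumWV.
have /L2_ae_eq hh0 : N (hatL2 h - hatL2 0) = 0.
  rewrite hatL2B; apply: hnorm2_L2_ae; apply: ae_lebesgueS h0 => x /(_ Logic.I) E0.
  by rewrite subr0 E0.
(* The transform of 0 is known to be 0 only almost everywhere, by isometry. *)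
have h00 : N (hatL2 (0 : L2R)) = 0 by rewrite /hnorm2 hatL2_ip (ip0l Hip).
have := ae_lebesgueS2 (fun x a b => conj a b) hh0 (hnorm2_L2_eq0 h00).
apply: ae_lebesgueS2 hE => x Ex [Ex1 Ex2] xE.
by move: Ex; rewrite Ex1 Ex2 /m indicE mem_set// mul1r.
Qed.

Variable f : L2R.

(** The direct sum splits [f] almost everywhere, whereas the definition wants the function [f - w]
    itself in the complement; inner products do not distinguish it from [u]. *)
Lemma oblique_projection_spec :
  let w := oblique_projection W (orthogonal_complement V) f in
  W w /\ orthogonal_complement V (fun x => f x - w x).
Proof.
suff ex : exists w : R -> R[i], [set w : R -> R[i] | W w /\ orthogonal_complement V (fun x => f x - w x)] w.
  exact: (xgetPex (cst 0) ex).
have [sW _ _ _] := closedW; have [sV _ _ _] := closedV.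
have [+ _] := sumWV => /(_ f ((L2funP f).2 (L2_square f)))[w [u [Ww Uu E]]].
have w2 := sW _ Ww; exists w; split => //.
have fw2 : csquare_integrable mu (fun x => f x - w x).
  exact: (L2_square (f - L2mk ((L2funP w).1 w2))).
split; first exact/L2funP.
move=> g Vg; have [/L2funP u2 /(_ g Vg) <-] := Uu; have /L2funP g2 := sV _ Vg.
apply: cint_ae.
- exact: (cintegrable_meas (cintegrable_mulJ fw2 g2)).
- exact: (cintegrable_meas (cintegrable_mulJ u2 g2)).
- by apply: ae_lebesgueS E => x /(_ Logic.I) ->; rewrite addrAC subrr add0r.
Qed.

Lemma fourier_oblique_projection : {ae mu, forall x,
  fourier (oblique_projection W (orthogonal_complement V) f) x =
  if x \in ~` zero_set (periodization phi) then
    bracket (hatL2 f) q x / bracket p q x * p x else 0}.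
Proof.
have [] := oblique_projection_spec; set w0 := oblique_projection _ _ _ => Ww [_ orth].
have [sW _ _ _] := closedW; have /L2funP w2 := sW _ Ww.
pose w : L2R := L2mk w2.
have [m [_ pm] wE] := multiplier_exists (w := w) closedW frameW Ww.
have /bracket_orthogonal d0 : forall k, inner (f - w) (translate k phi1) = 0.
  by move=> k; have [Vk _] := frameV; exact: (orth _ (Vk k)).
have dE : {ae mu, forall x, forall k : int,
    hatL2 f (x + k%:~R) = 1 * hatL2 (f - w) (x + k%:~R) + hatL2 w (x + k%:~R)}.
  apply: (@ae_all_shifts _ (fun y => hatL2 f y = 1 * hatL2 (f - w) y + hatL2 w y)).
  by have := hatL2_ae_lin 1 (f - w) w; rewrite scale1r subrK.
have sp := ae_square_summable (L2_square p).
have sq := ae_square_summable (L2_square q).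
have sd := ae_square_summable (L2_square (hatL2 (f - w))).
have sw := ae_square_summable (L2_square (hatL2 w)).
have fw : {ae mu, forall x, bracket (hatL2 f) q x = bracket (hatL2 w) q x}.
  have s := ae_lebesgueS2 (fun x a b => conj a b) sd (ae_lebesgueS2 (fun x a b => conj a b) sw sq).
  have := ae_lebesgueS2 (fun x a b => conj a b) d0 s.
  apply: ae_lebesgueS2 dE => x Ef [d0x [sdx [swx sqx]]].
  rewrite (@eq_bracket _ _ q (fun y => 1 * hatL2 (f - w) y + hatL2 w y) q)//.
  by rewrite bracket_linl// d0x mulr0 add0r.
(* [periodization phi] sees the whole fibre, so vanishing of [p] has to be inferred at every point
   of it. *)
have nz := ae_all_shifts ae_bracket_eq0.
have A := ae_lebesgueS2 (fun x a b => conj a b) fw (bracket_multiplier q pm wE).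
have B := ae_lebesgueS2 (fun x a b => conj a b) sp sq.
have C := ae_lebesgueS2 (fun x a b => conj a b) nz wE.
have := ae_lebesgueS2 (fun x a b => conj a b) A B.
apply: ae_lebesgueS2 C => x [nzx wx] [[fx bx] [spx sqx]].
have PE : periodization phi x = square_sum p x.
  by apply: eq_esum => k _; rewrite normc_sqr.
rewrite -[fourier _ x]/(hatL2 w x) wx fx bx.
have [] := boolP (x \in _) => [/set_mem|/negP xN].
  rewrite /zero_set /setC /mkset PE => S0.
  (* A zero of the periodic bracket at [x] is a zero at every [x + k], which would make [p] vanish
     on the whole fibre. *)
  have pq0 : bracket p q x != 0.
    apply: contra_notN S0 => /eqP pq0; apply: esum1 => k _.
    by rewrite nzx ?bracket_periodic// /sqn/= expr0n/= addr0.
  by rewrite mulfK.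
have S0 : square_sum p x = 0%E.
  by apply: contrapT => S0; apply: xN; apply: mem_set; rewrite /zero_set /setC /mkset PE.
(* If the periodization is 0 then so is [[p, q]], by Cauchy-Schwarz, and the shift by 0 in [nzx]
   gives [p x = 0]. *)
have p0 : p x = 0.
  have := nzx 0; rewrite addr0; apply; apply: sqn_eq0; apply/eqP.
  rewrite eq_le sqn_ge0 andbT.
  by apply: (le_trans (bracket_cauchy_schwarz spx sqx)); rewrite S0 mul0r.
by rewrite p0 mulr0.
Qed.

End FrameQuotient.

Theorem theorem8p3 (R : realType) (W V : set (R -> R[i])) (phi phi1 : R -> R[i])
    (closedW : closed_subspace W) (closedV : closed_subspace V)
    (sumWV : direct_sum_L2 W (orthogonal_complement V))
    (phiL2 : L2fun phi) (phi1L2 : L2fun phi1)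
    (frameW : is_frame W (fun k => translate k phi))
    (frameV : is_frame V (fun k => translate k phi1))
    (f : R -> R[i]) (fL2 : L2fun f) :
  \forall gamma \ae @lebesgue_measure R,
    fourier (oblique_projection W (orthogonal_complement V) f) gamma =
    if gamma \in ~` zero_set (periodization phi) then
      bracket (fourier f) (fourier phi1) gamma /
      bracket (fourier phi) (fourier phi1) gamma * fourier phi gamma
    else 0.
Proof.
move: phiL2 phi1L2 fL2 => /L2funP phi2 /L2funP phi12 /L2funP f2.
exact: (fourier_oblique_projection (phi := L2mk phi2) (phi1 := L2mk phi12)
  closedW closedV sumWV frameW frameV (L2mk f2)).
Qed.
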